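(* Let $H$ be a Wigner-type matrix satisfying (A), (B), (C), let $E_0\in\mathfrak S$, let $\varepsilon_0>0$ be a fixed small constant, and let $c_0>0$ be a sufficiently small $N$-independent constant. Let $z,\zeta\in\mathbb D_{E_0,c_0}\cap\mathbb H$. Then the smallest-modulus eigenvalues $\beta(z,\zeta)$ of $B(z,\zeta)$ and $\beta(\bar z,\zeta)$ of $B(\bar z,\zeta)$ satisfy $$\beta(z,\zeta)=\frac{\pi}{\langle\mathbf f(z)^2\rangle}\frac{\zeta-z}{\xi(z,\zeta)}\Big(1+\mathcal O\big(|\xi(z,\zeta)|+\rho(z)+\rho(z)^{-1}|\mathrm{Im}\,z|\big)\Big)\qquad(z\neq\zeta),$$ $$\beta(\bar z,\zeta)=\frac{\pi}{\langle\mathbf f(z)^2\rangle}\frac{\zeta-\bar z}{\xi(z,\zeta)+2i\rho(z)}\Big(1+\mathcal O\big(|\xi(z,\zeta)|+\rho(z)+\rho(z)^{-1}|\mathrm{Im}\,z|\big)\Big).$$ The implicit constants depend only on the constants in (A), (B), (C).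
   Context: Wigner-type matrices: $H=(H_{jk})_{j,k=1}^N$ is an $N\times N$ random matrix with $H=H^*$ (real symmetric, or complex Hermitian with $\mathrm{Re}\,H_{jk},\mathrm{Im}\,H_{jk}$ independent and $\mathbb E[H_{jk}^2]=0$ for $j\neq k$), independent entries up to symmetry, $\mathbb E[H_{jk}]=0$, $S_{jk}:=\mathbb E|H_{jk}|^2$. Assumptions (constants positive, independent of $N$): (A) $c_{inf}/N\le S_{jk}\le C_{sup}/N$; (B) for every $p\in\mathbb N$, $\mathbb E|\sqrt NH_{jk}|^p\le C_p$; (C) the unique solution $\mathbf m(z)=(m_j(z))_{j=1}^N$ of $-1/m_j(z)=z+\sum_kS_{jk}m_k(z)$, $\mathrm{Im}\,m_j(z)\,\mathrm{Im}\,z>0$, satisfies $|m_j(z)|\le C_{\mathrm m}$. Here $\mathbf m(\bar z)=\overline{\mathbf m(z)}$ and $\mathbf m$ extends continuously from the upper half-plane $\mathbb H$ to $\overline{\mathbb H}$. Notation: $\langle\mathbf x,\mathbf y\rangle=N^{-1}\sum_j\overline{x_j}y_j$, $\langle\mathbf x\rangle=N^{-1}\sum_jx_j$; products and functions of vectors are entrywise, and vectors also denote diagonal matrices. $\rho(z):=\pi^{-1}\langle\mathrm{Im}\,\mathbf m(z)\rangle$ for $z\in\overline{\mathbb H}$; $\mathfrak S:=\{E\in\mathrm{supp}\,\rho|_{\mathbb R}:\rho(E)=0\}$; $\mathbb D_{E_0,c_0}:=\{z\in\mathbb C:|z-E_0|\le c_0N^{-\varepsilon_0/3}\}$. Stability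 operator: $B(z,\zeta):=1-\mathbf m(z)\mathbf m(\zeta)S$. There is $\epsilon\sim1$ such that for $z\in\mathbb D_{E_0,c_0}\cap\mathbb H$ (with $c_0$ small) $B(z,z)$ has a single simple eigenvalue in $\{|w|\le\epsilon\}$, isolated from the rest of its spectrum; $\Pi(z,z):=\frac1{2\pi i}\oint_{|w|=\epsilon}(w-B(z,z))^{-1}\mathrm dw$ is the corresponding (non-orthogonal) spectral projection. For $z\in\mathbb H$: $F(z):=|\mathbf m(z)|S|\mathbf m(z)|$; $\mathbf v(z)$ is the entrywise positive eigenvector of $F(z)$ for its largest eigenvalue with $\langle\mathbf v,\mathbf v\rangle=1$; $\mathbf f(z):=\rho(z)^{-1}\,\mathrm{Im}\,\mathbf m(z)/|\mathbf m(z)|$; $$\mathbf b(z):=\Pi(z,z)\big[|\mathbf m(z)|\mathbf v(z)\big]\langle\mathbf v(z),\mathbf f(z)\rangle,\qquad\mathbf b^\ell(z):=\Pi(z,z)^*\big[|\mathbf m(z)|^{-1}\mathbf v(z)\big]\langle\mathbf v(z),\mathbf f(z)\rangle,$$ which are right and left eigenvectors of $B(z,z)$; and $\xi(z,\zeta):=\dfrac{\langle\mathbf b^\ell(z),\mathbf m(\zeta)-\mathbf m(z)\rangle}{\langle\mathbf b^\ell(z),\mathbf b(z)\rangle}$. *)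

(* Defs.v *)
From mathcomp Require Import all_boot all_order all_algebra.
From mathcomp Require Import all_classical all_reals all_analysis.
From mathcomp Require Import complex.

Set Implicit Arguments.
Unset Strict Implicit.
Unset Printing Implicit Defensive.

Import Order.TTheory GRing.Theory Num.Theory.
Import numFieldNormedType.Exports.

Local Open Scope classical_set_scope.
Local Open Scope ring_scope.
Local Open Scope complex_scope.

(* Vectors are columns.  The modulus is taken in [R] through [cabs], since the
   norm [`| z |] of [z : R[i]] is again an element of [R[i]]. *)

Definition cabs (R : realType) (z : R[i]) : R := ComplexField.Normc.normc z.

Definition adjmx (R : realType) (m n : nat) (A : 'M[R[i]]_(m, n)) :
  'M[R[i]]_(n, m) := (map_mx (@conjc R) A)^T.

Definition vmul (K : fieldType) (N : nat) (x y : 'cV[K]_N) : 'cV[K]_N :=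
  \col_j (x j 0 * y j 0).

Definition avg (K : fieldType) (N : nat) (x : 'cV[K]_N) : K :=
  N%:R^-1 * \sum_j x j 0.

(* On real vectors the scalar product is [avg (vmul x y)]. *)
Definition cdot (R : realType) (N : nat) (x y : 'cV[R[i]]_N) : R[i] :=
  avg (vmul (map_mx (@conjc R) x) y).

Definition cvec (R : realType) (N : nat) (x : 'cV[R]_N) : 'cV[R[i]]_N :=
  map_mx (fun t : R => t%:C) x.

Definition im_vec (R : realType) (N : nat) (x : 'cV[R[i]]_N) : 'cV[R]_N :=
  map_mx (@complex.Im R) x.

Definition abs_vec (R : realType) (N : nat) (x : 'cV[R[i]]_N) : 'cV[R]_N :=
  map_mx (@cabs R) x.

Definition Hplane (R : realType) : set R[i] := [set z | 0 < complex.Im z].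

Definition cexpectation (R : realType) (d : measure_display)
    (T : measurableType d) (P : probability T R) (X : T -> R[i]) : R[i] :=
  fine 'E_P[fun w => complex.Re (X w)]
    +i* fine 'E_P[fun w => complex.Im (X w)].

Definition re_im_independent (R : realType) (d : measure_display)
    (T : measurableType d) (P : probability T R) (X : T -> R[i]) : Prop :=
  forall A B : set R, measurable A -> measurable B ->
    P [set w | A (complex.Re (X w)) /\ B (complex.Im (X w))] =
    (P [set w | A (complex.Re (X w))] * P [set w | B (complex.Im (X w))])%E.

(* Mutual independence of the complex variables [H j k], [j <= k]; Borel sets
   of the complex plane are those of [R * R]. *)
Definition indep_up_to_symmetry (R : realType) (d : measure_display)
    (T : measurableType d) (P : probability T R) (N : nat)
    (H : T -> 'M[R[i]]_N) : Prop :=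
  forall (J : {set 'I_N * 'I_N}) (A : 'I_N * 'I_N -> set (R * R)),
    (forall p, p \in J -> (p.1 <= p.2)%N) ->
    (forall p, measurable (A p)) ->
    P [set w | forall p, p \in J ->
         A p (complex.Re (H w p.1 p.2), complex.Im (H w p.1 p.2))] =
    (\prod_(p in J)
      P [set w | A p (complex.Re (H w p.1 p.2), complex.Im (H w p.1 p.2))])%E.

Definition real_symmetric (R : realType) (T : Type) (N : nat)
    (H : T -> 'M[R[i]]_N) : Prop :=
  forall w j k, complex.Im (H w j k) = 0.

Definition complex_hermitian (R : realType) (d : measure_display)
    (T : measurableType d) (P : probability T R) (N : nat)
    (H : T -> 'M[R[i]]_N) : Prop :=
  forall j k, j != k ->
    re_im_independent P (fun w => H w j k) /\
    cexpectation P (fun w => H w j k ^+ 2) = 0.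

Definition wigner_type (R : realType) (d : measure_display)
    (T : measurableType d) (P : probability T R) (N : nat)
    (H : T -> 'M[R[i]]_N) : Prop :=
  [/\ forall j k,
        measurable_fun setT (fun w => complex.Re (H w j k)) /\
        measurable_fun setT (fun w => complex.Im (H w j k)),
      forall w, H w = adjmx (H w),
      real_symmetric H \/ complex_hermitian P H,
      indep_up_to_symmetry P H &
      forall j k, cexpectation P (fun w => H w j k) = 0].

Definition variance_mx (R : realType) (d : measure_display)
    (T : measurableType d) (P : probability T R) (N : nat)
    (H : T -> 'M[R[i]]_N) : 'M[R]_N :=
  \matrix_(j, k) fine 'E_P[fun w => (cabs (H w j k) ^+ 2)%R].

Definition assumptionA (R : realType) (N : nat) (c_inf C_sup : R)
    (S : 'M[R]_N) : Prop :=
  forall j k, c_inf / N%:R <= S j k <= C_sup / N%:R.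

Definition assumptionB (R : realType) (d : measure_display)
    (T : measurableType d) (P : probability T R) (N : nat) (C_mom : nat -> R)
    (H : T -> 'M[R[i]]_N) : Prop :=
  forall (p : nat) j k,
    ('E_P[fun w => ((Num.sqrt N%:R * cabs (H w j k)) ^+ p)%R] <= (C_mom p)%:E)%E.

(* [m] solves the equation off the real axis, and on the real axis it is the
   boundary value from the upper half-plane. *)
Definition qve_solution (R : realType) (N : nat) (S : 'M[R]_N)
    (m : R[i] -> 'cV[R[i]]_N) : Prop :=
  [/\ forall (z : R[i]) j, complex.Im z != 0 ->
        - (m z j 0)^-1 = z + \sum_k (S j k)%:C * m z k 0,
      forall (z : R[i]) j, complex.Im z != 0 ->
        0 < complex.Im (m z j 0) * complex.Im z &
      forall (E : R) j,
        m z j 0 @[z --> within (@Hplane R) (nbhs (E%:C : R[i]^o))]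
          --> (m E%:C j 0 : R[i]^o)].

Definition assumptionC (R : realType) (N : nat) (C_m : R)
    (m : R[i] -> 'cV[R[i]]_N) : Prop :=
  forall (z : R[i]) j, complex.Im z != 0 -> cabs (m z j 0) <= C_m.

Definition rho (R : realType) (N : nat) (m : R[i] -> 'cV[R[i]]_N) (z : R[i]) :
  R := pi^-1 * avg (im_vec (m z)).

Definition singular_set (R : realType) (N : nat) (m : R[i] -> 'cV[R[i]]_N) :
  set R :=
  [set E | closure [set x : R | rho m x%:C != 0] E /\ rho m E%:C = 0].

Definition Ddisk (R : realType) (N : nat) (E0 eps0 c0 : R) : set R[i] :=
  [set z | cabs (z - E0%:C) <= c0 * N%:R `^ (- (eps0 / 3))].

Definition Bop (R : realType) (N : nat) (S : 'M[R]_N)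
    (m : R[i] -> 'cV[R[i]]_N) (z zeta : R[i]) : 'M[R[i]]_N :=
  1%:M - \matrix_(j, k) (m z j 0 * m zeta j 0 * (S j k)%:C).

Definition smallest_eigenvalue (R : realType) (N : nat) (A : 'M[R[i]]_N)
    (beta : R[i]) : Prop :=
  eigenvalue A beta /\ forall w, eigenvalue A w -> cabs beta <= cabs w.

(* The eigenvalue lies in the open disk so that the circle of radius [eps] does
   not meet the spectrum; simplicity is algebraic. *)
Definition isolated_simple_eigenvalue (R : realType) (N : nat)
    (A : 'M[R[i]]_N) (eps : R) : Prop :=
  exists beta : R[i],
    [/\ eigenvalue A beta, cabs beta < eps, mup beta (char_poly A) = 1%N &
        forall w, eigenvalue A w -> cabs w <= eps -> w = beta].

Definition circle (R : realType) (eps t : R) : R[i] :=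
  (eps * cos t) +i* (eps * sin t).

Definition circle_integral (R : realType) (eps : R) (g : R[i] -> R[i]) :
    R[i] :=
  let h t := g (circle eps t) * ('i%C * circle eps t) in
  (\int[lebesgue_measure]_(t in `[0, 2 * pi]) complex.Re (h t))
    +i* (\int[lebesgue_measure]_(t in `[0, 2 * pi]) complex.Im (h t)).

Definition spectral_projection (R : realType) (N : nat) (A : 'M[R[i]]_N)
    (eps : R) : 'M[R[i]]_N :=
  \matrix_(j, k) ((2 * pi%:C * 'i%C)^-1 *
     circle_integral eps (fun w => invmx (w%:M - A) j k)).

Definition Fop (R : realType) (N : nat) (S : 'M[R]_N)
    (m : R[i] -> 'cV[R[i]]_N) (z : R[i]) : 'M[R]_N :=
  \matrix_(j, k) (cabs (m z j 0) * S j k * cabs (m z k 0)).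

Definition top_eigenvector (R : realType) (N : nat) (F : 'M[R]_N)
    (v : 'cV[R]_N) : Prop :=
  [/\ forall j, 0 < v j 0,
      exists lambda : R, [/\ eigenvalue F lambda, F *m v = lambda *: v &
        forall mu, eigenvalue F mu -> mu <= lambda] &
      avg (vmul v v) = 1].

Definition fvec (R : realType) (N : nat) (m : R[i] -> 'cV[R[i]]_N)
    (z : R[i]) : 'cV[R]_N :=
  \col_j ((rho m z)^-1 * (complex.Im (m z j 0) / cabs (m z j 0))).

Definition b_right (R : realType) (N : nat) (S : 'M[R]_N) (eps : R)
    (m : R[i] -> 'cV[R[i]]_N) (v : R[i] -> 'cV[R]_N) (z : R[i]) :
    'cV[R[i]]_N :=
  (avg (vmul (v z) (fvec m z)))%:C *:
    (spectral_projection (Bop S m z z) eps *m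
       cvec (vmul (abs_vec (m z)) (v z))).

Definition b_left (R : realType) (N : nat) (S : 'M[R]_N) (eps : R)
    (m : R[i] -> 'cV[R[i]]_N) (v : R[i] -> 'cV[R]_N) (z : R[i]) :
    'cV[R[i]]_N :=
  (avg (vmul (v z) (fvec m z)))%:C *:
    (adjmx (spectral_projection (Bop S m z z) eps) *m
       cvec (vmul (map_mx GRing.inv (abs_vec (m z))) (v z))).

Definition xi (R : realType) (N : nat) (S : 'M[R]_N) (eps : R)
    (m : R[i] -> 'cV[R[i]]_N) (v : R[i] -> 'cV[R]_N) (z zeta : R[i]) : R[i] :=
  cdot (b_left S eps m v z) (m zeta - m z) /
  cdot (b_left S eps m v z) (b_right S eps m v z).

Definition error_bound (R : realType) (N : nat) (S : 'M[R]_N) (eps : R)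
    (m : R[i] -> 'cV[R[i]]_N) (v : R[i] -> 'cV[R]_N) (z zeta : R[i]) : R :=
  cabs (xi S eps m v z zeta) + rho m z + (rho m z)^-1 * `|complex.Im z|.

(* [beta = pi / <f(z)^2> * num / den * (1 + O(err))] with implicit constant
   [C]; [den != 0] is required because division is total. *)
Definition beta_expansion (R : realType) (N : nat)
    (m : R[i] -> 'cV[R[i]]_N) (z : R[i]) (C err : R) (num den beta : R[i]) :
    Prop :=
  den != 0 /\
  exists r : R[i], cabs r <= C * err /\
    beta = (pi / avg (vmul (fvec m z) (fvec m z)))%:C * (num / den) * (1 + r).

(* Main.v *)
(* With [F = |m| S |m|] at [z], conjugation by [|m(z)|] turns [B(z, zeta)] into [1 - U F], where
   [U = m(z) m(zeta) / |m(z)|^2] is close to [1] when [z], [zeta] are close to a singular point.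
   [F] has top eigenvalue [1 - O(Im z / rho)] and a uniform gap, so [1 - U F] has exactly one
   eigenvalue [beta] near [0], with right eigenvector [r] close to [v] and, [F] being symmetric,
   left eigenvector [l = r / U].  The difference [g = (m(zeta) - m(z)) / |m(z)|] of two solutions
   satisfies [(1 - U F) g = (zeta - z) q], [q = m(z) m(zeta) / |m(z)|], so pairing with [l] gives the
   exact identity [beta <l, g> = (zeta - z) <l, q>].  To leading order [g] is [xi <v, f> v],
   [<v, f>^2] is [<f^2>] and [<v, f> <l, q>] is [<f, |m|> = pi], which is the claim; comparing
   [m(zeta)] with the conjugate of [m(z)] instead shifts [xi] by [2 i rho].
   The smallness of [U - 1], [g] and [Im z / rho] near a singular point comes from a uniform
   1/3-Hoelder bound for the solution, compared with points where [rho] or [Im z / rho] is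
   arbitrarily small.  The contour integral is the rank-one projection [r l / <l, r>] because the
   resolvent has an explicit geometric Laurent series on the circle. *)

(* The Hoelder bound cannot come from inverting the linearized equation, whose inverse blows up
   exactly at the points of interest. It comes from positivity. The imaginary parts of two
   solutions, normalized to mean 1, give by Cauchy-Schwarz a nonnegative weight that controls the
   distance of the two profiles and both ratios of [Im z] to the mean imaginary part. With [G] the
   sup distance of the solutions and [w] the distance of the spectral parameters, an energy
   inequality gives [G * gap <= C |w|] for the profile, ratio and phase gaps. These gaps in turn
   bound [G ^ 2], whence [G ^ 3 <= C |w|]. With [w = 0] this is uniqueness, which supplies the
   symmetry of [m] under conjugation.

   For the expansions the error must be relative to the denominator, which may be arbitrarily small.
   So [zeta - z] is first eliminated by pairing the equation of the difference with the left
   eigenvector, and the difference is expanded in terms of its own amplitude.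

   One constant [B] dominates the others, and smallness is drawn from conditions
   [B ^ 30 * x <= e]. *)
Require Import Defs.
From mathcomp Require Import all_boot all_order all_algebra.
From mathcomp Require Import all_classical all_reals all_analysis.
From mathcomp Require Import complex.
From mathcomp Require Import ring lra.

Set Implicit Arguments.
Unset Strict Implicit.
Unset Printing Implicit Defensive.

Import Order.TTheory GRing.Theory Num.Theory.
Import numFieldNormedType.Exports.

Local Open Scope classical_set_scope.
Local Open Scope ring_scope.
Local Open Scope complex_scope.

(** * Moduli and averages *)

Section Modulus.
Variable R : realType.
Implicit Types x y z : R[i].

Lemma cabsM x y : cabs (x * y) = cabs x * cabs y.
Proof. exact: ComplexField.Normc.normcM. Qed.

Lemma cabsD x y : cabs (x + y) <= cabs x + cabs y.
Proof. exact: le_normcD. Qed.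

Lemma cabsN x : cabs (- x) = cabs x.
Proof. exact: normcN. Qed.

Lemma cabsB x y : cabs (x - y) <= cabs x + cabs y.
Proof. by rewrite -(cabsN y) cabsD. Qed.

Lemma cabsC x y : cabs (x - y) = cabs (y - x).
Proof. by rewrite -cabsN opprB. Qed.

Lemma cabsV x : cabs x^-1 = (cabs x)^-1.
Proof. exact: ComplexField.Normc.normcV. Qed.

Lemma cabs0 : cabs (0 : R[i]) = 0.
Proof. exact: ComplexField.Normc.normc0. Qed.

Lemma cabs1 : cabs (1 : R[i]) = 1.
Proof. exact: ComplexField.Normc.normc1. Qed.

Lemma cabs_ge0 x : 0 <= cabs x.
Proof. by case: x => a b; exact: sqrtr_ge0. Qed.

Lemma cabs_sqr x : cabs x ^+ 2 = complex.Re x ^+ 2 + complex.Im x ^+ 2.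
Proof. by case: x => a b; rewrite /cabs /= sqr_sqrtr // addr_ge0 ?sqr_ge0. Qed.

Lemma cabs_eq0 x : (cabs x == 0) = (x == 0).
Proof.
apply/eqP/eqP => [/ComplexField.Normc.eq0_normc //|->]; exact: cabs0.
Qed.

Lemma cabs_gt0 x : (0 < cabs x) = (x != 0).
Proof. by rewrite lt0r cabs_eq0 cabs_ge0 andbT. Qed.

Lemma cabs_real (a : R) : cabs a%:C = `|a|.
Proof. by rewrite /cabs /= expr0n addr0 sqrtr_sqr. Qed.

Lemma cabs_i : cabs ('i%C : R[i]) = 1.
Proof. by rewrite /cabs /= expr0n add0r expr1n sqrtr1. Qed.

Lemma cabsX x n : cabs (x ^+ n) = cabs x ^+ n.
Proof. by elim: n => [|n IH]; rewrite ?expr0 ?cabs1 // !exprS cabsM IH. Qed.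

Lemma cabs_conj x : cabs (conjc x) = cabs x.
Proof. by case: x => a b; rewrite /cabs /= sqrrN. Qed.

Lemma cabs_Re x : `|complex.Re x| <= cabs x.
Proof.
rewrite -(@ler_pXn2r _ 2) ?nnegrE ?cabs_ge0 ?normr_ge0 //.
by rewrite cabs_sqr real_normK ?num_real // lerDl sqr_ge0.
Qed.

Lemma cabs_Im x : `|complex.Im x| <= cabs x.
Proof.
rewrite -(@ler_pXn2r _ 2) ?nnegrE ?cabs_ge0 ?normr_ge0 //.
by rewrite cabs_sqr real_normK ?num_real // lerDr sqr_ge0.
Qed.

Lemma cabs_le_ReIm x : cabs x <= `|complex.Re x| + `|complex.Im x|.
Proof.
rewrite -(@ler_pXn2r _ 2) ?nnegrE ?cabs_ge0 ?addr_ge0 ?normr_ge0 //.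
rewrite cabs_sqr sqrrD !real_normK ?num_real //.
have := mulr_ge0 (normr_ge0 (complex.Re x)) (normr_ge0 (complex.Im x)); lra.
Qed.

Lemma cReM x y : complex.Re (x * y) =
  complex.Re x * complex.Re y - complex.Im x * complex.Im y.
Proof. by case: x; case: y. Qed.

Lemma cImM x y : complex.Im (x * y) =
  complex.Re x * complex.Im y + complex.Im x * complex.Re y.
Proof. by case: x; case: y. Qed.

Lemma cReD x y : complex.Re (x + y) = complex.Re x + complex.Re y.
Proof. exact: raddfD. Qed.

Lemma cImD x y : complex.Im (x + y) = complex.Im x + complex.Im y.
Proof. exact: raddfD. Qed.

Lemma cReN x : complex.Re (- x) = - complex.Re x.
Proof. exact: raddfN. Qed.

Lemma cImN x : complex.Im (- x) = - complex.Im x.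
Proof. exact: raddfN. Qed.

Lemma cRe_sum I (r : seq I) (P : pred I) (f : I -> R[i]) :
  complex.Re (\sum_(i <- r | P i) f i) = \sum_(i <- r | P i) complex.Re (f i).
Proof. exact: raddf_sum. Qed.

Lemma cIm_sum I (r : seq I) (P : pred I) (f : I -> R[i]) :
  complex.Im (\sum_(i <- r | P i) f i) = \sum_(i <- r | P i) complex.Im (f i).
Proof. exact: raddf_sum. Qed.

Lemma cReMr (a : R) x : complex.Re (a%:C * x) = a * complex.Re x.
Proof. by rewrite cReM /= mul0r subr0. Qed.

Lemma cImMr (a : R) x : complex.Im (a%:C * x) = a * complex.Im x.
Proof. by rewrite cImM /= mul0r addr0. Qed.

Lemma cabs_sum (I : finType) (P : pred I) (f : I -> R[i]) :
  cabs (\sum_(i | P i) f i) <= \sum_(i | P i) cabs (f i).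
Proof.
elim/big_rec2: _ => [|i y1 y2 _ H]; first by rewrite cabs0.
by apply: le_trans (cabsD _ _) _; rewrite lerD2l.
Qed.

Lemma cImV x : complex.Im x^-1 = - complex.Im x / cabs x ^+ 2.
Proof. by rewrite cabs_sqr; case: x => a b /=; rewrite mulNr. Qed.

End Modulus.

Section Mean.
Variable (K : fieldType) (N : nat).
Implicit Types x y : 'I_N -> K.

Definition mean x : K := N%:R^-1 * \sum_j x j.

Lemma eq_mean x y : x =1 y -> mean x = mean y.
Proof. by move=> e; rewrite /mean; under eq_bigr do rewrite e. Qed.

Lemma meanD x y : mean (fun j => x j + y j) = mean x + mean y.
Proof. by rewrite /mean big_split mulrDr. Qed.

Lemma meanZ a x : mean (fun j => a * x j) = a * mean x.
Proof. by rewrite /mean -mulr_sumr mulrCA. Qed.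

Lemma meanN x : mean (fun j => - x j) = - mean x.
Proof. by rewrite /mean sumrN mulrN. Qed.

Lemma meanB x y : mean (fun j => x j - y j) = mean x - mean y.
Proof. by rewrite meanD meanN. Qed.

End Mean.

Section RealMean.
Variable (R : realType) (N : nat).
Hypothesis N_gt0 : (0 < N)%N.
Implicit Types x y : 'I_N -> R.

Lemma natN_gt0 : 0 < N%:R :> R. Proof. by rewrite ltr0n. Qed.

Lemma mean_const (a : R) : mean (fun _ : 'I_N => a) = a.
Proof.
rewrite /mean sumr_const card_ord -[a *+ N]mulr_natr mulrCA mulVf ?mulr1 //.
by rewrite gt_eqF // natN_gt0.
Qed.

Lemma ler_mean x y : (forall j, x j <= y j) -> mean x <= mean y.
Proof.
by move=> h; rewrite /mean ler_pM2l ?invr_gt0 ?natN_gt0 // ler_sum.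
Qed.

Lemma mean_ge0 x : (forall j, 0 <= x j) -> 0 <= mean x.
Proof. by move=> h; rewrite -(mean_const 0); exact: ler_mean. Qed.

Lemma mean_le x a : (forall j, x j <= a) -> mean x <= a.
Proof. by move=> h; rewrite -[leRHS]mean_const; exact: ler_mean. Qed.

Lemma mean_ge x a : (forall j, a <= x j) -> a <= mean x.
Proof. by move=> h; rewrite -[leLHS]mean_const; exact: ler_mean. Qed.

Lemma mean_gt0 x : (forall j, 0 < x j) -> 0 < mean x.
Proof.
move=> h; rewrite /mean mulr_gt0 ?invr_gt0 ?natN_gt0 //.
rewrite (bigD1 (Ordinal N_gt0)) //= ltr_wpDr ?h // sumr_ge0 // => j _.
exact: ltW.
Qed.

Lemma ler_norm_mean x : `|mean x| <= mean (fun j => `|x j|).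
Proof.
rewrite /mean normrM gtr0_norm ?invr_gt0 ?natN_gt0 //.
by rewrite ler_pM2l ?invr_gt0 ?natN_gt0 // ler_norm_sum.
Qed.

Lemma cabs_mean (x : 'I_N -> R[i]) : cabs (mean x) <= mean (fun j => cabs (x j)).
Proof.
rewrite /mean cabsM cabsV.
have -> : (N%:R : R[i]) = (N%:R : R)%:C by rewrite rmorph_nat.
rewrite cabs_real gtr0_norm ?natN_gt0 //.
by rewrite ler_pM2l ?invr_gt0 ?natN_gt0 // cabs_sum.
Qed.

Lemma cabs_mean_le (x : 'I_N -> R[i]) a :
  (forall j, cabs (x j) <= a) -> cabs (mean x) <= a.
Proof. by move=> h; apply: le_trans (cabs_mean x) _; exact: mean_le. Qed.

Lemma mean_complex x : mean (fun j => (x j)%:C) = (mean x)%:C.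
Proof.
rewrite /mean rmorphM rmorph_sum fmorphV rmorph_nat //.
Qed.

Lemma cRe_mean (x : 'I_N -> R[i]) :
  complex.Re (mean x) = mean (fun j => complex.Re (x j)).
Proof.
rewrite /mean; have -> : (N%:R : R[i])^-1 = (N%:R^-1 : R)%:C.
  by rewrite fmorphV rmorph_nat.
by rewrite cReMr cRe_sum.
Qed.

Lemma cIm_mean (x : 'I_N -> R[i]) :
  complex.Im (mean x) = mean (fun j => complex.Im (x j)).
Proof.
rewrite /mean; have -> : (N%:R : R[i])^-1 = (N%:R^-1 : R)%:C.
  by rewrite fmorphV rmorph_nat.
by rewrite cImMr cIm_sum.
Qed.

Lemma ker_le (F : 'I_N -> R) C x : (forall k, F k <= C / N%:R) ->
  (forall k, 0 <= x k) -> \sum_k F k * x k <= C * mean x.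
Proof.
move=> hF hx; rewrite /mean mulrA mulr_sumr ler_sum // => k _.
by rewrite ler_wpM2r.
Qed.

Lemma ker_ge (F : 'I_N -> R) c x : (forall k, c / N%:R <= F k) ->
  (forall k, 0 <= x k) -> c * mean x <= \sum_k F k * x k.
Proof.
move=> hF hx; rewrite /mean mulrA mulr_sumr ler_sum // => k _.
by rewrite ler_wpM2r.
Qed.

Lemma cabs_ker (F : 'I_N -> R) C (x : 'I_N -> R[i]) :
  (forall k, 0 <= F k <= C / N%:R) ->
  cabs (\sum_k (F k)%:C * x k) <= C * mean (fun k => cabs (x k)).
Proof.
move=> hF; apply: (le_trans (cabs_sum _ _)).
rewrite (eq_bigr (fun k => F k * cabs (x k))); last first.
  by move=> k _; rewrite cabsM cabs_real ger0_norm //; case/andP: (hF k).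
by apply: ker_le => k; [case/andP: (hF k)|exact: cabs_ge0].
Qed.

Lemma cabs_ker_le (F : 'I_N -> R) C (x : 'I_N -> R[i]) X : 0 <= C ->
  (forall k, 0 <= F k <= C / N%:R) -> (forall k, cabs (x k) <= X) ->
  cabs (\sum_k (F k)%:C * x k) <= C * X.
Proof.
move=> C0 hF hx; apply: (le_trans (cabs_ker _ hF)).
by rewrite ler_wpM2l // mean_le.
Qed.

End RealMean.

(** * Square means and the defect in Cauchy-Schwarz *)

Section SquareMeans.
Variables (R : realType) (N : nat).
Hypothesis N_gt0 : (0 < N)%N.
Implicit Types x y : 'I_N -> R.

Lemma mean_sqr_le x : mean x ^+ 2 <= mean (fun j => x j ^+ 2).
Proof.
have h : mean (fun j => 2 * mean x * x j - mean x ^+ 2) <=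
         mean (fun j => x j ^+ 2).
  by apply: ler_mean => // j; have := sqr_ge0 (x j - mean x); nra.
move: h; rewrite meanB meanZ mean_const //; nra.
Qed.

(** From [|t k| ^ 2 <= 2 |t j| ^ 2 + 2 |t j - t k| ^ 2], weighted by [y j] and averaged over both
    indices. It separates a weighted square mean into a product of two means, so that a small energy
    forces the weight itself to be small on average. *)
Lemma mean_weight_transfer (B : R) y (t : 'I_N -> R[i]) :
  (forall j, 0 <= y j <= B) ->
  mean y * mean (fun k => cabs (t k) ^+ 2) <=
  2 * mean (fun j => y j * cabs (t j) ^+ 2) +
  2 * B * mean (fun j => mean (fun k => cabs (t j - t k) ^+ 2)).
Proof.
move=> hy.
rewrite -[mean y * _]mulrC -meanZ -!meanZ -meanD.
apply: ler_mean => // j.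
rewrite mulrC -!meanZ -[2 * (y j * _)](mean_const N_gt0) -meanD.
apply: ler_mean => // k.
have h : cabs (t k) <= cabs (t j) + cabs (t j - t k).
  by have := cabsB (t j) (t j - t k); rewrite opprB addrC subrK.
have /andP[y0 yB] := hy j.
have tk := cabs_ge0 (t k); have tj := cabs_ge0 (t j).
have d0 := cabs_ge0 (t j - t k).
have h2 : cabs (t k) ^+ 2 <= 2 * cabs (t j) ^+ 2 + 2 * cabs (t j - t k) ^+ 2.
  move: h tk tj d0; set a := cabs (t k); set b := cabs (t j).
  set c := cabs _ => h tk tj d0.
  have : a ^+ 2 <= (b + c) ^+ 2 by rewrite lerXn2r ?nnegrE // addr_ge0.
  have := sqr_ge0 (b - c); nra.
have h3 : y j * cabs (t k) ^+ 2 <=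
   y j * (2 * cabs (t j) ^+ 2 + 2 * cabs (t j - t k) ^+ 2) by rewrite ler_wpM2l.
have h4 : y j * cabs (t j - t k) ^+ 2 <= B * cabs (t j - t k) ^+ 2.
  by rewrite ler_wpM2r // sqr_ge0.
lra.
Qed.

(** Lagrange's identity, for real and imaginary parts separately. The defect of Cauchy-Schwarz is
    kept exactly because the double sum becomes the Dirichlet energy of the estimate for two
    solutions. *)
Lemma cabs_sum_sqr (w : 'I_N -> R) (t : 'I_N -> R[i]) :
  cabs (\sum_k (w k)%:C * t k) ^+ 2 =
  (\sum_k w k) * (\sum_k w k * cabs (t k) ^+ 2) -
  2^-1 * \sum_k \sum_l w k * w l * cabs (t k - t l) ^+ 2.
Proof.
have e : forall (x : 'I_N -> R), (\sum_k w k * x k) ^+ 2 =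
  (\sum_k w k) * (\sum_k w k * x k ^+ 2) -
  2^-1 * \sum_k \sum_l w k * w l * (x k - x l) ^+ 2.
  move=> x.
  have -> : \sum_k \sum_l w k * w l * (x k - x l) ^+ 2 =
    \sum_k \sum_l w k * (w l * x l ^+ 2) + \sum_k \sum_l w l * (w k * x k ^+ 2)
    - 2 * \sum_k \sum_l (w k * x k) * (w l * x l).
    rewrite mulr_sumr -big_split -sumrB; apply: eq_bigr => k _ /=.
    rewrite mulr_sumr -big_split -sumrB; apply: eq_bigr => l _ /=; ring.
  rewrite [X in _ - 2^-1 * (_ + X - _)]exchange_big /=.
  by rewrite -!big_distrlr /= expr2; field.
rewrite cabs_sqr cRe_sum cIm_sum.
under eq_bigr do rewrite cReMr.
under [X in _ + X ^+ 2]eq_bigr do rewrite cImMr.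
rewrite !e.
under [X in _ = _ * X - _]eq_bigr do rewrite cabs_sqr mulrDr.
under [X in _ = _ - _ * X]eq_bigr => k _.
  under eq_bigr => l _ do rewrite cabs_sqr cReD cImD cReN cImN mulrDr.
  rewrite big_split /=; over.
rewrite !big_split /=; ring.
Qed.

End SquareMeans.

Lemma sqr_sum3_le (R : realType) (a p q l : R) : 0 <= a -> a <= p + q + l ->
  a ^+ 2 <= 3 * (p ^+ 2 + q ^+ 2 + l ^+ 2).
Proof.
move=> a0 h.
have : a ^+ 2 <= (p + q + l) ^+ 2.
  by rewrite lerXn2r ?nnegrE // (le_trans a0).
have := sqr_ge0 (p - q); have := sqr_ge0 (p - l); have := sqr_ge0 (q - l).
nra.
Qed.

(** Here [q] is the geometric mean, and [2 (x + y) (x + y - 2 q) - (x - y) ^ 2] equals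
    [(x + y - 2 q) ^ 2]. The gap between the two means therefore controls the squared difference. *)
Lemma amgm_gap (R : realType) (M x y q : R) : 0 <= x -> 0 <= y -> 0 <= q ->
  x <= M -> y <= M -> q ^+ 2 = x * y ->
  0 <= x + y - 2 * q /\ (x - y) ^+ 2 <= 4 * M * (x + y - 2 * q).
Proof.
move=> x0 y0 q0 xM yM q2.
have qxy : 2 * q <= x + y.
  rewrite -(@ler_pXn2r _ 2) ?nnegrE ?mulr_ge0 ?addr_ge0 //.
  rewrite exprMn q2; have := sqr_ge0 (x - y); nra.
have d0 : 0 <= x + y - 2 * q by lra.
split=> //.
have d1 : (x - y) ^+ 2 <= 2 * (x + y) * (x + y - 2 * q).
  rewrite -subr_ge0 (_ : _ - _ = (x + y - 2 * q) ^+ 2) ?sqr_ge0 //.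
  rewrite [in RHS]sqrrD sqrrN exprMn q2; ring.
apply: le_trans d1 _; rewrite ler_wpM2r //; lra.
Qed.

(** * Energy estimate for two normalized solutions *)

Section TwoSolutions.
Variables (R : realType) (N : nat) (B : R) (S : 'I_N -> 'I_N -> R).
Variables (f f' A A' : 'I_N -> R) (h h' : R).
Let b := B^-1.
Hypotheses (N_gt0 : (0 < N)%N) (B_ge1 : 1 <= B).
Hypothesis S_sym : forall j k, S j k = S k j.
Hypothesis S_bnd : forall j k, b / N%:R <= S j k <= B / N%:R.
Hypothesis f_bnd : forall j, b <= f j <= B.
Hypothesis f'_bnd : forall j, b <= f' j <= B.
Hypothesis A_bnd : forall j, b <= A j <= B.
Hypothesis A'_bnd : forall j, b <= A' j <= B.
Hypothesis h_bnd : 0 <= h <= B.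
Hypothesis h'_bnd : 0 <= h' <= B.
Hypothesis mean_f : mean f = 1.
Hypothesis mean_f' : mean f' = 1.
Hypothesis AE : forall j, A j = h + \sum_k S j k * f k.
Hypothesis A'E : forall j, A' j = h' + \sum_k S j k * f' k.

Let b_gt0 : 0 < b. Proof. by rewrite invr_gt0 (lt_le_trans ltr01). Qed.
Let bB : b * B = 1. Proof. by rewrite mulVf // gt_eqF // (lt_le_trans ltr01). Qed.
Let B_gt0 : 0 < B. Proof. exact: lt_le_trans B_ge1. Qed.

Let S_ge0 j k : 0 <= S j k.
Proof.
case/andP: (S_bnd j k) => + _; apply: le_trans.
by rewrite divr_ge0 // ltW.
Qed.

(** In the application [f] is the imaginary part divided by its mean and [A] is [f / |u| ^ 2]. The
    geometric means [s] and [Q] symmetrize the equation of the difference. If the profiles agreed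
    and [h], [h'] vanished, [T] would equal [Q]; [V] measures how far the ratio of the profiles is
    from constant. *)
Let s j := Num.sqrt (f j * f' j).
Let Q j := Num.sqrt (A j * A' j).
Let T j := \sum_k S j k * s k.
Let V := mean (fun k => mean (fun l => (f k * f' l - f l * f' k) ^+ 2)).

Let sqrt_bnd x y : b <= x <= B -> b <= y <= B -> b <= Num.sqrt (x * y) <= B.
Proof.
move=> /andP[x1 x2] /andP[y1 y2].
have xy : 0 <= x * y by apply: mulr_ge0; apply: le_trans (ltW b_gt0) _.
apply/andP; split; rewrite -(@ler_pXn2r _ 2) ?nnegrE ?sqrtr_ge0 ?(ltW b_gt0) ?(ltW B_gt0) //;
  rewrite sqr_sqrtr // expr2 ler_pM // ?(ltW b_gt0) ?(ltW B_gt0) //;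
  exact: le_trans (ltW b_gt0) _.
Qed.

Let s_bnd j : b <= s j <= B. Proof. exact: sqrt_bnd. Qed.
Let Q_bnd j : b <= Q j <= B. Proof. exact: sqrt_bnd. Qed.

Let ge0_f j : 0 <= f j. Proof. by case/andP: (f_bnd j) => + _; apply/le_trans/ltW. Qed.
Let ge0_f' j : 0 <= f' j. Proof. by case/andP: (f'_bnd j) => + _; apply/le_trans/ltW. Qed.
Let ge0_A j : 0 <= A j. Proof. by case/andP: (A_bnd j) => + _; apply/le_trans/ltW. Qed.
Let ge0_A' j : 0 <= A' j. Proof. by case/andP: (A'_bnd j) => + _; apply/le_trans/ltW. Qed.

Let s2 j : s j ^+ 2 = f j * f' j. Proof. by rewrite sqr_sqrtr // mulr_ge0. Qed.
Let Q2 j : Q j ^+ 2 = A j * A' j. Proof. by rewrite sqr_sqrtr // mulr_ge0. Qed.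

Let T_ge0 j : 0 <= T j.
Proof. by apply: sumr_ge0 => k _; rewrite mulr_ge0 ?sqrtr_ge0. Qed.

(** Averaging [f k * f' l - f l * f' k] over [l] leaves [f k - f' k], both means being 1; the rest
    is Jensen. *)
Let ratio_variation : mean (fun k => (f k - f' k) ^+ 2) <= V.
Proof.
apply: ler_mean => // k; apply: le_trans (mean_sqr_le N_gt0 _).
rewrite le_eqVlt; apply/orP; left; apply/eqP; congr (_ ^+ 2).
rewrite meanB meanZ mean_f' mulr1; congr (_ - _).
by under eq_mean do rewrite mulrC; rewrite meanZ mean_f mulr1.
Qed.

Let V_ge0 : 0 <= V.
Proof. by apply: mean_ge0 => // k; apply: mean_ge0 => // l; exact: sqr_ge0. Qed.

(** The right side is half a double sum with weights [S j k * S j l] of the gaps between arithmetic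
    and geometric means of [f k * f' l] and [f l * f' k], up to a factor 2. [amgm_gap] bounds each
    gap below, at the price [b ^ 2 / 4], and the weights cost another [b ^ 2]. *)
Let cauchy_schwarz_defect j : b ^+ 4 / 8 * V <=
  (\sum_k S j k * f k) * (\sum_k S j k * f' k) - T j ^+ 2.
Proof.
have -> : (\sum_k S j k * f k) * (\sum_k S j k * f' k) - T j ^+ 2 =
  2^-1 * \sum_k \sum_l S j k * S j l * (f k * f' l + f l * f' k - 2 * (s k * s l)).
  rewrite [in LHS]expr2 !big_distrlr /=.
  have e : \sum_k \sum_l S j k * f k * (S j l * f' l) =
     \sum_k \sum_l S j k * f' k * (S j l * f l).
    rewrite exchange_big /=; apply: eq_bigr => k _; apply: eq_bigr => l _; ring.
  have -> : \sum_k \sum_l S j k * S j l * (f k * f' l + f l * f' k - 2 * (s k * s l)) =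
    \sum_k \sum_l S j k * f k * (S j l * f' l) + \sum_k \sum_l S j k * f' k * (S j l * f l)
    - 2 * \sum_k \sum_l S j k * s k * (S j l * s l).
    rewrite mulr_sumr -big_split -sumrB; apply: eq_bigr => k _ /=.
    rewrite mulr_sumr -big_split -sumrB; apply: eq_bigr => l _ /=; ring.
  by rewrite -e; field.
rewrite /V /mean !mulr_sumr.
apply: ler_sum => k _; rewrite !mulr_sumr; apply: ler_sum => l _.
set x := f k * f' l; set y := f l * f' k; set q := s k * s l.
have x0 : 0 <= x by rewrite mulr_ge0.
have y0 : 0 <= y by rewrite mulr_ge0.
have xB : x <= B ^+ 2.
  by rewrite expr2 ler_pM //; [case/andP: (f_bnd k)|case/andP: (f'_bnd l)].
have yB : y <= B ^+ 2.
  by rewrite expr2 ler_pM //; [case/andP: (f_bnd l)|case/andP: (f'_bnd k)].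
have q2 : q ^+ 2 = x * y by rewrite exprMn !s2 /x /y; ring.
have q0 : 0 <= q by rewrite mulr_ge0 ?sqrtr_ge0.
have [d0 d2] := amgm_gap x0 y0 q0 xB yB q2.
have d3 : b ^+ 2 * (x - y) ^+ 2 <= 4 * (x + y - 2 * q).
  have -> : 4 * (x + y - 2 * q) = b ^+ 2 * (4 * B ^+ 2 * (x + y - 2 * q)).
    rewrite -[LHS]mul1r -(expr1n _ 2) -bB; ring.
  by rewrite ler_wpM2l // sqr_ge0.
have SS : b ^+ 2 / N%:R ^+ 2 <= S j k * S j l.
  rewrite expr2 [N%:R ^+ 2]expr2 invfM mulrACA.
  apply: ler_pM; rewrite ?divr_ge0 ?(ltW b_gt0) //.
    by case/andP: (S_bnd j k).
  by case/andP: (S_bnd j l).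
have d4 : b ^+ 2 / N%:R ^+ 2 * (x + y - 2 * q) <= S j k * S j l * (x + y - 2 * q).
  by rewrite ler_wpM2r.
have n0 : 0 <= b ^+ 2 / N%:R ^+ 2 by rewrite divr_ge0 ?sqr_ge0.
have d5 := ler_wpM2l n0 d3.
apply: le_trans (ler_wpM2l _ d4); last by rewrite invr_ge0.
rewrite [X in _ <= _ * X](_ : _ = 4^-1 * (b ^+ 2 / N%:R ^+ 2 * (4 * (x + y - 2 * q)))); last by field; rewrite gt_eqF // natN_gt0.
apply: le_trans (ler_wpM2l _ (ler_wpM2l _ d5)); rewrite ?invr_ge0 //.
rewrite le_eqVlt; apply/orP; left; apply/eqP; field.
by rewrite gt_eqF // natN_gt0.
Qed.

(** Expanding [(h + S f) (h' + S f')], the cross terms add [b * (h + h')], because [S f] and [S f']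
    are at least [b]. *)
Let defect j : b ^+ 4 / 8 * V + b * (h + h') <= Q j ^+ 2 - T j ^+ 2.
Proof.
have d := cauchy_schwarz_defect j.
have g1 : b <= \sum_k S j k * f k.
  rewrite -[b]mulr1 -mean_f; apply: ker_ge => // k; by case/andP: (S_bnd j k).
have g2 : b <= \sum_k S j k * f' k.
  rewrite -[b]mulr1 -mean_f'; apply: ker_ge => // k; by case/andP: (S_bnd j k).
rewrite Q2 AE A'E.
case/andP: h_bnd => h0 _; case/andP: h'_bnd => h'0 _.
move: d g1 g2; set X := \sum_k _ * f k; set Y := \sum_k _ * f' k.
move=> d g1 g2.
have := ler_wpM2l h0 g2; have := ler_wpM2l h'0 g1; have := mulr_ge0 h0 h'0; lra.
Qed.

Let T_le_Q j : T j <= Q j.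
Proof.
rewrite -(@ler_pXn2r _ 2) ?nnegrE ?T_ge0 ?sqrtr_ge0 //.
have := defect j.
case/andP: h_bnd => h0 _; case/andP: h'_bnd => h'0 _.
have : 0 <= b ^+ 4 / 8 * V by rewrite mulr_ge0 ?divr_ge0 ?exprn_ge0 ?(ltW b_gt0).
have : 0 <= b * (h + h') by rewrite mulr_ge0 ?addr_ge0 // ltW.
lra.
Qed.

Let y j := Q j - T j.

Let y_bnd j : 0 <= y j <= B.
Proof.
by rewrite /y subr_ge0 T_le_Q /=; case/andP: (Q_bnd j) => _; have := T_ge0 j; lra.
Qed.

Let defect_le j : b ^+ 4 / 8 * V + b * (h + h') <= 2 * B * y j.
Proof.
apply: le_trans (defect j) _; rewrite subr_sqr mulrC ler_wpM2r //.
  by case/andP: (y_bnd j).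
by have := T_le_Q j; case/andP: (Q_bnd j) => _; lra.
Qed.

Lemma variation_le_defect :
  mean (fun k => (f k - f' k) ^+ 2) <= 16 * B ^+ 5 * mean y /\
  h + h' <= 2 * B ^+ 2 * mean y.
Proof.
case/andP: h_bnd => h0 _; case/andP: h'_bnd => h'0 _.
have p1 : 0 <= b ^+ 4 / 8 * V by rewrite mulr_ge0 ?divr_ge0 ?exprn_ge0 ?(ltW b_gt0).
have p2 : 0 <= b * (h + h') by rewrite mulr_ge0 ?addr_ge0 // ltW.
have d : b ^+ 4 / 8 * V + b * (h + h') <= 2 * B * mean y.
  by rewrite -[leRHS]meanZ; apply: mean_ge => // j; exact: defect_le.
have B4 : 0 <= B ^+ 4 by rewrite exprn_ge0 // ltW.
split.
  apply: le_trans ratio_variation _.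
  have : B ^+ 4 * (b ^+ 4 / 8 * V) <= B ^+ 4 * (2 * B * mean y).
    rewrite ler_wpM2l //; lra.
  have -> : B ^+ 4 * (b ^+ 4 / 8 * V) = (b * B) ^+ 4 * V / 8 by ring.
  rewrite bB expr1n; lra.
have : B * (b * (h + h')) <= B * (2 * B * mean y).
  rewrite ler_wpM2l ?(ltW B_gt0) //; lra.
by rewrite [B * (b * _)]mulrA [B * b]mulrC bB mul1r; lra.
Qed.

(** In the application [t] is the difference of the solutions divided by [s], [w] the difference of
    the spectral parameters, [U] the phase of the product of the two solutions, and [G] the largest
    modulus of the difference. *)
Variables (t U : 'I_N -> R[i]) (w : R[i]) (G : R).
Hypothesis tE : forall j,
  t j * (Q j)%:C = U j * (w + \sum_k (S j k)%:C * ((s k)%:C * t k)).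
Hypothesis U1 : forall j, cabs (U j) = 1.
Hypothesis G_bnd : forall j, s j * cabs (t j) <= G.

Let W j := \sum_k (S j k * s k)%:C * t k.
Let D := mean (fun j => mean (fun k => cabs (t j - t k) ^+ 2)).

Let W_E j : \sum_k (S j k)%:C * ((s k)%:C * t k) = W j.
Proof. by apply: eq_bigr => k _; rewrite mulrA -rmorphM. Qed.

Let Qt j : Q j * cabs (t j) = cabs (w + W j).
Proof.
have := congr1 (@cabs R) (tE j); rewrite W_E !cabsM U1 mul1r cabs_real mulrC.
by rewrite ger0_norm ?sqrtr_ge0.
Qed.

Let D_ge0 : 0 <= D.
Proof. by apply: mean_ge0 => // k; apply: mean_ge0 => // l; exact: sqr_ge0. Qed.

(** Taking moduli removes the phase: [Q |t| = |w + W|]. Squaring, inserting Lagrange's identity for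
    [|W| ^ 2] and multiplying by [s / Q] gives a pointwise inequality. Summed over [j], the symmetry
    of [S] turns its averaged term into [s T |t| ^ 2], which leaves the weight [Q - T] and the
    Dirichlet energy [D]. *)
Let energy : mean (fun j => y j * cabs (t j) ^+ 2) <= 2 * B * (cabs w * G) /\
  D <= 4 * B ^+ 6 * (cabs w * G).
Proof.
have pw j : s j * (y j * cabs (t j) ^+ 2) + b ^+ 6 / 2 * D <=
    2 * (cabs w * G) + (\sum_k S j k * s j * s k * cabs (t k) ^+ 2 - s j * T j * cabs (t j) ^+ 2).
  have Q0 : 0 < Q j by apply: lt_le_trans b_gt0 _; case/andP: (Q_bnd j).
  have s0 : 0 < s j by apply: lt_le_trans b_gt0 _; case/andP: (s_bnd j).
  have t0 := cabs_ge0 (t j); have w0 := cabs_ge0 w; have W0 := cabs_ge0 (W j).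
  (* The difference of squares is linear in [|w|] by the triangle inequality; the case
     [Q |t| <= |w|] is separate because there the inequality cannot be squared after subtraction. *)
  have e1 : (Q j * cabs (t j)) ^+ 2 - cabs (W j) ^+ 2 <= 2 * (Q j * cabs (t j)) * cabs w.
    have := cabsD w (W j); rewrite -Qt.
    have : 0 <= Q j * cabs (t j) by rewrite mulr_ge0 // ltW.
    move: w0 W0; set x := _ * _; set ww := cabs w; set WW := cabs _ => w0 W0 x0 le.
    have [xw|/ltW wx] := leP x ww.
      have := sqr_ge0 WW; have := ler_wpM2l x0 xw; nra.
    have : (x - ww) ^+ 2 <= WW ^+ 2 by rewrite lerXn2r ?nnegrE ?subr_ge0 //; lra.
    have := sqr_ge0 ww; nra.
  have e2 := cabs_sum_sqr (fun k => S j k * s k) t.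
  rewrite -/(W j) -/(T j) in e2.
  have e3 : b ^+ 4 * D <= \sum_k \sum_l S j k * s k * (S j l * s l) * cabs (t k - t l) ^+ 2.
    rewrite /D /mean !mulr_sumr; apply: ler_sum => k _.
    rewrite !mulr_sumr; apply: ler_sum => l _.
    have := sqr_ge0 (cabs (t k - t l)); move: (cabs _ ^+ 2) => X X0.
    rewrite !mulrA ler_wpM2r //.
    have SS m : b ^+ 2 / N%:R <= S j m * s m.
      rewrite expr2 mulrAC ler_pM ?divr_ge0 ?(ltW b_gt0) //.
        by case/andP: (S_bnd j m).
      by case/andP: (s_bnd m).
    rewrite -[leRHS]mulrA; apply: le_trans (ler_pM _ _ (SS k) (SS l)); last first.
    - by rewrite divr_ge0 ?sqr_ge0.
    - by rewrite divr_ge0 ?sqr_ge0.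
    rewrite le_eqVlt; apply/orP; left; apply/eqP; field.
    by rewrite gt_eqF // natN_gt0.
  have e4 : (s j / Q j) * (T j * \sum_k S j k * s k * cabs (t k) ^+ 2) <=
      \sum_k S j k * s j * s k * cabs (t k) ^+ 2.
    have -> : \sum_k S j k * s j * s k * cabs (t k) ^+ 2 =
       s j * \sum_k S j k * s k * cabs (t k) ^+ 2.
      rewrite mulr_sumr; apply: eq_bigr => k _; ring.
    rewrite mulrA ler_wpM2r //.
      by apply: sumr_ge0 => k _; apply: mulr_ge0; rewrite ?sqr_ge0 ?mulr_ge0 ?sqrtr_ge0.
    rewrite -mulrA ler_piMr ?(ltW s0) // mulrC ler_pdivrMr // mul1r; exact: T_le_Q.
  have sQ : b ^+ 2 <= s j / Q j.
    rewrite ler_pdivlMr //; case/andP: (Q_bnd j) => _ QB; case/andP: (s_bnd j) => sb _.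
    have : b ^+ 2 * Q j <= b ^+ 2 * B by rewrite ler_wpM2l ?sqr_ge0.
    by rewrite expr2 -[b * b * B]mulrA bB mulr1; lra.
  have sQ0 : 0 <= s j / Q j by rewrite divr_ge0 ?ltW.
  have e5 : (s j / Q j) * ((Q j * cabs (t j)) ^+ 2 - cabs (W j) ^+ 2) <= 2 * (cabs w * G).
    apply: le_trans (ler_wpM2l sQ0 e1) _.
    have -> : s j / Q j * (2 * (Q j * cabs (t j)) * cabs w) = 2 * (cabs w * (s j * cabs (t j))).
      by field; rewrite gt_eqF.
    by rewrite !ler_wpM2l.
  have e6 : b ^+ 2 * (b ^+ 4 * D) <= (s j / Q j) *
      \sum_k \sum_l S j k * s k * (S j l * s l) * cabs (t k - t l) ^+ 2.
    by rewrite ler_pM // ?sqr_ge0 // mulr_ge0 // exprn_ge0 // ltW.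
  move: e5 e4; rewrite mulrBr e2 [s j / Q j * (_ - _)]mulrBr.
  have -> : s j / Q j * (Q j * cabs (t j)) ^+ 2 = s j * (Q j * cabs (t j) ^+ 2).
    by field; rewrite gt_eqF.
  rewrite [s j / Q j * (2^-1 * _)]mulrCA.
  move: e6; rewrite /y; set X := s j / Q j * \sum_k _; set Y := s j / Q j * (_ * _).
  move=> e6 e5 e4; lra.
have G0 : 0 <= G.
  apply: le_trans (G_bnd (Ordinal N_gt0)); rewrite mulr_ge0 ?sqrtr_ge0 ?cabs_ge0 //.
have wG : 0 <= cabs w * G by rewrite mulr_ge0 ?cabs_ge0.
have tot : mean (fun j => s j * (y j * cabs (t j) ^+ 2)) + b ^+ 6 / 2 * D <=
   2 * (cabs w * G).
  rewrite -[X in _ + X](mean_const N_gt0) -meanD.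
  apply: le_trans (ler_mean N_gt0 pw) _; rewrite meanD meanB mean_const //.
  rewrite gerDl subr_le0 /mean ler_wpM2l ?invr_ge0 //.
  rewrite exchange_big /=; apply: ler_sum => k _.
  rewrite /T mulr_sumr mulr_suml; apply: ler_sum => j _.
  by rewrite S_sym; rewrite le_eqVlt; apply/orP; left; apply/eqP; ring.
have yt j : 0 <= y j * cabs (t j) ^+ 2.
  by rewrite mulr_ge0 ?sqr_ge0 //; case/andP: (y_bnd j).
have p1 : 0 <= b ^+ 6 / 2 * D by rewrite mulr_ge0 ?divr_ge0 ?exprn_ge0 ?(ltW b_gt0).
have p2 : b * mean (fun j => y j * cabs (t j) ^+ 2) <= mean (fun j => s j * (y j * cabs (t j) ^+ 2)).
  rewrite -meanZ; apply: ler_mean => // j; rewrite ler_wpM2r //.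
  by case/andP: (s_bnd j).
have p3 : 0 <= b * mean (fun j => y j * cabs (t j) ^+ 2).
  by rewrite mulr_ge0 ?(ltW b_gt0) // mean_ge0.
split.
  have : B * (b * mean (fun j => y j * cabs (t j) ^+ 2)) <= B * (2 * (cabs w * G)).
    rewrite ler_wpM2l ?(ltW B_gt0) //; lra.
  by rewrite [B * (b * _)]mulrA [B * b]mulrC bB mul1r; lra.
have : B ^+ 6 * (b ^+ 6 / 2 * D) <= B ^+ 6 * (2 * (cabs w * G)).
  rewrite ler_wpM2l ?exprn_ge0 ?(ltW B_gt0) //; lra.
have -> : B ^+ 6 * (b ^+ 6 / 2 * D) = (b * B) ^+ 6 * D / 2 by ring.
rewrite bB expr1n; lra.
Qed.

Let r j := cabs (1 - U j).

(** The equation reads [(1 - U) (w + W) = w - y t + (W - T t)]. The weight [y] and the variation of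
    [t] are controlled by [energy], and [|w| <= G] turns the square of the source into [|w| G]. *)
Let phase_bound : cabs w <= G ->
  mean (fun j => r j ^+ 2 * cabs (t j) ^+ 2) <= 21 * B ^+ 12 * (cabs w * G).
Proof.
move=> wG.
have pw j : b ^+ 2 * (r j ^+ 2 * cabs (t j) ^+ 2) <= 3 * (cabs w ^+ 2 +
    (B * (y j * cabs (t j) ^+ 2) + B ^+ 4 * mean (fun k => cabs (t j - t k) ^+ 2))).
  have Q0 : 0 <= Q j by exact: sqrtr_ge0.
  have e1 : r j * (Q j * cabs (t j)) <= cabs w + y j * cabs (t j) +
      B ^+ 2 * mean (fun k => cabs (t j - t k)).
    rewrite Qt /r -cabsM.
    have -> : (1 - U j) * (w + W j) = w - (y j)%:C * t j + (W j - (T j)%:C * t j).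
      rewrite mulrBl mul1r -W_E -tE W_E /y rmorphB /=; ring.
    apply: le_trans (cabsD _ _) _; apply: lerD.
      apply: le_trans (cabsB _ _) _; rewrite cabsM cabs_real ger0_norm //.
      by case/andP: (y_bnd j).
    have -> : W j - (T j)%:C * t j = \sum_k (S j k * s k)%:C * (t k - t j).
      rewrite /W /T rmorph_sum mulr_suml -sumrB /=.
      by apply: eq_bigr => k _; rewrite mulrBr.
    have <- : mean (fun k => cabs (t k - t j)) = mean (fun k => cabs (t j - t k)).
      by apply: eq_mean => k; rewrite cabsC.
    apply: cabs_ker => // k; rewrite mulr_ge0 ?sqrtr_ge0 //=.
    rewrite expr2 mulrAC ler_pM ?sqrtr_ge0 //.
      by case/andP: (S_bnd j k).
    by case/andP: (s_bnd k).
  have r0 : 0 <= r j by exact: cabs_ge0.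
  have t0 := cabs_ge0 (t j).
  have e2 : b * (r j * cabs (t j)) <= r j * (Q j * cabs (t j)).
    rewrite mulrCA ler_wpM2l // ler_wpM2r //; by case/andP: (Q_bnd j).
  have m0 : 0 <= mean (fun k => cabs (t j - t k)).
    by apply: mean_ge0 => // k; exact: cabs_ge0.
  have e3 := mean_sqr_le N_gt0 (fun k => cabs (t j - t k)).
  have /andP[y0 yB] := y_bnd j.
  have e4 : (y j * cabs (t j)) ^+ 2 <= B * (y j * cabs (t j) ^+ 2).
    by rewrite exprMn expr2 -mulrA ler_wpM2r // mulr_ge0 // sqr_ge0.
  have e5 : (B ^+ 2 * mean (fun k => cabs (t j - t k))) ^+ 2 <=
      B ^+ 4 * mean (fun k => cabs (t j - t k) ^+ 2).
    by rewrite exprMn -exprM ler_wpM2l // exprn_ge0 // ltW.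
  rewrite -!exprMn.
  have rt0 : 0 <= b * (r j * cabs (t j)) by rewrite !mulr_ge0 // ltW.
  have := sqr_sum3_le rt0 (le_trans e2 e1).
  by move=> H; apply: le_trans H _; rewrite ler_wpM2l // -addrA lerD2l lerD.
have [E1 E2] := energy.
have w0 := cabs_ge0 w; have G0 : 0 <= G by apply: le_trans wG.
have tot : b ^+ 2 * mean (fun j => r j ^+ 2 * cabs (t j) ^+ 2) <=
    3 * (cabs w ^+ 2 + (B * (2 * B * (cabs w * G)) + B ^+ 4 * (4 * B ^+ 6 * (cabs w * G)))).
  rewrite -meanZ; apply: le_trans (ler_mean N_gt0 pw) _.
  rewrite meanZ ler_wpM2l // meanD mean_const // lerD2l meanD meanZ lerD //.
    by rewrite ler_wpM2l // ltW.
  by rewrite meanZ ler_wpM2l // exprn_ge0 // ltW.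
have wG0 : 0 <= cabs w * G by rewrite mulr_ge0.
have tot2 : b ^+ 2 * mean (fun j => r j ^+ 2 * cabs (t j) ^+ 2) <=
    21 * B ^+ 10 * (cabs w * G).
  apply: le_trans tot _.
  have p1 : cabs w ^+ 2 <= B ^+ 10 * (cabs w * G).
    apply: (@le_trans _ _ (cabs w * G)); first by rewrite expr2 ler_wpM2l.
    by rewrite ler_peMl // exprn_ege1.
  have p2 : B ^+ 2 * (cabs w * G) <= B ^+ 10 * (cabs w * G).
    by rewrite ler_wpM2r // ler_weXn2l.
  have -> : B * (2 * B * (cabs w * G)) = 2 * (B ^+ 2 * (cabs w * G)) by ring.
  have -> : B ^+ 4 * (4 * B ^+ 6 * (cabs w * G)) = 4 * (B ^+ 10 * (cabs w * G)) by ring.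
  lra.
have -> : 21 * B ^+ 12 * (cabs w * G) = B ^+ 2 * (21 * B ^+ 10 * (cabs w * G)) by ring.
have -> : mean (fun j => r j ^+ 2 * cabs (t j) ^+ 2) =
    B ^+ 2 * (b ^+ 2 * mean (fun j => r j ^+ 2 * cabs (t j) ^+ 2)).
  by rewrite mulrA -exprMn [B * b]mulrC bB expr1n mul1r.
by rewrite ler_wpM2l // sqr_ge0.
Qed.

(** The last hypothesis compares the maximum of the difference with the square mean of [t]. By
    [mean_weight_transfer], a bound of order [|w| G] on the mean of [x |t| ^ 2] becomes
    [G ^ 2 * mean x <= C |w| G]; one factor [G] cancels. This is applied to the weights [y] and
    [|1 - U| ^ 2], and [y] dominates the two other gaps. *)
Lemma solution_gap_bounds (K0 : R) : 0 <= K0 -> 0 < G -> cabs w <= G ->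
  G ^+ 2 <= K0 * mean (fun j => cabs (t j) ^+ 2) ->
  [/\ G * mean (fun k => (f k - f' k) ^+ 2) <= 200 * K0 * B ^+ 12 * cabs w,
      G * (h + h') <= 200 * K0 * B ^+ 12 * cabs w &
      G * mean (fun j => cabs (1 - U j) ^+ 2) <= 200 * K0 * B ^+ 12 * cabs w].
Proof.
move=> K00 G0 wG GK.
have [E1 E2] := energy; have E3 := phase_bound wG.
have wG0 : 0 <= cabs w * G by rewrite mulr_ge0 ?cabs_ge0 // ltW.
have KB n : (n <= 12)%N -> K0 * B ^+ n * cabs w <= K0 * B ^+ 12 * cabs w.
  move=> hn; rewrite ler_wpM2r ?cabs_ge0 // ler_wpM2l //.
  by rewrite ler_weXn2l.
have tr (x : 'I_N -> R) M c n : (forall j, 0 <= x j <= M) -> 0 <= c ->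
    2 * mean (fun j => x j * cabs (t j) ^+ 2) + 2 * M * D <= c * B ^+ n * (cabs w * G) ->
    G * mean x <= c * (K0 * B ^+ n * cabs w).
  move=> hx c0 H; have := le_trans (mean_weight_transfer N_gt0 t hx) H.
  have mx : 0 <= mean x by apply: mean_ge0 => // j; case/andP: (hx j).
  move=> H2; rewrite -(ler_pM2l G0).
  have : G ^+ 2 * mean x <= K0 * (mean x * mean (fun j => cabs (t j) ^+ 2)).
    by rewrite [mean x * _]mulrC [K0 * (_ * _)]mulrA ler_wpM2r.
  have := ler_wpM2l K00 H2; lra.
have Dy : G * mean y <= 12 * (K0 * B ^+ 7 * cabs w).
  apply: (tr y B) => //.
  have p1 : B * D <= B * (4 * B ^+ 6 * (cabs w * G)) by rewrite ler_wpM2l // ltW.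
  have p2 : B * (cabs w * G) <= B ^+ 7 * (cabs w * G).
    by rewrite ler_wpM2r // -{1}[B]expr1 ler_weXn2l.
  have e : B * (4 * B ^+ 6 * (cabs w * G)) = 4 * (B ^+ 7 * (cabs w * G)) by ring.
  rewrite e in p1; lra.
have [V1 V2] := variation_le_defect.
have wB0 n : 0 <= K0 * B ^+ n * cabs w.
  by rewrite !mulr_ge0 ?cabs_ge0 ?exprn_ge0 // ltW.
split.
- apply: le_trans (ler_wpM2l (ltW G0) V1) _.
  have -> : G * (16 * B ^+ 5 * mean y) = 16 * B ^+ 5 * (G * mean y) by ring.
  apply: le_trans (ler_wpM2l _ Dy) _; first by rewrite mulr_ge0 // exprn_ge0 // ltW.
  have -> : 16 * B ^+ 5 * (12 * (K0 * B ^+ 7 * cabs w)) = 192 * (K0 * B ^+ 12 * cabs w) by ring.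
  have := wB0 12%N; lra.
- apply: le_trans (ler_wpM2l (ltW G0) V2) _.
  have -> : G * (2 * B ^+ 2 * mean y) = 2 * B ^+ 2 * (G * mean y) by ring.
  apply: le_trans (ler_wpM2l _ Dy) _; first by rewrite mulr_ge0 // exprn_ge0 // ltW.
  have -> : 2 * B ^+ 2 * (12 * (K0 * B ^+ 7 * cabs w)) = 24 * (K0 * B ^+ 9 * cabs w) by ring.
  have := wB0 12%N; have := KB 9%N isT; lra.
- rewrite -!mulrA; apply: le_trans (tr (fun j => r j ^+ 2) 4 74 12%N _ _ _) _ => //.
  + move=> j; rewrite sqr_ge0 /=.
    have := cabsB 1 (U j); rewrite cabs1 U1 -/(r j) => r2.
    have : r j ^+ 2 <= (1 + 1) ^+ 2 by rewrite lerXn2r ?nnegrE ?cabs_ge0 ?addr_ge0.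
    lra.
  + have p2 : B ^+ 6 * (cabs w * G) <= B ^+ 12 * (cabs w * G).
      by rewrite ler_wpM2r // ler_weXn2l.
    lra.
  + have := wB0 12%N; lra.
Qed.

End TwoSolutions.

(** * Hoelder continuity of solutions *)

(** The equation is multiplied out to avoid division. Being stated for one function at one point, it
    applies equally to [m z] and to the conjugate of [m] at the conjugate point. *)
Definition solves (R : realType) (N : nat) (S : 'I_N -> 'I_N -> R) (z : R[i])
    (u : 'I_N -> R[i]) : Prop :=
  (forall j, u j * (z + \sum_k (S j k)%:C * u k) = -1) /\
  (forall j, 0 < complex.Im (u j)).

Lemma solves_neq0 (R : realType) (N : nat) (S : 'I_N -> 'I_N -> R) z u :
  solves S z u -> forall j, u j != 0.
Proof.
by case=> _ h j; apply/eqP => u0; move: (h j); rewrite u0 ltxx.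
Qed.

Lemma solves_im (R : realType) (N : nat) (S : 'I_N -> 'I_N -> R) z u :
  solves S z u -> forall j, complex.Im (u j) =
    cabs (u j) ^+ 2 * (complex.Im z + \sum_k S j k * complex.Im (u k)).
Proof.
move=> hu j; have [e _] := hu; have u0 := solves_neq0 hu.
have e1 : z + \sum_k (S j k)%:C * u k = - (u j)^-1.
  by apply: (mulfI (u0 j)); rewrite e mulrN mulfV ?u0.
have := congr1 (@complex.Im R) e1.
rewrite cImD cIm_sum cImN cImV; under eq_bigr do rewrite cImMr.
by move=> ->; field; rewrite cabs_eq0 u0.
Qed.

Lemma cabs_bounded_neq0 (R : realType) (I : Type) (L : R) (u : I -> R[i]) : 1 <= L ->
  (forall j, L^-1 <= cabs (u j) <= L) -> forall j, u j != 0.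
Proof.
move=> L1 h j; rewrite -cabs_gt0; case/andP: (h j) => + _; apply: lt_le_trans.
by rewrite invr_gt0 (lt_le_trans _ L1).
Qed.

Section OneSolution.
Variables (R : realType) (N : nat) (L : R) (S : 'I_N -> 'I_N -> R).
Hypotheses (N_gt0 : (0 < N)%N) (L_ge1 : 1 <= L).
Hypothesis S_bnd : forall j k, L^-1 / N%:R <= S j k <= L / N%:R.
Variables (z : R[i]) (u : 'I_N -> R[i]).
Hypotheses (z_im : 0 < complex.Im z) (u_sol : solves S z u).
Hypothesis u_bnd : forall j, L^-1 <= cabs (u j) <= L.

Let a j := complex.Im (u j).
Let al := mean a.
Let a_gt0 j : 0 < a j. Proof. exact: u_sol.2. Qed.
Let L_gt0 : 0 < L. Proof. exact: lt_le_trans L_ge1. Qed.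
Let Li_gt0 : 0 < L^-1. Proof. by rewrite invr_gt0. Qed.

Lemma mean_im_gt0 : 0 < al.
Proof. exact: mean_gt0. Qed.

Lemma im_z_le : complex.Im z <= L ^+ 2 * al.
Proof.
rewrite -[leLHS](mean_const N_gt0) -meanZ; apply: ler_mean => // j.
have sq : 1 <= L ^+ 2 * cabs (u j) ^+ 2.
  rewrite -exprMn exprn_ege1 //.
  have -> : 1 = L * L^-1 by rewrite mulfV // gt_eqF.
  by rewrite ler_pM2l //; case/andP: (u_bnd j).
have s0 : 0 <= \sum_k S j k * a k.
  apply: sumr_ge0 => k _; rewrite mulr_ge0 ?(ltW (a_gt0 k)) //.
  case/andP: (S_bnd j k) => + _; apply: le_trans.
  by rewrite divr_ge0 ?(ltW Li_gt0) // ler0n.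
rewrite (_ : a j = cabs (u j) ^+ 2 * (complex.Im z + \sum_k S j k * a k)) ?mulrA;
  last exact: solves_im u_sol j.
have := ler_wpM2r (ltW z_im) sq.
have : 0 <= L ^+ 2 * cabs (u j) ^+ 2 * \sum_k S j k * a k.
  by apply: mulr_ge0 s0; rewrite mulr_ge0 ?sqr_ge0.
lra.
Qed.

Let A j := (complex.Im z + \sum_k S j k * a k) / al.
Let B := 2 * L ^+ 4.

Lemma stable_dom_ge1 : 1 <= B.
Proof. have := exprn_ege1 4 L_ge1; rewrite /B; lra. Qed.

(** By [solves_im], [a / al] is [|u| ^ 2 * A], and [A] lies between [L^-1] and [2 L ^ 2] since [S]
    averages [a] up to constants. The bounds hold however small [al] is, which makes the later
    constants uniform up to the real axis. *)
Lemma normalized_im_bounds j :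
  [/\ B^-1 <= a j / al <= B, B^-1 <= A j <= B & complex.Im z / al <= B].
Proof.
have al0 := mean_im_gt0.
have pw n m : (n <= m)%N -> L ^+ n <= L ^+ m by move=> h; rewrite ler_weXn2l.
have S1 : al / L <= \sum_k S j k * a k.
  rewrite mulrC; apply: ker_ge => // k; first by case/andP: (S_bnd j k).
  exact: ltW.
have S2 : \sum_k S j k * a k <= L * al.
  apply: ker_le => // k; first by case/andP: (S_bnd j k).
  exact: ltW.
have h1 : complex.Im z / al <= L ^+ 2 by rewrite ler_pdivrMr // im_z_le.
have h0 : 0 <= complex.Im z / al by rewrite divr_ge0 ?ltW.
have A1 : L^-1 <= A j.
  rewrite /A ler_pdivlMr //; rewrite mulrC; have := ltW z_im; lra.
have A2 : A j <= 2 * L ^+ 2.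
  rewrite /A mulrDl.
  have : (\sum_k S j k * a k) / al <= L by rewrite ler_pdivrMr.
  have := pw 1%N 2%N isT; rewrite expr1; lra.
have aA : a j / al = cabs (u j) ^+ 2 * A j by rewrite /a (solves_im u_sol) /A mulrA.
have [u1 u2] := andP (u_bnd j).
have uL : cabs (u j) ^+ 2 <= L ^+ 2 by rewrite lerXn2r ?nnegrE ?cabs_ge0 // ltW.
have uLi : L^-1 ^+ 2 <= cabs (u j) ^+ 2.
  by rewrite lerXn2r ?nnegrE ?cabs_ge0 // ltW.
have BL : B^-1 <= L^-1 ^+ 2 * L^-1.
  rewrite -exprSr exprVn lef_pV2 ?posrE ?exprn_gt0 ?mulr_gt0 ?exprn_gt0 //.
  by have := pw 3%N 4%N isT; have := exprn_ge0 4 (ltW L_gt0); rewrite /B; lra.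
have Lm : L^-1 ^+ 2 * L^-1 <= L^-1.
  by rewrite ler_piMl ?(ltW Li_gt0) // exprn_ile1 ?(ltW Li_gt0) // invf_le1.
have L4 := pw 2%N 4%N isT; have L40 := exprn_ge0 4 (ltW L_gt0).
split.
- rewrite aA; apply/andP; split.
    by apply: le_trans BL _; apply: ler_pM; rewrite ?exprn_ge0 ?(ltW Li_gt0).
  apply: le_trans (ler_pM _ _ uL A2) _; rewrite ?sqr_ge0 //.
    by apply: le_trans A1; exact: ltW.
  by rewrite le_eqVlt; apply/orP; left; apply/eqP; rewrite /B; ring.
- apply/andP; split; first by apply: le_trans BL _; exact: le_trans A1.
  by apply: le_trans A2 _; rewrite /B; lra.
- by apply: le_trans h1 _; rewrite /B; lra.
Qed.

End OneSolution.

Lemma argmax_cabs (R : realType) (N : nat) (g : 'I_N -> R[i]) : (0 < N)%N ->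
  exists j0, forall j, cabs (g j) <= cabs (g j0).
Proof.
move=> N_gt0; exists [arg max_(i > Ordinal N_gt0) cabs (g i)]%O => j.
by case: arg_maxP => // i _ H; exact: H.
Qed.

Lemma cabs_diff_conj (R : realType) (x : R[i]) :
  cabs (conjc x - x) = 2 * `|complex.Im x|.
Proof.
have -> : conjc x - x = (- 2 * complex.Im x)%:C * 'i%C.
  by case: x => a b; apply/eqP; rewrite eq_complex /=; apply/andP; split;
    apply/eqP; ring.
by rewrite cabsM cabs_i mulr1 cabs_real normrM normrN normr_nat.
Qed.

(** If the phase of [x * y] is close to 1, then [y / |y|] is close to the conjugate of [x / |x|].
    Both points lie above the real axis, so their imaginary parts add up in this comparison and must
    be small. One multiple of [|x|] times the phase gap pays for [y - conjc x], two for
    [conjc x - x]. *)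
Lemma upper_diff_le (R : realType) (x y : R[i]) :
  x != 0 -> y != 0 -> 0 <= complex.Im x -> 0 <= complex.Im y ->
  cabs (y - x) <= `|cabs y - cabs x| +
    3 * cabs x * cabs (1 - x * y / (cabs (x * y))%:C).
Proof.
move=> x0 y0 xi yi.
have nx : 0 < cabs x by rewrite cabs_gt0.
have ny : 0 < cabs y by rewrite cabs_gt0.
have cx : (cabs x)%:C != 0 :> R[i] by rewrite eq_complex /= eqxx andbT gt_eqF.
have cy : (cabs y)%:C != 0 :> R[i] by rewrite eq_complex /= eqxx andbT gt_eqF.
have xx : x * conjc x = ((cabs x)%:C) ^+ 2.
  rewrite -rmorphXn cabs_sqr; case: x {x0 xi nx cx} => a b.
  by apply/eqP; rewrite eq_complex /=; apply/andP; split; apply/eqP; ring.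
have phase : y / (cabs y)%:C - conjc x / (cabs x)%:C =
    (x * y / (cabs (x * y))%:C - 1) * (conjc x / (cabs x)%:C).
  rewrite cabsM rmorphM mulrBl mul1r; congr (_ - _).
  have -> : x * y / ((cabs x)%:C * (cabs y)%:C) * (conjc x / (cabs x)%:C) =
     (x * conjc x) * y / ((cabs x)%:C ^+ 2 * (cabs y)%:C) by field; rewrite cx cy.
  by rewrite xx; field; rewrite cx cy.
have nphase : cabs (y / (cabs y)%:C - conjc x / (cabs x)%:C) =
    cabs (1 - x * y / (cabs (x * y))%:C).
  rewrite phase cabsM [cabs (conjc x / _)]cabsM cabsV cabs_conj cabs_real.
  rewrite ger0_norm ?cabs_ge0 //.
  by rewrite mulfV ?gt_eqF // mulr1 cabsC.
set r := cabs (1 - _) in nphase *.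
have ImS (w : R[i]) (c : R) : complex.Im (w / c%:C) = complex.Im w / c.
  by rewrite mulrC -fmorphV cImMr mulrC.
have im_le : complex.Im x <= cabs x * r.
  have := cabs_Im (y / (cabs y)%:C - conjc x / (cabs x)%:C).
  rewrite nphase cImD cImN !ImS.
  have -> : complex.Im (conjc x) = - complex.Im x by case: (x).
  rewrite mulNr opprK => H.
  have y1 : 0 <= complex.Im y / cabs y by rewrite divr_ge0 ?cabs_ge0.
  rewrite mulrC -ler_pdivrMr //.
  by apply: le_trans H; apply: le_trans (ler_norm _); rewrite lerDr.
have d1 : cabs (y - conjc x) <= `|cabs y - cabs x| + cabs x * r.
  have -> : y - conjc x = (cabs y - cabs x)%:C * (y / (cabs y)%:C) +
     (cabs x)%:C * (y / (cabs y)%:C - conjc x / (cabs x)%:C).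
    by rewrite rmorphB /=; field; rewrite cx cy.
  apply: le_trans (cabsD _ _) _; rewrite !(cabsM _%:C) nphase !cabs_real.
  rewrite cabsM cabsV cabs_real [`|cabs y|]ger0_norm ?cabs_ge0 //.
  by rewrite mulfV ?gt_eqF // mulr1 [`|cabs x|]ger0_norm ?cabs_ge0.
have -> : y - x = (y - conjc x) + (conjc x - x) by ring.
apply: le_trans (cabsD _ _) _; rewrite cabs_diff_conj ger0_norm //; lra.
Qed.

Section TwoQVESolutions.
Variables (R : realType) (N : nat) (L : R) (S : 'I_N -> 'I_N -> R).
Hypotheses (N_gt0 : (0 < N)%N) (L_ge1 : 1 <= L).
Hypothesis S_sym : forall j k, S j k = S k j.
Hypothesis S_bnd : forall j k, L^-1 / N%:R <= S j k <= L / N%:R.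
Variables (z z' : R[i]) (u u' : 'I_N -> R[i]).
Hypotheses (z_im : 0 < complex.Im z) (z'_im : 0 < complex.Im z').
Hypotheses (u_sol : solves S z u) (u'_sol : solves S z' u').
Hypothesis u_bnd : forall j, L^-1 <= cabs (u j) <= L.
Hypothesis u'_bnd : forall j, L^-1 <= cabs (u' j) <= L.

Variable B : R.
Hypothesis B_E : B = 2 * L ^+ 4.
Let B_ge1 : 1 <= B. Proof. by rewrite B_E; exact: stable_dom_ge1. Qed.
Let B_gt0 : 0 < B. Proof. exact: lt_le_trans B_ge1. Qed.
Let L_gt0 : 0 < L. Proof. exact: lt_le_trans L_ge1. Qed.
Let L_le_B : L <= B.
Proof.
have h1 : L <= L ^+ 4 by rewrite -{1}[L]expr1 ler_weXn2l.
have h2 : 0 <= L ^+ 4 by rewrite exprn_ge0 ?ltW.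
rewrite B_E; lra.
Qed.
Let Bi_le_Li : B^-1 <= L^-1.
Proof. by rewrite lef_pV2 ?posrE. Qed.

Lemma solution_diff j :
  u' j - u j = u j * u' j * (z' - z + \sum_k (S j k)%:C * (u' k - u k)).
Proof.
have [e _] := u_sol; have [e' _] := u'_sol.
under eq_bigr do rewrite mulrBr; rewrite sumrB.
have -> : z' - z + (\sum_k (S j k)%:C * u' k - \sum_k (S j k)%:C * u k) =
  (z' + \sum_k (S j k)%:C * u' k) - (z + \sum_k (S j k)%:C * u k) by ring.
by rewrite mulrBr -mulrA e' [u j * u' j]mulrC -mulrA e; ring.
Qed.

Let al := mean (fun j => complex.Im (u j)).
Let al' := mean (fun j => complex.Im (u' j)).
Let f j := complex.Im (u j) / al.
Let f' j := complex.Im (u' j) / al'.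
Let A j := (complex.Im z + \sum_k S j k * complex.Im (u k)) / al.
Let A' j := (complex.Im z' + \sum_k S j k * complex.Im (u' k)) / al'.
Let h := complex.Im z / al.
Let h' := complex.Im z' / al'.
Let s j := Num.sqrt (f j * f' j).
Let Q j := Num.sqrt (A j * A' j).

Let al_gt0 : 0 < al. Proof. exact: (mean_im_gt0 N_gt0 u_sol). Qed.
Let al'_gt0 : 0 < al'. Proof. exact: (mean_im_gt0 N_gt0 u'_sol). Qed.

Let bnds j : [/\ B^-1 <= f j <= B, B^-1 <= A j <= B & h <= B].
Proof. by rewrite B_E; exact: normalized_im_bounds. Qed.

Let bnds' j : [/\ B^-1 <= f' j <= B, B^-1 <= A' j <= B & h' <= B].
Proof. by rewrite B_E; exact: normalized_im_bounds. Qed.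

Let fA j : f j = cabs (u j) ^+ 2 * A j.
Proof. by rewrite /f (solves_im u_sol) mulrA. Qed.

Let f'A j : f' j = cabs (u' j) ^+ 2 * A' j.
Proof. by rewrite /f' (solves_im u'_sol) mulrA. Qed.

Let Bi_gt0 : 0 < B^-1. Proof. by rewrite invr_gt0. Qed.

Let pos_of x : B^-1 <= x <= B -> 0 < x.
Proof. by case/andP => + _; exact: lt_le_trans. Qed.

Let f_gt0 j : 0 < f j. Proof. by apply: pos_of; case: (bnds j). Qed.
Let f'_gt0 j : 0 < f' j. Proof. by apply: pos_of; case: (bnds' j). Qed.
Let A_gt0 j : 0 < A j. Proof. by apply: pos_of; case: (bnds j). Qed.
Let A'_gt0 j : 0 < A' j. Proof. by apply: pos_of; case: (bnds' j). Qed.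

Let s_gt0 j : 0 < s j. Proof. by rewrite sqrtr_gt0 mulr_gt0. Qed.

Let sQ j : s j = cabs (u j) * cabs (u' j) * Q j.
Proof.
rewrite /s /Q fA f'A.
have -> : cabs (u j) ^+ 2 * A j * (cabs (u' j) ^+ 2 * A' j) =
   (cabs (u j) * cabs (u' j)) ^+ 2 * (A j * A' j) by ring.
by rewrite sqrtrM ?sqr_ge0 // sqrtr_sqr ger0_norm // mulr_ge0 ?cabs_ge0.
Qed.

Let s_le j : s j <= B.
Proof.
rewrite -(@ler_pXn2r _ 2) ?nnegrE ?(ltW (s_gt0 j)) ?(ltW B_gt0) //.
rewrite sqr_sqrtr; last by rewrite ltW // mulr_gt0.
rewrite expr2; apply: ler_pM; rewrite ?(ltW (f_gt0 j)) ?(ltW (f'_gt0 j)) //.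
  by case: (bnds j) => /andP[].
by case: (bnds' j) => /andP[].
Qed.

Let mean_f1 : mean f = 1.
Proof.
rewrite /f; under eq_mean do rewrite mulrC; rewrite meanZ.
by rewrite -/al mulVf // gt_eqF.
Qed.

Let mean_f'1 : mean f' = 1.
Proof.
rewrite /f'; under eq_mean do rewrite mulrC; rewrite meanZ.
by rewrite -/al' mulVf // gt_eqF.
Qed.

Let AE j : A j = h + \sum_k S j k * f k.
Proof.
rewrite /A /h /f mulrDl; congr (_ + _); rewrite mulr_suml.
by apply: eq_bigr => k _; rewrite mulrA.
Qed.

Let A'E j : A' j = h' + \sum_k S j k * f' k.
Proof.
rewrite /A' /h' /f' mulrDl; congr (_ + _); rewrite mulr_suml.
by apply: eq_bigr => k _; rewrite mulrA.
Qed.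

Let g j := u' j - u j.
Let w := z' - z.
Let U j := u j * u' j / (cabs (u j * u' j))%:C.
Let r j := cabs (1 - U j).

Let u_neq0 j : u j != 0. Proof. exact: solves_neq0 u_sol _. Qed.
Let u'_neq0 j : u' j != 0. Proof. exact: solves_neq0 u'_sol _. Qed.

Let SB j k : B^-1 / N%:R <= S j k <= B / N%:R.
Proof.
have /andP[h1 h2] := S_bnd j k.
apply/andP; split; [apply: le_trans h1|apply: (le_trans h2)].
  by rewrite ler_wpM2r.
by rewrite ler_wpM2r.
Qed.

(** From [|u| ^ 2 = f / A] for both solutions; dividing the difference of squares by the sum of the
    moduli costs only powers of [B]. *)
Let modulus_diff j : `|cabs (u' j) - cabs (u j)| <=
  B ^+ 4 * (`|A j - A' j| + `|f' j - f j|).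
Proof.
set p := cabs (u j); set p' := cabs (u' j).
have p1 : B^-1 <= p by apply: le_trans Bi_le_Li _; case/andP: (u_bnd j).
have p'0 : 0 <= p' by exact: cabs_ge0.
have p0 : 0 < p by apply: lt_le_trans p1.
have A0 := A_gt0 j; have A'0 := A'_gt0 j.
have [/andP[_ f1] /andP[a1 a2] _] := bnds j.
have [/andP[_ f2] /andP[a3 a4] _] := bnds' j.
have e : (p' - p) * (p' + p) = (f' j * (A j - A' j) + A' j * (f' j - f j)) / (A j * A' j).
  by rewrite f'A fA -/p -/p'; field; rewrite !gt_eqF.
have e2 : `|p' - p| * (p' + p) = `|f' j * (A j - A' j) + A' j * (f' j - f j)| / (A j * A' j).
  rewrite -[in LHS](ger0_norm (addr_ge0 p'0 (ltW p0))) -normrM e normrM normfV.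
  by rewrite [`|A j * _|]gtr0_norm // mulr_gt0.
have e3 : `|f' j * (A j - A' j) + A' j * (f' j - f j)| <= B * (`|A j - A' j| + `|f' j - f j|).
  apply: le_trans (ler_normD _ _) _; rewrite (normrM (f' j)) (normrM (A' j)) mulrDr.
  by rewrite lerD // ler_wpM2r // gtr0_norm.
have e4 : (A j * A' j)^-1 <= B ^+ 2.
  have -> : B ^+ 2 = (B^-1 ^+ 2)^-1 by rewrite exprVn invrK.
  have AA : 0 < A j * A' j by rewrite mulr_gt0.
  have BB : 0 < B^-1 ^+ 2 by rewrite exprn_gt0.
  rewrite lef_pV2 ?posrE ?AA ?BB //.
  by rewrite expr2; apply: ler_pM; rewrite ?(ltW Bi_gt0).
have e5 : `|p' - p| * B^-1 <= `|p' - p| * (p' + p).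
  by rewrite ler_wpM2l //; apply: le_trans p1 _; rewrite lerDr.
have e6 : `|p' - p| * B^-1 <= B * (`|A j - A' j| + `|f' j - f j|) * B ^+ 2.
  apply: le_trans e5 _; rewrite e2; apply: (ler_pM _ _ e3 e4) => //.
  by rewrite invr_ge0 ltW // mulr_gt0.
move: e6; move: (`|A j - A' j| + _) => X e6.
have -> : B ^+ 4 * X = B * X * B ^+ 2 * B by ring.
by rewrite -ler_pdivrMr.
Qed.

(** The product [4 * 96 * 200 * 4] that closes [holder_cube], where [B ^ 36] collects the exponents
    [6 + 10 + 12 + 8]. *)
Variable C0 : R.
Hypothesis C0_E : C0 = 384 * 800.

(** With [G] the maximum of [|u' - u|], [solution_gap_bounds] makes the profile, ratio and phase
    gaps of order [|w| / G]. By [modulus_diff] and [upper_diff_le] they bound the square mean of the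
    difference, which in turn bounds [G ^ 2]. *)
Lemma holder_cube j :
  cabs (u' j - u j) ^+ 3 <= (8 * B ^+ 4 + C0 * B ^+ 36) * cabs (z' - z).
Proof.
have [j0 hj0] := argmax_cabs g N_gt0.
pose G := cabs (g j0).
suff H : G ^+ 3 <= (8 * B ^+ 4 + C0 * B ^+ 36) * cabs w.
  apply: le_trans H; rewrite lerXn2r ?nnegrE ?cabs_ge0 //; exact: hj0.
have C0_ge0 : 0 <= C0.
  by rewrite C0_E; exact: mulr_ge0 (ler0n _ 384) (ler0n _ 800).
have w0 : 0 <= cabs w by exact: cabs_ge0.
have G0 : 0 <= G by exact: cabs_ge0.
have GB : G <= 2 * B.
  apply: le_trans (cabsB _ _) _.
  have /andP[_ h1] := u_bnd j0; have /andP[_ h2] := u'_bnd j0; have := L_le_B; lra.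
have pB n : 0 <= B ^+ n by rewrite exprn_ge0 // ltW.
(* If [|w|] dominates, the crude bound [G <= 2 B] suffices and gives the term [8 B ^ 4]. Otherwise
   [B ^ 2 * |w|] is below [G / 2] and can be absorbed. *)
have [wG|wG] := leP G (2 * B ^+ 2 * cabs w).
  have : G ^+ 2 * G <= (2 * B) ^+ 2 * (2 * B ^+ 2 * cabs w).
    by rewrite ler_pM ?sqr_ge0 // lerXn2r ?nnegrE ?mulr_ge0 ?(ltW B_gt0).
  have -> : (2 * B) ^+ 2 * (2 * B ^+ 2 * cabs w) = 8 * B ^+ 4 * cabs w by ring.
  have : 0 <= C0 * B ^+ 36 * cabs w by apply: mulr_ge0 => //; exact: mulr_ge0.
  rewrite -exprSr; lra.
have G_gt0 : 0 < G by apply: le_lt_trans wG; apply: mulr_ge0 => //; exact: mulr_ge0.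
have wleG : cabs w <= G.
  apply: le_trans (ltW wG); rewrite ler_peMl //.
  have := exprn_ege1 2 B_ge1; lra.
pose t k := g k / (s k)%:C.
have sC k : (s k)%:C != 0 :> R[i] by rewrite eq_complex /= eqxx andbT gt_eqF.
have st k : (s k)%:C * t k = g k by rewrite /t mulrC mulfVK.
have ucu j' : (cabs (u j' * u' j'))%:C != 0 :> R[i].
  by rewrite eq_complex /= eqxx andbT cabs_eq0 mulf_neq0.
have tE k : t k * (Q k)%:C = U k * (w + \sum_l (S k l)%:C * ((s l)%:C * t l)).
  under eq_bigr do rewrite st.
  apply: (mulfI (sC k)); rewrite mulrA st {1}/g solution_diff -/w.
  have -> : (s k)%:C = (cabs (u k * u' k))%:C * (Q k)%:C :> R[i].
    by rewrite -rmorphM cabsM -sQ.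
  by rewrite /U; field; exact: ucu.
have U1 k : cabs (U k) = 1.
  rewrite /U [cabs (_ / _)]cabsM cabsV cabs_real ger0_norm ?cabs_ge0 //.
  by rewrite mulfV // cabs_eq0 mulf_neq0.
have gt k : s k * cabs (t k) = cabs (g k).
  by rewrite -st (cabsM _%:C) cabs_real gtr0_norm.
have Gt k : s k * cabs (t k) <= G by rewrite gt.
have mg0 : 0 <= mean (fun k => cabs (g k)) by apply: mean_ge0 => // k; exact: cabs_ge0.
(* [S] averages, so one application of the difference equation bounds the maximum by a mean; the
   source is absorbed into [G]. *)
have mean_g : G <= 2 * B ^+ 3 * mean (fun k => cabs (g k)).
  have : G <= B ^+ 2 * (cabs w + B * mean (fun k => cabs (g k))).
    rewrite /G {1}/g solution_diff cabsM -/w; apply: ler_pM; rewrite ?cabs_ge0 //.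
      rewrite cabsM expr2 ler_pM ?cabs_ge0 //.
        by apply: le_trans L_le_B; case/andP: (u_bnd j0).
      by apply: le_trans L_le_B; case/andP: (u'_bnd j0).
    apply: le_trans (cabsD _ _) _; rewrite lerD2l; apply: cabs_ker => // k.
    have /andP[h1 ->] := SB j0 k; rewrite andbT; apply: le_trans h1.
    by rewrite divr_ge0 ?ler0n // ltW.
  have -> : B ^+ 2 * (cabs w + B * mean (fun k => cabs (g k))) =
     B ^+ 2 * cabs w + B ^+ 3 * mean (fun k => cabs (g k)) by ring.
  lra.
pose K0 := 4 * B ^+ 8.
have K00 : 0 <= K0 by rewrite mulr_ge0.
have GK : G ^+ 2 <= K0 * mean (fun k => cabs (t k) ^+ 2).
  have m1 : mean (fun k => cabs (g k)) <= B * mean (fun k => cabs (t k)).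
    rewrite -meanZ; apply: ler_mean => // k.
    by rewrite -gt ler_wpM2r ?cabs_ge0.
  have m2 : 0 <= mean (fun k => cabs (t k)).
    by apply: mean_ge0 => // k; exact: cabs_ge0.
  have m3 : G <= 2 * B ^+ 4 * mean (fun k => cabs (t k)).
    apply: le_trans mean_g _; rewrite (_ : 2 * B ^+ 4 * _ = 2 * B ^+ 3 * (B * mean (fun k => cabs (t k)))); last by ring.
    by rewrite ler_wpM2l // mulr_ge0.
  have m4 : G ^+ 2 <= (2 * B ^+ 4 * mean (fun k => cabs (t k))) ^+ 2.
    rewrite lerXn2r ?nnegrE //; exact: le_trans m3.
  apply: le_trans m4 _; rewrite exprMn.
  have -> : (2 * B ^+ 4) ^+ 2 = K0 by rewrite /K0; ring.
  by rewrite ler_wpM2l // mean_sqr_le.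
have hB : 0 <= h <= B.
  apply/andP; split; first exact: divr_ge0 (ltW z_im) (ltW al_gt0).
  by case: (bnds j0).
have h'B : 0 <= h' <= B.
  apply/andP; split; first exact: divr_ge0 (ltW z'_im) (ltW al'_gt0).
  by case: (bnds' j0).
have [M1 M2 M3] : [/\ G * mean (fun k => (f k - f' k) ^+ 2) <= 200 * K0 * B ^+ 12 * cabs w,
      G * (h + h') <= 200 * K0 * B ^+ 12 * cabs w &
      G * mean (fun j => r j ^+ 2) <= 200 * K0 * B ^+ 12 * cabs w].
  apply: (@solution_gap_bounds R N B S f f' A A' h h' _ _ _ _ _ _ _ _ _ _ _ _ _ _ t U w G) => //.
  - by move=> k; case: (bnds k).
  - by move=> k; case: (bnds' k).
  - by move=> k; case: (bnds k).
  - by move=> k; case: (bnds' k).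
pose K := 200 * K0 * B ^+ 12.
pose M := mean (fun k => (f k - f' k) ^+ 2).
rewrite -/K -/M in M1 M2 M3.
have M0 : 0 <= M by apply: mean_ge0 => // k; exact: sqr_ge0.
have /andP[h0 hb] := hB; have /andP[h'0 h'b] := h'B.
have pw k : cabs (g k) ^+ 2 <= 3 * (B ^+ 8 * (4 * B * (h + h') + 2 * B ^+ 2 * M)
     + B ^+ 8 * (f k - f' k) ^+ 2 + 9 * B ^+ 2 * r k ^+ 2).
  have g1 : cabs (g k) <= B ^+ 4 * `|A k - A' k| + B ^+ 4 * `|f' k - f k| + 3 * B * r k.
    apply: le_trans (upper_diff_le (u_neq0 k) (u'_neq0 k) _ _) _.
    - by apply: ltW; case: u_sol.
    - by apply: ltW; case: u'_sol.
    rewrite -/(U k) -/(r k) -mulrDr lerD //.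
    rewrite -!mulrA ler_wpM2l // ler_wpM2r ?cabs_ge0 //.
    by apply: le_trans L_le_B; case/andP: (u_bnd k).
  have g2 := sqr_sum3_le (cabs_ge0 (g k)) g1.
  (* [A = h + S f] reduces the gap in [A] to those in [h] and [f]. Only the first power of [h + h']
     is controlled, so one factor of [(h - h') ^ 2] is given up for [2 B]. *)
  have A2 : `|A k - A' k| ^+ 2 <= 4 * B * (h + h') + 2 * B ^+ 2 * M.
    rewrite real_normK ?num_real // AE A'E.
    have -> : h + \sum_k0 S k k0 * f k0 - (h' + \sum_k0 S k k0 * f' k0) =
      (h - h') + \sum_l S k l * (f l - f' l).
      by under [in RHS]eq_bigr do rewrite mulrBr; rewrite sumrB; ring.
    set X := \sum_l _.
    have X1 : `|X| <= B * mean (fun l => `|f l - f' l|).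
      apply: le_trans (ler_norm_sum _ _ _) _.
      under eq_bigr => l _.
        rewrite normrM [`|S k l|]ger0_norm; last first.
          have /andP[h1 _] := SB k l; apply: le_trans h1.
          by rewrite divr_ge0 ?ler0n // ltW.
        over.
      apply: ker_le => // l; by case/andP: (SB k l).
    have X2 : X ^+ 2 <= B ^+ 2 * M.
      rewrite -real_normK ?num_real //.
      apply: le_trans (_ : (B * mean (fun l => `|f l - f' l|)) ^+ 2 <= _).
        rewrite lerXn2r ?nnegrE //; exact: le_trans X1.
      rewrite exprMn ler_wpM2l ?sqr_ge0 //.
      apply: le_trans (mean_sqr_le N_gt0 _) _.
      by rewrite /M; under eq_mean do rewrite real_normK ?num_real //.
    have hh : (h - h') ^+ 2 <= 2 * B * (h + h').
      have q1 : (h - h') ^+ 2 <= (h + h') * (h + h').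
        have := mulr_ge0 h0 h'0; nra.
      apply: le_trans q1 _; rewrite ler_wpM2r ?addr_ge0 //; lra.
    have := sqr_ge0 (h - h' - X); move: hh X2; rewrite -/w; nra.
  apply: le_trans g2 _; rewrite ler_wpM2l //.
  have e1 x : (B ^+ 4 * x) ^+ 2 = B ^+ 8 * x ^+ 2 by ring.
  have e2 x : (3 * B * x) ^+ 2 = 9 * B ^+ 2 * x ^+ 2 by ring.
  have e3 : `|f' k - f k| ^+ 2 = (f k - f' k) ^+ 2.
    by rewrite distrC real_normK ?num_real.
  by rewrite !e1 e2 e3 lerD // lerD // ler_wpM2l.
have tot : G * mean (fun k => cabs (g k) ^+ 2) <= 32 * 3 * (B ^+ 10 * (K * cabs w)).
  have t1 := ler_mean N_gt0 pw.
  rewrite meanZ !meanD mean_const // !meanZ -/M in t1.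
  apply: le_trans (ler_wpM2l G0 t1) _.
  set MR := mean (fun j => r j ^+ 2) in M3 *.
  have -> : G * (3 * (B ^+ 8 * (4 * B * (h + h') + 2 * B ^+ 2 * M) + B ^+ 8 * M + 9 * B ^+ 2 * MR)) =
    3 * (4 * (B ^+ 9 * (G * (h + h'))) + 2 * (B ^+ 10 * (G * M)) + B ^+ 8 * (G * M) + 9 * (B ^+ 2 * (G * MR))) by ring.
  have Kw : 0 <= K * cabs w.
    apply: mulr_ge0 => //; apply: mulr_ge0 => //; exact: mulr_ge0.
  have bd n x : (n <= 10)%N -> G * x <= K * cabs w -> B ^+ n * (G * x) <= B ^+ 10 * (K * cabs w).
    move=> hn hx; apply: le_trans (ler_wpM2l (pB n) hx) _.
    by rewrite ler_wpM2r // ler_weXn2l.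
  have := bd 9%N _ isT M2; have := bd 10%N _ isT M1; have := bd 8%N _ isT M1.
  have := bd 2%N _ isT M3; have : 0 <= B ^+ 10 * (K * cabs w) by rewrite mulr_ge0.
  lra.
have G2 : G ^+ 2 <= 4 * B ^+ 6 * mean (fun k => cabs (g k) ^+ 2).
  have : G ^+ 2 <= (2 * B ^+ 3 * mean (fun k => cabs (g k))) ^+ 2.
    rewrite lerXn2r ?nnegrE //; exact: le_trans mean_g.
  move=> H; apply: le_trans H _; rewrite exprMn.
  have -> : (2 * B ^+ 3) ^+ 2 = 4 * B ^+ 6 by ring.
  apply: ler_wpM2l; [exact: mulr_ge0|exact: mean_sqr_le].
have : G * G ^+ 2 <= 4 * B ^+ 6 * (32 * 3 * (B ^+ 10 * (K * cabs w))).
  apply: le_trans (ler_wpM2l G0 G2) _.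
  rewrite mulrCA; apply: ler_wpM2l => //; exact: mulr_ge0.
have -> : 4 * B ^+ 6 * (32 * 3 * (B ^+ 10 * (K * cabs w))) = C0 * B ^+ 36 * cabs w.
  rewrite C0_E /K /K0; ring.
have : 0 <= 8 * B ^+ 4 * cabs w by apply: mulr_ge0 => //; exact: mulr_ge0.
rewrite -exprS; lra.
Qed.

End TwoQVESolutions.

(** * The symmetrized kernel *)

Section SelfConsistentKernel.
Variables (R : realType) (N : nat) (L : R) (F : 'I_N -> 'I_N -> R).
Variables (v : 'I_N -> R) (lam : R).
Hypotheses (N_gt0 : (0 < N)%N) (L_ge1 : 1 <= L).
Hypothesis F_sym : forall j k, F j k = F k j.
Hypothesis F_bnd : forall j k, L^-1 / N%:R <= F j k <= L / N%:R.
Hypothesis v_gt0 : forall j, 0 < v j.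
Hypothesis v_eig : forall j, \sum_k F j k * v k = lam * v j.
Hypothesis v_norm : mean (fun j => v j ^+ 2) = 1.
Hypothesis lam_bnd : 2^-1 <= lam <= 1.

Let L_gt0 : 0 < L. Proof. exact: lt_le_trans L_ge1. Qed.
Let Li_gt0 : 0 < L^-1. Proof. by rewrite invr_gt0. Qed.
Let F_ge0 j k : 0 <= F j k.
Proof.
case/andP: (F_bnd j k) => + _; apply: le_trans.
by rewrite divr_ge0 ?ler0n // ltW.
Qed.

Lemma F_ge0_le j k : 0 <= F j k <= L / N%:R.
Proof. by rewrite F_ge0; case/andP: (F_bnd j k). Qed.

Lemma perron_le j : v j <= 2 * L.
Proof.
have mv : mean v <= 1.
  have : mean v <= mean (fun j => 2^-1 * (1 + v j ^+ 2)).
    by apply: ler_mean => // k; have := sqr_ge0 (v k - 1); nra.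
  rewrite meanZ meanD mean_const // v_norm; lra.
have : lam * v j <= L * mean v.
  rewrite -v_eig; apply: ker_le => k; last exact: ltW.
  by case/andP: (F_bnd j k).
have : L * mean v <= L by rewrite ger_pMr.
have : 2^-1 * v j <= lam * v j.
  by rewrite ler_pM2r //; case/andP: lam_bnd.
lra.
Qed.

Lemma perron_mean : (2 * L)^-1 <= mean v.
Proof.
have : mean (fun j => v j ^+ 2) <= mean (fun j => 2 * L * v j).
  apply: ler_mean => // k; rewrite expr2 ler_wpM2r ?perron_le //; exact: ltW.
rewrite v_norm meanZ => h.
by rewrite -[leLHS]mul1r ler_pdivrMr ?mulr_gt0 // mulrC.
Qed.

(* [v j * (lam * x j - (F x) j)] tested against [x / v] is the Dirichlet form of [F j k * v j * v k]
   at [x / v], whose weights are all at least of order [1 / N]. *)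
Lemma perron_gap (x : 'I_N -> R) :
  (4 * L ^+ 3)^-1 * (mean (fun j => x j ^+ 2) - mean (fun j => v j * x j) ^+ 2) <=
  mean (fun j => x j * (lam * x j - \sum_k F j k * x k)).
Proof.
pose y j := x j / v j.
have xE j : x j = v j * y j by rewrite /y mulrC mulfVK // gt_eqF.
have e1 : mean (fun j => x j ^+ 2) - mean (fun j => v j * x j) ^+ 2 =
  2^-1 * mean (fun j => mean (fun k => v j ^+ 2 * v k ^+ 2 * (y j - y k) ^+ 2)).
  transitivity (2^-1 * (mean (fun j => x j ^+ 2 * mean (fun k => v k ^+ 2)) +
     mean (fun j => mean (fun k => v j ^+ 2 * x k ^+ 2))
     - 2 * mean (fun j => v j * x j * mean (fun k => v k * x k)))).
    have meanZr (f : 'I_N -> R) a : mean (fun j => f j * a) = mean f * a.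
      by under eq_mean do rewrite mulrC; rewrite meanZ mulrC.
    rewrite !meanZr v_norm; under [X in _ * (_ + X - _)]eq_mean do rewrite meanZ.
    by rewrite meanZr v_norm; field.
  congr (_ * _); rewrite -meanZ -meanD -meanB; apply: eq_mean => j.
  rewrite -!meanZ -meanD -meanB; apply: eq_mean => k.
  rewrite !xE; ring.
have e2 : mean (fun j => x j * (lam * x j - \sum_k F j k * x k)) =
  2^-1 * (N%:R^-1 * \sum_j \sum_k F j k * (v j * v k) * (y j - y k) ^+ 2).
  rewrite /mean mulrCA; congr (_ * _).
  have s1 : \sum_j \sum_k F j k * (v j * v k) * y j ^+ 2 = \sum_j lam * x j ^+ 2.
    apply: eq_bigr => j _.
    transitivity ((\sum_k F j k * v k) * (v j * y j ^+ 2)).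
      by rewrite mulr_suml; apply: eq_bigr => k _; ring.
    rewrite v_eig xE; ring.
  have s2 : \sum_j \sum_k F j k * (v j * v k) * y k ^+ 2 = \sum_j lam * x j ^+ 2.
    rewrite -s1 exchange_big /=; apply: eq_bigr => j _; apply: eq_bigr => k _.
    by rewrite F_sym; ring.
  transitivity (2^-1 * (\sum_j \sum_k F j k * (v j * v k) * y j ^+ 2 +
     \sum_j \sum_k F j k * (v j * v k) * y k ^+ 2 -
     2 * \sum_j x j * \sum_k F j k * x k)).
    rewrite s1 s2; under eq_bigr do rewrite mulrBr.
    rewrite sumrB (eq_bigr (fun j => lam * x j ^+ 2)); last by move=> j _; ring.
    by field.
  congr (_ * _); rewrite mulr_sumr -big_split -sumrB; apply: eq_bigr => j _ /=.
  rewrite mulrA mulr_sumr -big_split -sumrB; apply: eq_bigr => k _ /=.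
  rewrite !xE; ring.
rewrite e1 e2 mulrCA ler_pM2l // /mean -mulr_sumr mulrCA ler_pM2l ?invr_gt0 ?ltr0n //.
rewrite mulrA mulr_sumr; apply: ler_sum => j _; rewrite mulr_sumr; apply: ler_sum => k _.
rewrite [X in X <= _]mulrA ler_wpM2r ?sqr_ge0 //.
have vv : v j * v k <= 4 * L ^+ 2.
  have -> : 4 * L ^+ 2 = (2 * L) * (2 * L) by ring.
  by apply: ler_pM; rewrite ?perron_le ?(ltW (v_gt0 _)).
have vv0 : 0 < v j * v k by rewrite mulr_gt0.
have F1 : L^-1 / N%:R * (v j * v k) <= F j k * (v j * v k).
  by rewrite ler_wpM2r ?(ltW vv0) //; case/andP: (F_bnd j k).
apply: le_trans F1.
have -> : (4 * L ^+ 3)^-1 / N%:R * (v j ^+ 2 * v k ^+ 2) =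
  L^-1 / N%:R * ((4 * L ^+ 2)^-1 * (v j * v k) * (v j * v k)).
  by field; rewrite !gt_eqF // ltr0n.
rewrite ler_wpM2l ?divr_ge0 ?ler0n ?(ltW Li_gt0) //.
rewrite ler_piMl ?(ltW vv0) // mulrC ler_pdivrMr ?mul1r //.
by rewrite mulr_gt0 // exprn_gt0.
Qed.

Let mean_vv_le (x : 'I_N -> R) : `|mean (fun k => v k * x k)| <= 2 * L * mean (fun k => `|x k|).
Proof.
apply: le_trans (ler_norm_mean N_gt0 _) _; rewrite -meanZ; apply: ler_mean => // k.
rewrite normrM gtr0_norm // ler_wpM2r // perron_le //.
Qed.

(** The operator [1 - F + v <v, .>] is coercive in the square mean: [perron_gap] covers the part
    orthogonal to [v], the rank-one term the rest. The sup bound follows since [F] and the rank-one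
    term send means to bounded functions. The three terms of [x = h + F x - v <v, x>] cost [X],
    [4 L ^ 4 X] and [16 L ^ 5 X], whence 21. *)
Lemma kernel_inverse_real (x : 'I_N -> R) X :
  (forall j, `|x j - \sum_k F j k * x k + v j * mean (fun k => v k * x k)| <= X) ->
  forall j, `|x j| <= 21 * L ^+ 5 * X.
Proof.
move=> hX.
pose h j := x j - \sum_k F j k * x k + v j * mean (fun k => v k * x k).
have X0 : 0 <= X by apply: le_trans (hX (Ordinal N_gt0)).
pose D := 4 * L ^+ 3.
have D_gt0 : 0 < D by rewrite mulr_gt0 // exprn_gt0.
have pL n : 1 <= L ^+ n by exact: exprn_ege1.
have D_ge1 : 1 <= D by have := pL 3%N; rewrite /D; lra.
pose x2 := mean (fun j => x j ^+ 2).
have x20 : 0 <= x2 by apply: mean_ge0 => // j; exact: sqr_ge0.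
have coer : D^-1 * x2 <= mean (fun j => x j * h j).
  have -> : mean (fun j => x j * h j) = mean (fun j => x j * (lam * x j - \sum_k F j k * x k))
     + (1 - lam) * x2 + mean (fun k => v k * x k) ^+ 2.
    rewrite -meanZ -meanD expr2 -[X in _ + X]meanZ -meanD.
    by apply: eq_mean => j; rewrite /h; ring.
  have := perron_gap x; rewrite -/D -/x2.
  have l1 : 0 <= (1 - lam) * x2.
    by rewrite mulr_ge0 //; case/andP: lam_bnd => _; lra.
  have Di : D^-1 * mean (fun k => v k * x k) ^+ 2 <= mean (fun k => v k * x k) ^+ 2.
    by rewrite ler_piMl ?sqr_ge0 // invf_le1.
  lra.
(* Young's inequality with weight [D], so that half of the coercive term survives. *)
have amgm : mean (fun j => x j * h j) <= (2 * D)^-1 * x2 + D / 2 * X ^+ 2.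
  rewrite -[X in _ + X](mean_const N_gt0) -meanZ -meanD; apply: ler_mean => // j.
  have hj : h j ^+ 2 <= X ^+ 2.
    rewrite -real_normK ?num_real // lerXn2r ?nnegrE //; exact: hX.
  have : D / 2 * h j ^+ 2 <= D / 2 * X ^+ 2 by rewrite ler_wpM2l // divr_ge0 // ltW.
  have := sqr_ge0 (x j - D * h j).
  have -> : (x j - D * h j) ^+ 2 = 2 * D * ((2 * D)^-1 * x j ^+ 2 + D / 2 * h j ^+ 2 - x j * h j).
    by field; rewrite gt_eqF.
  rewrite pmulr_rge0 ?mulr_gt0 //; lra.
have x2X : x2 <= (D * X) ^+ 2.
  have e : D^-1 * x2 = 2 * ((2 * D)^-1 * x2) by field; rewrite gt_eqF.
  have : (2 * D)^-1 * x2 <= D / 2 * X ^+ 2 by lra.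
  rewrite mulrC ler_pdivrMr ?mulr_gt0 //; lra.
have DX0 : 0 <= D * X by apply: mulr_ge0 => //; exact: ltW.
have ax : mean (fun j => `|x j|) <= D * X.
  have m0 : 0 <= mean (fun j => `|x j|) by apply: mean_ge0.
  rewrite -(@ler_pXn2r _ 2) ?nnegrE //.
  apply: le_trans (mean_sqr_le N_gt0 _) _.
  rewrite (_ : mean _ = x2) //.
  by apply: eq_mean => k; rewrite real_normK ?num_real.
move=> j.
have -> : x j = h j + \sum_k F j k * x k - v j * mean (fun k => v k * x k).
  by rewrite /h; ring.
have t1 : `|\sum_k F j k * x k| <= L * (D * X).
  apply: le_trans (ler_norm_sum _ _ _) _.
  under eq_bigr do rewrite normrM ger0_norm ?F_ge0 //.
  apply: le_trans (ker_le (C := L) _ _) _ => // [k|].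
    by case/andP: (F_bnd j k).
  by rewrite ler_wpM2l // ltW.
have t2 : `|v j * mean (fun k => v k * x k)| <= 4 * L ^+ 2 * (D * X).
  have -> : 4 * L ^+ 2 * (D * X) = (2 * L) * (2 * L * (D * X)) by ring.
  rewrite normrM gtr0_norm //; apply: ler_pM => //.
  - exact: ltW.
  - exact: perron_le.
  - apply: le_trans (mean_vv_le x) _; rewrite ler_wpM2l //.
    by rewrite mulr_ge0 // ltW.
have t3 := hX j; rewrite -/(h j) in t3.
apply: le_trans (ler_normB _ _) _; apply: le_trans (lerD (ler_normD _ _) (lexx _)) _.
have p1 : X <= L ^+ 5 * X by rewrite ler_peMl.
have p2 : L ^+ 4 * X <= L ^+ 5 * X by rewrite ler_wpM2r // ler_weXn2l.
have q1 : L * (D * X) = 4 * (L ^+ 4 * X) by rewrite /D; ring.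
have q2 : 4 * L ^+ 2 * (D * X) = 16 * (L ^+ 5 * X) by rewrite /D; ring.
rewrite q1 in t1; rewrite q2 in t2; lra.
Qed.

(** The orthogonal projection onto [v]; adding it lifts the almost vanishing eigenvalue of
    [1 - F]. *)
Definition Jop (u : 'I_N -> R[i]) (j : 'I_N) : R[i] :=
  (v j)%:C * mean (fun k => (v k)%:C * u k).

Definition Fapp (u : 'I_N -> R[i]) (j : 'I_N) : R[i] :=
  \sum_k (F j k)%:C * u k.

Lemma cabs_Fapp u X : (forall j, cabs (u j) <= X) ->
  forall j, cabs (Fapp u j) <= L * X.
Proof.
move=> h j; apply: cabs_ker_le => //; first exact: ltW.
by move=> k; exact: F_ge0_le.
Qed.

Lemma cabs_mean_v u X : (forall j, cabs (u j) <= X) ->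
  cabs (mean (fun k => (v k)%:C * u k)) <= 2 * L * X.
Proof.
move=> h; apply: cabs_mean_le => // k; rewrite cabsM cabs_real gtr0_norm //.
by apply: ler_pM; rewrite ?cabs_ge0 ?perron_le // ltW.
Qed.

Lemma kernel_inverse u X :
  (forall j, cabs (u j - Fapp u j + Jop u j) <= X) ->
  forall j, cabs (u j) <= 42 * L ^+ 5 * X.
Proof.
move=> hX j; apply: le_trans (cabs_le_ReIm _) _.
have h1 : forall j, `|complex.Re (u j)| <= 21 * L ^+ 5 * X.
  apply: kernel_inverse_real => k; apply: le_trans (hX k).
  apply: le_trans (cabs_Re _); rewrite cReD cReD cReN cRe_sum cReMr cRe_mean.
  under [X in _ <= `|_ - X + _|]eq_bigr do rewrite cReMr.
  by under [X in _ <= `|_ + _ * X|]eq_mean do rewrite cReMr.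
have h2 : forall j, `|complex.Im (u j)| <= 21 * L ^+ 5 * X.
  apply: kernel_inverse_real => k; apply: le_trans (hX k).
  apply: le_trans (cabs_Im _); rewrite cImD cImD cImN cIm_sum cImMr cIm_mean.
  under [X in _ <= `|_ - X + _|]eq_bigr do rewrite cImMr.
  by under [X in _ <= `|_ + _ * X|]eq_mean do rewrite cImMr.
have := h1 j; have := h2 j; lra.
Qed.

Definition MU (U u : 'I_N -> R[i]) (j : 'I_N) : R[i] := u j - U j * Fapp u j.

(** At a point where [|u|] is maximal, replacing [U] by 1 and dropping [w] costs [(d L + e) |u|].
    The smallness hypothesis makes this at most half of the left side, so the constant 42 of
    [kernel_inverse] doubles. *)
Lemma shifted_inverse (U u : 'I_N -> R[i]) (w : R[i]) d e X :
  (forall j, cabs (U j - 1) <= d) -> cabs w <= e ->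
  (d * L + e) * (84 * L ^+ 5) <= 1 ->
  (forall j, cabs (MU U u j - w * u j + Jop u j) <= X) ->
  forall j, cabs (u j) <= 84 * L ^+ 5 * X.
Proof.
move=> hU hw small hX j.
have [j0 hj0] := argmax_cabs u N_gt0; apply: le_trans (hj0 j) _.
set G := cabs (u j0) in hj0 *.
have G0 : 0 <= G by exact: cabs_ge0.
have H : forall k, cabs (u k - Fapp u k + Jop u k) <= X + (d * L + e) * G.
  move=> k.
  have -> : u k - Fapp u k + Jop u k =
    (MU U u k - w * u k + Jop u k) + ((U k - 1) * Fapp u k + w * u k).
    by rewrite /MU; ring.
  apply: le_trans (cabsD _ _) _; rewrite lerD //.
  apply: le_trans (cabsD _ _) _; rewrite !cabsM mulrDl lerD //.
    rewrite -mulrA; apply: ler_pM; rewrite ?cabs_ge0 //; exact: cabs_Fapp.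
  by apply: ler_pM; rewrite ?cabs_ge0.
have := kernel_inverse H j0; rewrite -/G.
have := ler_wpM2r G0 small; lra.
Qed.

End SelfConsistentKernel.

Lemma injective_unitmx (K : fieldType) (n : nat) (A : 'M[K]_n) :
  (forall x : 'cV[K]_n, A *m x = 0 -> x = 0) -> A \in unitmx.
Proof.
move=> inj; rewrite -unitmx_tr -row_free_unit -kermx_eq0.
apply/eqP/row_matrixP => i; rewrite row0.
apply: trmx_inj; rewrite trmx0; apply: inj.
apply: trmx_inj; rewrite trmx_mul trmxK trmx0.
by apply/sub_kermxP; exact: row_sub.
Qed.

(** * The eigenvalue near zero as a fixed point *)

Section Contraction.
Variables (R : realType) (T : R[i] -> R[i]) (e : R).
Hypothesis e_gt0 : 0 < e.
Hypothesis T0 : cabs (T 0) <= e / 2.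
Hypothesis T_contr : forall w w', cabs w <= e -> cabs w' <= e ->
  cabs (T w - T w') <= 4^-1 * cabs (w - w').

Let s n := iter n T 0.

Let s_bnd n : cabs (s n) <= e.
Proof.
elim: n => [|n IH]; first by rewrite cabs0 ltW.
have -> : s n.+1 = T 0 + (T (s n) - T 0) by rewrite /s iterS; ring.
have e0 : cabs (0 : R[i]) <= e by rewrite cabs0 ltW.
apply: le_trans (cabsD _ _) _; apply: le_trans (lerD T0 (T_contr IH e0)) _.
rewrite subr0; have : 0 < e by [].
move: IH; lra.
Qed.

Let s_step n : cabs (s n.+1 - s n) <= e / 2 * 4^-1 ^+ n.
Proof.
elim: n => [|n IH]; first by rewrite subr0 expr0 mulr1.
rewrite /s iterS [X in _ - X]iterS -/(s n.+1) -/(s n).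
apply: le_trans (T_contr (s_bnd _) (s_bnd _)) _.
by rewrite exprS; have := IH; lra.
Qed.

Let cvg_of (f : R[i] -> R) : (forall x y, f x - f y = f (x - y)) ->
  (forall x, `|f x| <= cabs x) -> exists l : R, f (s n) @[n --> \oo] --> l.
Proof.
move=> fB fle.
have : cvgn (series (telescope (fun n => f (s n)))).
  apply: normed_cvg.
  apply: (@series_le_cvg _ _ (geometric (e / 2) 4^-1)) => [n|n|n|].
  - exact: normr_ge0.
  - by rewrite /geometric /= mulr_ge0 ?exprn_ge0 // divr_ge0 // ltW.
  - by rewrite /telescope /= fB; apply: le_trans (fle _) _; exact: s_step.
  - apply: is_cvg_geometric_series; rewrite ger0_norm //; lra.
move=> /cvg_ex[/= l hl]; exists (l + f (s 0)).
have -> : (fun n => f (s n)) = (fun n => series (telescope (fun n => f (s n))) n + f (s 0%N)).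
  by apply/funext => n; rewrite [LHS](eq_sum_telescope (fun n => f (s n))) addrC.
by apply: cvgD => //; exact: cvg_cst.
Qed.

(** The iterates from 0 stay in the disc because [T 0] is at most [e / 2]; their real and imaginary
    parts converge as absolutely convergent telescoping series. The bound linear in [T 0] will make
    the eigenvalue as small as the perturbation, not merely smaller than [e]. *)
Lemma disc_contraction : exists w, [/\ cabs w <= e, cabs w <= 2 * cabs (T 0) & T w = w].
Proof.
have [a ha] := cvg_of (fun x y => esym (raddfB (@complex.Re R) x y)) (@cabs_Re R).
have [b hb] := cvg_of (fun x y => esym (raddfB (@complex.Im R) x y)) (@cabs_Im R).
pose w : R[i] := a +i* b.
have near_w d : 0 < d -> exists n, cabs (s n - w) <= d /\ cabs (s n.+1 - w) <= d.
  move=> d0; have d2 : 0 < d / 2 by rewrite divr_gt0.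
  move/cvgrPdist_le : ha => /(_ _ d2)[na _ ha]; move/cvgrPdist_le : hb => /(_ _ d2)[nb _ hb].
  exists (maxn na nb).
  have H n : (na <= n)%N -> (nb <= n)%N -> cabs (s n - w) <= d.
    move=> h1 h2; rewrite cabsC; apply: le_trans (cabs_le_ReIm _) _.
    have := ha n h1; have := hb n h2; rewrite !raddfB /=; lra.
  by split; apply: H; rewrite ?leqW ?leq_maxl ?leq_maxr.
have we : cabs w <= e.
  apply/ler_addgt0Pr => d /near_w[n [h _]].
  have -> : w = s n - (s n - w) by ring.
  by apply: le_trans (cabsB _ _) _; rewrite lerD.
have Tw : T w = w.
  apply/eqP; rewrite -subr_eq0 -cabs_eq0; apply/eqP/le_anti; rewrite cabs_ge0 andbT.
  apply/ler_addgt0Pr => d d0; rewrite add0r.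
  have [n [h1 h2]] := near_w _ (divr_gt0 d0 (ltr0Sn R 1)).
  have -> : T w - w = (T w - T (s n)) + (s n.+1 - w) by rewrite /s iterS; ring.
  apply: le_trans (cabsD _ _) _.
  have := T_contr we (s_bnd n); rewrite (cabsC w); have := cabs_ge0 (s n - w); lra.
exists w; split => //.
have := T_contr we (_ : cabs 0 <= e); rewrite Tw subr0 cabs0 => /(_ (ltW e_gt0)).
have := cabsD (w - T 0) (T 0); rewrite subrK; have := cabs_ge0 w; lra.
Qed.

End Contraction.

Section PerturbedEigenvalue.
Variables (R : realType) (N : nat) (L K : R) (F : 'I_N -> 'I_N -> R).
Variables (v : 'I_N -> R) (lam : R).
Hypotheses (N_gt0 : (0 < N)%N) (L_ge1 : 1 <= L).
Hypothesis F_sym : forall j k, F j k = F k j.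
Hypothesis F_bnd : forall j k, L^-1 / N%:R <= F j k <= L / N%:R.
Hypothesis v_gt0 : forall j, 0 < v j.
Hypothesis v_eig : forall j, \sum_k F j k * v k = lam * v j.
Hypothesis v_norm : mean (fun j => v j ^+ 2) = 1.
Hypothesis lam_bnd : 2^-1 <= lam <= 1.
Hypothesis K_E : K = 84 * L ^+ 5.
Variables (U : 'I_N -> R[i]) (d e : R).
Hypothesis e_gt0 : 0 < e.
Hypothesis e_small : 96 * K ^+ 2 * L ^+ 2 * e <= 1.
Hypothesis d_small : 16 * L ^+ 2 * K * d <= e.
Hypothesis U_bnd : forall j, cabs (U j - 1) <= d.
Hypothesis lam_d : 1 - lam <= d.

Let L_gt0 : 0 < L. Proof. exact: lt_le_trans L_ge1. Qed.
Let K_ge1 : 1 <= K.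
Proof. have := exprn_ege1 5 L_ge1; rewrite K_E; lra. Qed.
Let K_gt0 : 0 < K. Proof. exact: lt_le_trans K_ge1. Qed.
Let d_ge0 : 0 <= d.
Proof. by apply: le_trans (U_bnd (Ordinal N_gt0)); exact: cabs_ge0. Qed.

Let Ld_le : L * d <= e / 16.
Proof.
have h : L * d <= L ^+ 2 * K * d.
  rewrite ler_wpM2r //; have a1 : 1 <= L * K by rewrite mulr_ege1.
  have := ler_wpM2l (ltW L_gt0) a1; lra.
have := d_small; lra.
Qed.

Let e_le1 : 96 * K * e <= 1.
Proof.
apply: le_trans e_small; rewrite ler_wpM2r ?(ltW e_gt0) //.
have a1 : 1 <= K * L ^+ 2 by rewrite mulr_ege1 // exprn_ege1.
have := ler_wpM2l (ltW K_gt0) a1; lra.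
Qed.

Let small : (d * L + e) * (84 * L ^+ 5) <= 1.
Proof.
rewrite -K_E mulrDl; have := e_le1; have := ler_wpM2r (ltW K_gt0) Ld_le; lra.
Qed.

Local Notation M := (MU F U).
Local Notation J := (Jop v).

Let inverse w u X : cabs w <= e -> (forall j, cabs (M u j - w * u j + J u j) <= X) ->
  forall j, cabs (u j) <= K * X.
Proof.
move=> we; rewrite K_E.
exact: (shifted_inverse N_gt0 L_ge1 F_sym F_bnd v_gt0 v_eig v_norm lam_bnd U_bnd we small).
Qed.

(** The estimate [inverse] gives injectivity, which in finite dimension is surjectivity. *)
Let solve w h : cabs w <= e -> exists u, forall j, M u j - w * u j + J u j = h j.
Proof.
move=> we.
pose A : 'M[R[i]]_N := \matrix_(j, k) ((j == k)%:R * (1 - w) - U j * (F j k)%:C +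
   (v j)%:C * (N%:R^-1 * (v k)%:C)).
have AE (x : 'cV[R[i]]_N) j : (A *m x) j 0 =
    M (fun k => x k 0) j - w * x j 0 + J (fun k => x k 0) j.
  rewrite mxE; under eq_bigr do rewrite mxE mulrDl mulrBl.
  rewrite big_split sumrB /=; congr (_ + _).
    rewrite (bigD1 j) //= eqxx mul1r big1 ?addr0; last first.
      by move=> k /negPf kj; rewrite eq_sym kj !mul0r.
    rewrite /MU /Fapp mulr_sumr; under eq_bigr do rewrite -mulrA; ring.
  rewrite /Jop /mean mulrA mulr_sumr; apply: eq_bigr => k _; ring.
have Au : A \in unitmx.
  apply: injective_unitmx => x Ax; apply/colP => j; rewrite mxE.
  apply/eqP; rewrite -cabs_eq0; apply/eqP/le_anti; rewrite cabs_ge0 andbT.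
  rewrite -(mulr0 K); apply: (inverse (u := fun k => x k 0) we) => k.
  by rewrite -AE Ax mxE cabs0.
exists (fun k => (invmx A *m (\col_k h k)) k 0) => j.
by rewrite -AE mulmxA mulmxV // mul1mx mxE.
Qed.

Let cv j : R[i] := (v j)%:C.
Let cv_le j : cabs (cv j) <= 2 * L.
Proof. by rewrite cabs_real gtr0_norm //; exact: perron_le v_gt0 v_eig v_norm lam_bnd j. Qed.

Let mean_cv_le u X : (forall j, cabs (u j) <= X) ->
  cabs (mean (fun k => cv k * u k)) <= 2 * L * X.
Proof. exact: cabs_mean_v. Qed.

Let mean_vv : mean (fun k => cv k * cv k) = 1.
Proof.
rewrite (eq_mean (y := fun k => (v k ^+ 2)%:C)) ?mean_complex ?v_norm //.
by move=> k; rewrite /cv -rmorphM expr2.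
Qed.

Let Jcv j : J cv j = cv j.
Proof. by rewrite /Jop mean_vv mulr1. Qed.

Let Mcv_le j : cabs (M cv j) <= 4 * L * d.
Proof.
have -> : M cv j = (1 - lam)%:C * cv j - (U j - 1) * (lam%:C * cv j).
  rewrite /MU (_ : Fapp F cv j = lam%:C * cv j); first by rewrite rmorphB /=; ring.
  rewrite /Fapp -rmorphM -v_eig rmorph_sum; apply: eq_bigr => k _.
  by rewrite rmorphM.
case/andP: lam_bnd => l1 l2.
have q1 : cabs ((1 - lam)%:C * cv j) <= d * (2 * L).
  rewrite cabsM cabs_real ger0_norm ?subr_ge0 //.
  by apply: ler_pM; rewrite ?cabs_ge0 ?subr_ge0.
have q2 : cabs ((U j - 1) * (lam%:C * cv j)) <= d * (2 * L).
  rewrite cabsM; apply: ler_pM; rewrite ?cabs_ge0 // cabsM cabs_real ger0_norm; last by lra.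
  by rewrite -[leRHS]mul1r ler_pM ?cabs_ge0 //; lra.
apply: le_trans (cabsB _ _) _; lra.
Qed.

Let Mlin a b u u' j : M (fun k => a * u k + b * u' k) j = a * M u j + b * M u' j.
Proof.
rewrite /MU (_ : Fapp F _ j = a * Fapp F u j + b * Fapp F u' j); first by ring.
rewrite /Fapp !mulr_sumr -big_split; apply: eq_bigr => k _ /=; ring.
Qed.

Let Jlin a b u u' j : J (fun k => a * u k + b * u' k) j = a * J u j + b * J u' j.
Proof.
rewrite /Jop (_ : mean _ = a * mean (fun k => (v k)%:C * u k) + b * mean (fun k => (v k)%:C * u' k)).
  by ring.
by rewrite -!meanZ -meanD; apply: eq_mean => k; ring.
Qed.

(* [u] solves [(M + J - w) u = v]. *)
Let res w u := forall j, M u j - w * u j + J u j = cv j.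

Let res_close w u : cabs w <= e -> res w u ->
  forall j, cabs (u j - cv j) <= K * (4 * L * d + 2 * L * cabs w).
Proof.
move=> we hu j.
have -> : u j - cv j = 1 * u j + (-1) * cv j by ring.
apply: (inverse (u := fun k => 1 * u k + (-1) * cv k) we) => k.
rewrite Mlin Jlin Jcv.
have -> : 1 * M u k + -1 * M cv k - w * (1 * u k + -1 * cv k) + (1 * J u k + -1 * cv k) =
   (M u k - w * u k + J u k) - cv k - (M cv k - w * cv k) by ring.
rewrite hu subrr sub0r cabsN; apply: le_trans (cabsB _ _) _; rewrite lerD //.
by rewrite cabsM mulrC ler_wpM2r ?cabs_ge0.
Qed.

(** To first order [u] is [v + w v], so [<v, u>] has slope close to 1 in [w]. Applied to
    [u - u' - (w - w') v], the shifted operator leaves [w - w'] times quantities of order [e]. The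
    constant 96 in [e_small] is four times the [24 K ^ 2 L ^ 2 e] obtained here. *)
Let k_lip w w' u u' : cabs w <= e -> cabs w' <= e -> res w u -> res w' u' ->
  cabs (mean (fun k => cv k * u k) - mean (fun k => cv k * u' k) - (w - w')) <=
  4^-1 * cabs (w - w').
Proof.
move=> we we' hu hu'.
set D := cabs (w - w'); have D0 : 0 <= D by exact: cabs_ge0.
have H : forall j, cabs ((1 * u j + (-1) * u' j) + - (w - w') * cv j) <=
    K * (12 * K * L * e * D).
  move=> j.
  have -> : (1 * u j + (-1) * u' j) + - (w - w') * cv j =
     1 * (1 * u j + (-1) * u' j) + - (w - w') * cv j by ring.
  apply: (inverse (u := fun k => 1 * (1 * u k + (-1) * u' k) + - (w - w') * cv k) we) => k.
  rewrite Mlin Jlin Jcv Mlin Jlin.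
  have -> : 1 * (1 * M u k + -1 * M u' k) + - (w - w') * M cv k -
     w * (1 * (1 * u k + -1 * u' k) + - (w - w') * cv k) +
     (1 * (1 * J u k + -1 * J u' k) + - (w - w') * cv k) =
     (M u k - w * u k + J u k) - (M u' k - w' * u' k + J u' k) +
     (w - w') * ((u' k - cv k) - (M cv k - w * cv k)) by ring.
  rewrite hu hu' subrr add0r cabsM mulrC ler_wpM2r //.
  have q1 := res_close we' hu' k.
  have q2 : cabs (w * cv k) <= 2 * L * e.
    by rewrite cabsM mulrC; apply: ler_pM; rewrite ?cabs_ge0.
  have q3 : cabs (M cv k - w * cv k) <= 4 * L * d + 2 * L * e.
    by apply: le_trans (cabsB _ _) _; rewrite lerD.
  have q4 : L * cabs w' <= L * e by rewrite ler_wpM2l // ltW.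
  have Le : 4 * L * d + 2 * L * e <= 6 * L * e.
    have : e <= L * e by rewrite ler_peMl // ltW.
    have := e_gt0; have := Ld_le; lra.
  have q5 : K * (4 * L * d + 2 * L * cabs w') <= K * (6 * L * e).
    by rewrite ler_wpM2l ?(ltW K_gt0) //; lra.
  have q6 : 6 * L * e <= K * (6 * L * e).
    by rewrite ler_peMl // !mulr_ge0 // ltW.
  apply: le_trans (cabsB _ _) _; lra.
have -> : mean (fun k => cv k * u k) - mean (fun k => cv k * u' k) - (w - w') =
  mean (fun k => cv k * ((1 * u k + (-1) * u' k) + - (w - w') * cv k)).
  transitivity (mean (fun k => cv k * u k) - mean (fun k => cv k * u' k) -
      (w - w') * mean (fun k => cv k * cv k)); first by rewrite mean_vv mulr1.
  by rewrite -meanZ -!meanB; apply: eq_mean => k; ring.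
apply: le_trans (mean_cv_le H) _.
have -> : 2 * L * (K * (12 * K * L * e * D)) = 4^-1 * (96 * K ^+ 2 * L ^+ 2 * e) * D by field.
by rewrite ler_wpM2r //; have := e_small; lra.
Qed.

(** Lyapunov-Schmidt reduction. If [(M + J - w) u = v] then [(M - w) u = (1 - <v, u>) v], so [w] is
    an eigenvalue in the disc exactly when [k(w) = <v, u>] equals 1, that is when [w] is fixed by
    [w + 1 - k(w)]. By [k_lip] this map is a contraction, which gives existence and uniqueness
    together. *)
Lemma perturbed_eigenvalue : exists (beta : R[i]) (r : 'I_N -> R[i]),
  [/\ cabs beta <= 16 * L ^+ 2 * K * d,
      forall j, cabs (r j - (v j)%:C) <= 36 * L ^+ 3 * K ^+ 2 * d,
      mean (fun k => (v k)%:C * r k) = 1,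
      forall j, MU F U r j = beta * r j &
      forall w u, cabs w <= e -> (forall j, MU F U u j = w * u j) ->
        (exists j, u j != 0) ->
        w = beta /\ forall j, u j = mean (fun k => (v k)%:C * u k) * r j].
Proof.
(* Outside the disc the chosen function is the default 0. *)
have /choice[rs hrs] : forall w, exists u, cabs w <= e -> res w u.
  move=> w; have [we|nwe] := pselect (cabs w <= e); last by exists (fun _ => 0) => /nwe.
  by have [u hu] := solve cv we; exists u.
pose kk w := mean (fun k => cv k * rs w k).
pose T w := w + 1 - kk w.
have e0 : cabs (0 : R[i]) <= e by rewrite cabs0 ltW.
have T0 : cabs (T 0) <= 8 * L ^+ 2 * K * d.
  rewrite /T add0r -mean_vv /kk -meanB.
  rewrite (eq_mean (y := fun k => cv k * (cv k - rs 0 k))); last by move=> k; ring.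
  have H k : cabs (cv k - rs 0 k) <= K * (4 * L * d).
    rewrite cabsC; have := res_close e0 (hrs _ e0) k.
    by rewrite cabs0 mulr0 addr0.
  by apply: le_trans (mean_cv_le H) _; rewrite le_eqVlt; apply/orP; left; apply/eqP; ring.
have Tc w w' : cabs w <= e -> cabs w' <= e -> cabs (T w - T w') <= 4^-1 * cabs (w - w').
  move=> we we'; rewrite /T.
  have -> : w + 1 - kk w - (w' + 1 - kk w') = - (kk w - kk w' - (w - w')) by ring.
  by rewrite cabsN; apply: k_lip => //; exact: hrs.
have T0e : cabs (T 0) <= e / 2 by apply: le_trans T0 _; have := d_small; lra.
have [beta [be b2 Tb]] := disc_contraction e_gt0 T0e Tc.
have kb : kk beta = 1.
  by apply/eqP; rewrite eq_sym -subr_eq0; apply/eqP; move: Tb; rewrite /T => Tb; rewrite -[RHS](subrr beta) -{2}Tb; ring.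
have bd : cabs beta <= 16 * L ^+ 2 * K * d by apply: le_trans b2 _; lra.
have rb := hrs _ be.
exists beta, (rs beta); split => //.
- move=> j; apply: le_trans (res_close be rb j) _.
  have q1 : 2 * L * cabs beta <= 2 * L * (16 * L ^+ 2 * K * d).
    by rewrite ler_wpM2l // mulr_ge0 // ltW.
  have q2 : 4 * L * d <= 4 * (L ^+ 3 * K * d).
    have p : L <= L ^+ 3 * K.
      have a1 : 1 <= L ^+ 2 * K by rewrite mulr_ege1 // exprn_ege1.
      have := ler_wpM2l (ltW L_gt0) a1; lra.
    by have := ler_wpM2r d_ge0 p; lra.
  have : K * (4 * L * d + 2 * L * cabs beta) <= K * (36 * (L ^+ 3 * K * d)).
    rewrite ler_wpM2l ?(ltW K_gt0) //; lra.
  by move=> H; apply: le_trans H _; rewrite le_eqVlt; apply/orP; left; apply/eqP; ring.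
- move=> j; have := rb j; rewrite /Jop -/(kk beta) -/(cv j) => H.
  have : cv j * kk beta = cv j by rewrite kb mulr1.
  rewrite /kk => E; rewrite E in H.
  by apply/eqP; rewrite -subr_eq0; apply/eqP; rewrite -[RHS](subrr (cv j)) -{1}H; ring.
- move=> w u we hu [j0 uj0].
  (* An eigenfunction satisfies [(M + J - w) u = c v], hence is [c] times the chosen solution. As it
     is not zero, [c] is nonzero, so [k(w) = 1] and [w] is the fixed point. *)
  pose c := mean (fun k => cv k * u k).
  have uc j : u j = c * rs w j.
    apply/eqP; rewrite -subr_eq0 -cabs_eq0; apply/eqP/le_anti; rewrite cabs_ge0 andbT.
    have -> : u j - c * rs w j = 1 * u j + - c * rs w j by ring.
    rewrite -(mulr0 K); apply: (inverse (u := fun k => 1 * u k + - c * rs w k) we) => k.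
    rewrite Mlin Jlin.
    have -> : 1 * M u k + - c * M (rs w) k - w * (1 * u k + - c * rs w k) + (1 * J u k + - c * J (rs w) k) =
      (M u k - w * u k) + J u k - c * (M (rs w) k - w * rs w k + J (rs w) k) by ring.
    rewrite (hrs _ we) hu subrr add0r /Jop -/c.
    by rewrite (_ : _ - _ = 0) ?cabs0 //; rewrite /c /cv; ring.
  have c0 : c != 0.
    by apply: contra uj0 => /eqP c0; rewrite uc c0 mul0r.
  have kw : kk w = 1.
    apply: (mulfI c0); rewrite mulr1 {2}/c /kk -meanZ.
    by apply: eq_mean => k; rewrite uc; ring.
  have wb : w = beta.
    apply/eqP; rewrite -subr_eq0 -cabs_eq0; apply/eqP.
    have := Tc w beta we be; rewrite Tb /T kw addrK.
    have := cabs_ge0 (w - beta); lra.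
  by split => // j; rewrite uc wb.
Qed.

End PerturbedEigenvalue.

(** * Simple eigenvalues and spectral projections *)

(** Two block factorizations of one bordered matrix. The factor [y] on the left avoids inverting
    [y], which will be a polynomial, and an exponent [n - 1]. *)
Lemma det_scalar_sub_rank1 (K : comNzRingType) (n : nat) (y : K)
    (r : 'cV[K]_n) (l : 'rV[K]_n) :
  y * \det (y%:M - r *m l) = y ^+ n * (y - (l *m r) 0 0).
Proof.
pose M := block_mx (y%:M : 'M[K]_n) r l (1%:M : 'M[K]_1).
have e1 : \det M = \det (y%:M - r *m l).
  have E : block_mx (y%:M - r *m l) r 0 1%:M *m block_mx 1%:M 0 l 1%:M = M.
    by rewrite mulmx_block !mulmx1 !mul1mx !mulmx0 ?mul0mx !add0r subrK.
  by rewrite -E det_mulmx det_ublock det_lblock !det1 !mulr1.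
have e2 : y * \det M = y ^+ n * (y - (l *m r) 0 0).
  have E : block_mx 1%:M 0 (- l) y%:M *m M = block_mx y%:M r 0 (y%:M - l *m r).
    rewrite mulmx_block !mul1mx !mulmx1 ?mul0mx !addr0 mulNmx mulNmx.
    by rewrite mul_mx_scalar mul_scalar_mx addNr addrC.
  have := congr1 determinant E.
  by rewrite det_mulmx det_lblock det_ublock det1 mul1r !det_scalar det_mx11 !mxE eqxx mulr1n.
by rewrite -e1.
Qed.

(** Adding [r *m l] moves one copy of the eigenvalue [b] to [b + 1]. A double root at [b] would
    survive the move and give a left eigenvector [w] of the new matrix; pairing with [r] shows
    [w *m r = 0], so [w] is an eigenvector of [A], hence a multiple of [l], against [l *m r = 1]. *)
Lemma simple_eigenvalue_mup (K : fieldType) (n : nat) (A : 'M[K]_n) (b : K)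
    (r : 'cV[K]_n) (l : 'rV[K]_n) :
  A *m r = b *: r -> l *m A = b *: l -> (l *m r) 0 0 = 1 ->
  (forall u : 'rV[K]_n, u *m A = b *: u -> exists c, u = c *: l) ->
  mup b (char_poly A) = 1%N.
Proof.
move=> Ar lA lr uniq.
pose A' := A + r *m l.
pose q : {poly K} := 'X - b%:P.
have qX : q != 0 by rewrite polyXsubC_eq0.
have rel : char_poly A * (q - 1) = q * char_poly A'.
  pose r' := map_mx polyC r; pose l' := map_mx polyC l.
  have l'r' : (l' *m r') 0 0 = 1 by rewrite -map_mxM mxE lr.
  have E : char_poly_mx A *m (q%:M - r' *m l') = q%:M *m char_poly_mx A'.
    have Xr : char_poly_mx A *m r' = q *: r'.
      rewrite /char_poly_mx mulmxBl mul_scalar_mx -map_mxM Ar map_mxZ.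
      by rewrite -scalerBl.
    rewrite mulmxBr mul_mx_scalar mulmxA Xr mul_scalar_mx -scalemxAl -scalerBr.
    by rewrite /char_poly_mx /A' map_mxD map_mxM opprD addrA.
  have := congr1 determinant E; rewrite !det_mulmx det_scalar.
  rewrite -/(char_poly A) -/(char_poly A') => D.
  have := det_scalar_sub_rank1 q r' l'; rewrite l'r' => D2.
  apply: (mulfI (expf_neq0 n qX)).
  by rewrite mulrCA -D2 mulrCA D mulrCA.
have r0 : r != 0.
  by apply/eqP => r0; move: lr; rewrite r0 mulmx0 mxE => /eqP; rewrite eq_sym oner_eq0.
have A0 : char_poly A != 0 by exact/monic_neq0/char_poly_monic.
have l0 : l != 0.
  by apply/eqP => l0; move: lr; rewrite l0 mul0mx mxE => /eqP; rewrite eq_sym oner_eq0.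
have rootA : root (char_poly A) b.
  by rewrite -eigenvalue_root_char; apply/eigenvalueP; exists l.
apply/eqP; rewrite eqn_leq mup_leq // mup_geq // expr1 dvdp_XsubCl rootA andbT.
apply/negP => /dvdpP[p pE].
have : root (char_poly A') b.
  have : q * (p * q * (q - 1)) = q * char_poly A'.
    by rewrite -rel pE -/q expr2; ring.
  move=> /(mulfI qX) <-; rewrite !rootM (root_XsubC b b) eqxx orbT //.
rewrite -eigenvalue_root_char => /eigenvalueP[w wA' w0].
have wr : w *m r = 0.
  have h1 : w *m A' *m r = b *: (w *m r) by rewrite wA' scalemxAl.
  have h2 : w *m A' *m r = b *: (w *m r) + w *m r.
    rewrite /A' mulmxDr mulmxDl -(mulmxA w A) Ar -scalemxAr; congr (_ + _).
    by rewrite mulmxA -mulmxA [l *m r]mx11_scalar lr mulmx1.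
  by apply: (addrI (b *: (w *m r))); rewrite -h2 h1 addr0.
have wA : w *m A = b *: w.
  by rewrite -wA' /A' mulmxDr mulmxA wr mul0mx addr0.
have [c wc] := uniq w wA.
move: wr; rewrite wc -scalemxAl => /matrixP/(_ 0 0); rewrite !mxE.
have -> : \sum_j l 0 j * r j 0 = 1 by rewrite -lr mxE.
by rewrite mulr1 => c0; move: w0; rewrite wc c0 scale0r eqxx.
Qed.

(** * Contour integral of a Laurent series on a circle *)

Section TrigonometricIntegrals.
Variable R : realType.
Local Notation mu := (@lebesgue_measure R).
Local Notation D := (`[(0 : R), 2 * pi]%classic).

Lemma trig_is_derive (x al ga t : R) : x != 0 ->
  is_derive t 1 (fun t => x^-1 * (al * sin (x * t) - ga * cos (x * t)))
    (al * cos (x * t) + ga * sin (x * t)).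
Proof.
move=> x0.
have dx : is_derive t 1 ( *%R x) x.
  by apply: is_derive_eq; rewrite -[RHS]mulr1.
have ds : is_derive t 1 (sin \o *%R x) (cos (x * t) * x).
  exact: is_derive1_comp.
have dc : is_derive t 1 (cos \o *%R x) (- sin (x * t) * x).
  exact: is_derive1_comp.
have d1 : is_derive t 1 (x^-1 *: (al *: (sin \o *%R x) - ga *: (cos \o *%R x)))
   (x^-1 *: (al *: (cos (x * t) * x) - ga *: (- sin (x * t) * x))).
  exact: is_deriveZ.
apply: is_derive_eq.
by rewrite /GRing.scale /=; field.
Qed.

Let pi2_gt0 : 0 < 2 * pi :> R. Proof. by rewrite mulr_gt0 ?pi_gt0. Qed.

Lemma derive_continuous (f df : R -> R) : (forall t : R, is_derive t (1 : R) f (df t)) ->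
  continuous f.
Proof.
move=> h t; apply: differentiable_continuous; apply/derivable1_diffP.
by case: (h t).
Qed.

Lemma continuous_integrable_D (f : R -> R) : continuous f ->
  mu.-integrable D (EFin \o f).
Proof.
move=> cf; apply: continuous_compact_integrable; first exact: segment_compact.
by apply: continuous_subspaceT.
Qed.

Lemma cos_sin_continuous (x al ga : R) :
  continuous (fun t => al * cos (x * t) + ga * sin (x * t)).
Proof.
have [->|x0] := eqVneq x 0.
  rewrite (_ : (fun _ => _) = cst (al * cos 0 + ga * sin 0)); first exact: cst_continuous.
  by apply/funext => t; rewrite mul0r.
have -> : (fun t => al * cos (x * t) + ga * sin (x * t)) =
   (fun t => x^-1 * ((x * ga) * sin (x * t) - (- (x * al)) * cos (x * t))).
  by apply/funext => s; field.
apply: derive_continuous => t; exact: trig_is_derive.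
Qed.

Lemma cos_sin_integral (x al ga : R) : x != 0 ->
  cos (x * (2 * pi)) = 1 -> sin (x * (2 * pi)) = 0 ->
  (\int[mu]_(t in D) (al * cos (x * t) + ga * sin (x * t)))%R = 0.
Proof.
move=> x0 c1 s0.
pose F t := x^-1 * (al * sin (x * t) - ga * cos (x * t)).
have dF (t : R) : is_derive t (1 : R) F (al * cos (x * t) + ga * sin (x * t)).
  exact: trig_is_derive.
have cF : continuous F by exact: derive_continuous dF.
rewrite /Rintegral (@continuous_FTC2 _ _ F) //.
- by rewrite /F c1 s0 [x * 0]mulr0 cos0 sin0 -EFinB /= subrr.
- by apply: continuous_subspaceT; exact: cos_sin_continuous.
- split; first by move=> t _; case: (dF t).
    by apply: cvg_at_right_filter; exact: cF.
  by apply: cvg_at_left_filter; exact: cF.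
- by move=> t _; rewrite derive1E; apply: derive_val.
Qed.

Lemma Rintegral_D_cst (a : R) : (\int[mu]_(t in D) a)%R = 2 * pi * a.
Proof.
rewrite Rintegral_cst //= lebesgue_measure_itv /= lte_fin pi2_gt0 /= subr0.
by rewrite mulrC.
Qed.

(** Bounded convergence. The constant value [I] fits the application, where all partial sums of a
    Laurent series have the same integral. *)
Lemma Rintegral_bounded_limit (fn : nat -> R -> R) (f : R -> R) (M I : R) :
  (forall n, mu.-integrable D (EFin \o fn n)) ->
  (forall t, D t -> fn n t @[n --> \oo] --> f t) ->
  (forall n t, D t -> `|fn n t| <= M) ->
  (forall n, (\int[mu]_(t in D) fn n t)%R = I) ->
  (\int[mu]_(t in D) f t)%R = I.
Proof.
move=> ifn cv bd In.
have mD : measurable D by exact: measurable_itv.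
have cvE t : D t -> (EFin \o fn n) t @[n --> \oo] --> (EFin \o f) t.
  by move=> Dt; apply: cvg_EFin; [exact: nearW | exact: cv].
have [] := @dominated_convergence _ _ R mu D mD (fun n => EFin \o fn n) (EFin \o f) (EFin \o cst M).
- by move=> n; exact: measurable_int (ifn n).
- apply: measurable_realfun.emeasurable_fun_cvg cvE => n.
  exact: measurable_int (ifn n).
- by apply: aeW => t; exact: cvE.
- by apply: continuous_integrable_D; exact: cst_continuous.
- by apply: aeW => t n Dt; rewrite /= lee_fin; exact: bd.
move=> _ _ H.
have E0 : (fun n => (\int[mu]_(x in D) (EFin \o fn n) x)%E) = cst I%:E.
  apply/funext => n /=; rewrite -(In n) /Rintegral fineK //.
  by apply: (@integrable_fin_num _ _ R mu _ _ _ (ifn n)); exact: measurable_itv.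
rewrite /= in E0 H; rewrite E0 in H.
have E := cvg_lim (@ereal_hausdorff R) H; rewrite lim_cst // in E.
by rewrite /Rintegral -E.
Qed.

End TrigonometricIntegrals.

Section CircleIntegral.
Variable R : realType.
Local Notation mu := (@lebesgue_measure R).
Local Notation D := (`[(0 : R), 2 * pi]%classic).

Lemma circleM (a b s t : R) : circle a s * circle b t = circle (a * b) (s + t).
Proof.
apply/eqP; rewrite eq_complex /= cosD sinD; apply/andP; split; apply/eqP; ring.
Qed.

Lemma circleX (a t : R) k : circle a t ^+ k = circle (a ^+ k) (k%:R * t).
Proof.
elim: k => [|k IH]; first by rewrite !expr0 /circle mul0r cos0 sin0 mulr0 mulr1.
by rewrite exprS IH circleM -exprS -natr1 mulrDl mul1r addrC.
Qed.

Lemma cabs_circle (a t : R) : 0 <= a -> cabs (circle a t) = a.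
Proof.
move=> a0; rewrite /cabs /circle /= !exprMn -mulrDr cos2Dsin2 mulr1 sqrtr_sqr.
by rewrite ger0_norm.
Qed.

Lemma circleV (a t : R) : 0 < a -> (circle a t)^-1 = circle a^-1 (- t).
Proof.
move=> a0; have c0 : circle a t != 0 by rewrite -cabs_gt0 cabs_circle // ltW.
apply: (mulfI c0); rewrite mulfV // circleM mulfV ?gt_eqF // subrr.
by rewrite /circle cos0 sin0 mulr0 mulr1.
Qed.

(** Continuity is carried along so that integrability of sums comes for free. *)
Let has_int (h : R -> R) (I : R) :=
  continuous h /\ (\int[mu]_(t in D) h t)%R = I.

Let has_intD h h' I I' : has_int h I -> has_int h' I' ->
  has_int (fun t => h t + h' t) (I + I').
Proof.
move=> [c1 i1] [c2 i2]; split.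
  by move=> t; apply: continuousD; [exact: c1|exact: c2].
rewrite (@RintegralD _ _ R mu) ?i1 ?i2 //.
- exact: continuous_integrable_D.
- exact: continuous_integrable_D.
Qed.

Let period (n : int) : cos (n%:~R * (2 * pi)) = 1 :> R /\ sin (n%:~R * (2 * pi)) = 0 :> R.
Proof.
have nat_case (k : nat) : cos (k%:R * (2 * pi)) = 1 :> R /\ sin (k%:R * (2 * pi)) = 0 :> R.
  have -> : k%:R * (2 * pi) = 0 + (pi *+ 2) *+ k :> R.
    by rewrite add0r -[RHS]mulr_natl -[pi *+ 2]mulr_natl.
  by rewrite (periodicn (@cosD2pi R)) (periodicn (@sinD2pi R)) cos0 sin0.
case: n => k; first exact: nat_case.
have [h1 h2] := nat_case k.+1.
by rewrite NegzE mulrNz mulNr cosN sinN h1 h2 oppr0.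
Qed.

Let ReIm_int (n : int) (d : R[i]) (a : R) : n != 0 ->
  has_int (fun t => complex.Re (d * circle a (n%:~R * t))) 0 /\
  has_int (fun t => complex.Im (d * circle a (n%:~R * t))) 0.
Proof.
move=> n0; have [c1 s0] := period n.
have x0 : n%:~R != 0 :> R by rewrite intr_eq0.
split; split.
- rewrite (_ : (fun t => _) = (fun t => complex.Re d * a * cos (n%:~R * t) + - (complex.Im d * a) * sin (n%:~R * t))).
    exact: cos_sin_continuous.
  by apply/funext => t; rewrite cReM /circle /=; ring.
- under eq_Rintegral => t _.
    rewrite (_ : complex.Re _ = complex.Re d * a * cos (n%:~R * t) + - (complex.Im d * a) * sin (n%:~R * t)); last first.
      by rewrite cReM /circle /=; ring.
    over.
  exact: cos_sin_integral.
- rewrite (_ : (fun t => _) = (fun t => complex.Im d * a * cos (n%:~R * t) + (complex.Re d * a) * sin (n%:~R * t))).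
    exact: cos_sin_continuous.
  by apply/funext => t; rewrite cImM /circle /=; ring.
- under eq_Rintegral => t _.
    rewrite (_ : complex.Im _ = complex.Im d * a * cos (n%:~R * t) + (complex.Re d * a) * sin (n%:~R * t)); last first.
      by rewrite cImM /circle /=; ring.
    over.
  exact: cos_sin_integral.
Qed.

Variables (e : R) (g : R[i] -> R[i]) (c c' : nat -> R[i]) (M q : R).
Hypothesis e_gt0 : 0 < e.
Hypotheses (q_ge0 : 0 <= q) (q_lt1 : q < 1) (M_ge0 : 0 <= M).
Hypothesis c_bnd : forall k, cabs (c k) * e ^+ k <= M * q ^+ k.
Hypothesis c'_bnd : forall k, cabs (c' k) * e^-1 ^+ k <= M * q ^+ k.

Let lterm k (w : R[i]) := c k * w ^+ k + c' k * w^-1 ^+ k.+1.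
Let psum n w := \sum_(k < n) lterm k w.

Hypothesis laurent : forall t, exists Ct : R, forall n,
  cabs (g (circle e t) - psum n (circle e t)) <= Ct * q ^+ n.

Let hn n t := psum n (circle e t) * ('i%C * circle e t).

Let w_neq0 t : circle e t != 0.
Proof. by rewrite -cabs_gt0 cabs_circle // ltW. Qed.

(** After multiplication by the derivative of the parametrization, the [k]-th terms have frequencies
    [k + 1] and [- k]; the only constant one carries [c' 0]. *)
Let ltermE k t : lterm k (circle e t) * ('i%C * circle e t) =
  'i%C * c k * circle (e ^+ k.+1) ((k.+1%:Z)%:~R * t) +
  'i%C * c' k * circle (e^-1 ^+ k) ((- k%:Z)%:~R * t).
Proof.
rewrite /lterm mulrDl; congr (_ + _).
  by rewrite -[circle (e ^+ k.+1) _](circleX e t k.+1) exprS; ring.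
have -> : circle (e^-1 ^+ k) ((- k%:Z)%:~R * t) = (circle e t)^-1 ^+ k.
  by rewrite circleV // circleX mulrNz mulNr mulrN.
by rewrite exprS; field; exact: w_neq0.
Qed.

(** Stated from [n.+1] on because the empty partial sum misses the residue. *)
Let hn_int n : has_int (fun t => complex.Re (hn n.+1 t)) (complex.Re (2 * pi%:C * 'i%C * c' 0%N)) /\
   has_int (fun t => complex.Im (hn n.+1 t)) (complex.Im (2 * pi%:C * 'i%C * c' 0%N)).
Proof.
have hS m : hn m.+1 = fun t => hn m t + ('i%C * c m * circle (e ^+ m.+1) ((m.+1%:Z)%:~R * t) +
    'i%C * c' m * circle (e^-1 ^+ m) ((- m%:Z)%:~R * t)).
  by apply/funext => t; rewrite /hn /psum big_ord_recr /= mulrDl ltermE.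
elim: n => [|n [IH1 IH2]].
  have h1 : hn 1 = fun t => 'i%C * c 0%N * circle (e ^+ 1) ((1%:Z)%:~R * t) + 'i%C * c' 0%N.
    rewrite hS; apply/funext => t; rewrite /hn /psum big_ord0 mul0r add0r expr0.
    by rewrite {2}/circle oppr0 mul0r cos0 sin0 mulr0 !mulr1.
  have [i1 i2] := @ReIm_int 1 ('i%C * c 0%N) (e ^+ 1) isT.
  rewrite h1; split.
    rewrite (_ : (fun t => _) = (fun t => complex.Re ('i%C * c 0%N * circle (e ^+ 1) (1%:~R * t)) + complex.Re ('i%C * c' 0%N))); last first.
      by apply/funext => t; rewrite cReD.
    rewrite -[complex.Re (2 * _ * _ * _)]add0r; apply: has_intD => //; split.
      by move=> t; exact: cst_continuous.
    rewrite Rintegral_D_cst.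
    have -> : 2 * pi%:C * 'i%C * c' 0%N = (2 * pi)%:C * ('i%C * c' 0%N).
      by rewrite rmorphM /= rmorph_nat; ring.
    by rewrite cReMr.
  rewrite (_ : (fun t => _) = (fun t => complex.Im ('i%C * c 0%N * circle (e ^+ 1) (1%:~R * t)) + complex.Im ('i%C * c' 0%N))); last first.
    by apply/funext => t; rewrite cImD.
  rewrite -[complex.Im (2 * _ * _ * _)]add0r; apply: has_intD => //; split.
    by move=> t; exact: cst_continuous.
  rewrite Rintegral_D_cst.
  have -> : 2 * pi%:C * 'i%C * c' 0%N = (2 * pi)%:C * ('i%C * c' 0%N).
    by rewrite rmorphM /= rmorph_nat; ring.
  by rewrite cImMr.
have [i1 i2] := @ReIm_int n.+2 ('i%C * c n.+1) (e ^+ n.+2) isT.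
have [i3 i4] := @ReIm_int (- (n.+1)%:Z) ('i%C * c' n.+1) (e^-1 ^+ n.+1) isT.
rewrite hS; split.
  rewrite -[complex.Re (2 * _ * _ * _)]addr0 -[X in has_int _ (_ + X)](addr0 0).
  rewrite (_ : (fun t => _) = (fun t => complex.Re (hn n.+1 t) + (complex.Re ('i%C * c n.+1 * circle (e ^+ n.+2) ((n.+2)%:~R * t)) + complex.Re ('i%C * c' n.+1 * circle (e^-1 ^+ n.+1) ((- n.+1%:Z)%:~R * t))))); last first.
    by apply/funext => t; rewrite !cReD.
  by apply: has_intD => //; apply: has_intD.
rewrite -[complex.Im (2 * _ * _ * _)]addr0 -[X in has_int _ (_ + X)](addr0 0).
rewrite (_ : (fun t => _) = (fun t => complex.Im (hn n.+1 t) + (complex.Im ('i%C * c n.+1 * circle (e ^+ n.+2) ((n.+2)%:~R * t)) + complex.Im ('i%C * c' n.+1 * circle (e^-1 ^+ n.+1) ((- n.+1%:Z)%:~R * t))))); last first.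
  by apply/funext => t; rewrite !cImD.
by apply: has_intD => //; apply: has_intD.
Qed.

Let hn_bnd n t : cabs (hn n t) <= M * (1 + e) / (1 - q).
Proof.
have : cabs (hn n t) <= \sum_(k < n) M * (1 + e) * q ^+ k.
  rewrite /hn /psum mulr_suml; apply: le_trans (cabs_sum _ _) _; apply: ler_sum => k _.
  rewrite ltermE; apply: le_trans (cabsD _ _) _.
  rewrite !cabsM !cabs_i !mul1r !cabs_circle ?exprn_ge0 ?invr_ge0 ?(ltW e_gt0) //.
  have := c_bnd k; have := c'_bnd k; rewrite exprS => h1 h2.
  have := ler_wpM2r (ltW e_gt0) h2; lra.
move=> H; apply: le_trans H _; rewrite -mulr_sumr.
rewrite ler_wpM2l ?mulr_ge0 ?addr_ge0 ?(ltW e_gt0) //.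
have q1 : 0 < 1 - q by rewrite subr_gt0.
have E : (1 - q) * \sum_(i < n) q ^+ i = 1 - q ^+ n by rewrite -[RHS]opprB subrX1; ring.
rewrite -[leRHS]mul1r ler_pdivlMr // mulrC E.
by rewrite gerBl exprn_ge0.
Qed.

Let hn_cvg (f : R[i] -> R) t : (forall x y, f x - f y = f (x - y)) ->
  (forall x, `|f x| <= cabs x) ->
  f (hn n.+1 t) @[n --> \oo] --> f (g (circle e t) * ('i%C * circle e t)).
Proof.
move=> fB fle; have [Ct hCt] := laurent t.
have : (fun n => Ct * e * q ^+ n.+1) @ \oo --> (0 : R).
  rewrite (_ : (fun n => _) = (fun n => Ct * e * q * q ^+ n)); last first.
    by apply/funext => n; rewrite exprS mulrA.
  rewrite -[0](mulr0 (Ct * e * q)); apply: cvgM; first exact: cvg_cst.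
  by apply: cvg_expr; rewrite ger0_norm.
move/cvgrPdist_le => H; apply/cvgrPdist_le => ee ee0.
have := H ee ee0; apply: filterS => n /=.
rewrite sub0r normrN => Hn; apply: le_trans Hn.
rewrite fB; apply: le_trans (fle _) _; rewrite /hn -mulrBl cabsM.
apply: le_trans (ler_norm _).
rewrite cabsM cabs_i mul1r cabs_circle ?(ltW e_gt0) //.
have := ler_wpM2r (ltW e_gt0) (hCt n.+1); lra.
Qed.

(** Each nonempty partial sum contributes only the residue, and the geometric bounds on the
    coefficients give the majorant under which the limit passes through the integral. *)
Lemma circle_integral_laurent :
  (2 * pi%:C * 'i%C)^-1 * circle_integral e g = c' 0%N.
Proof.
have -> : circle_integral e g = 2 * pi%:C * 'i%C * c' 0%N.
  rewrite [RHS](_ : _ = complex.Re (2 * pi%:C * 'i%C * c' 0%N) +i* complex.Im (2 * pi%:C * 'i%C * c' 0%N)); last by case: (2 * _ * _ * _).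
  rewrite /circle_integral; congr (_ +i* _).
    apply: (@Rintegral_bounded_limit _ (fun n t => complex.Re (hn n.+1 t)) _ (M * (1 + e) / (1 - q))).
    - by move=> n; apply: continuous_integrable_D; case: (hn_int n) => -[].
    - by move=> t _; apply: hn_cvg => [x y|x]; [rewrite raddfB|exact: cabs_Re].
    - by move=> n t _; apply: le_trans (cabs_Re _) _.
    - by move=> n; case: (hn_int n) => -[].
  apply: (@Rintegral_bounded_limit _ (fun n t => complex.Im (hn n.+1 t)) _ (M * (1 + e) / (1 - q))).
  - by move=> n; apply: continuous_integrable_D; case: (hn_int n) => _ [].
  - by move=> t _; apply: hn_cvg => [x y|x]; [rewrite raddfB|exact: cabs_Im].
  - by move=> n t _; apply: le_trans (cabs_Im _) _.
  - by move=> n; case: (hn_int n) => _ [].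
rewrite mulKf //; rewrite !mulf_neq0 //.
- by rewrite eq_complex /= eqxx andbT gt_eqF ?pi_gt0.
- by rewrite eq_complex /= oner_eq0 andbF.
Qed.

End CircleIntegral.

(** * The spectral projection of a simple eigenvalue *)

Section RankOneProjection.
Variables (R : realType) (N : nat) (A : 'M[R[i]]_N) (e K : R) (b : R[i]).
Variables (r : 'cV[R[i]]_N) (l : 'rV[R[i]]_N).
Hypotheses (e_gt0 : 0 < e) (K_ge0 : 0 <= K) (Ke : K * e < 1).
Hypothesis b_lt : cabs b < e.
Hypotheses (Ar : A *m r = b *: r) (lA : l *m A = b *: l).
Hypothesis lr : l *m r = 1%:M.
Let P := r *m l.
Let A' := A + (1 - b) *: P.
Hypothesis A'_inv : forall (u : 'cV[R[i]]_N) X,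
  (forall j, cabs ((A' *m u) j 0) <= X) -> forall j, cabs (u j 0) <= K * X.
Hypothesis resolvent : forall w, cabs w = e -> w%:M - A \in unitmx.

Let PP : P *m P = P.
Proof. by rewrite /P mulmxA -(mulmxA r) lr mulmx1. Qed.

Let AP : A *m P = b *: P.
Proof. by rewrite /P mulmxA Ar scalemxAl. Qed.

Let PA : P *m A = b *: P.
Proof. by rewrite /P -mulmxA lA scalemxAr. Qed.

Let PA' : P *m A' = P.
Proof.
by rewrite /A' mulmxDr PA -scalemxAr PP -scalerDl addrC subrK scale1r.
Qed.

Let A'_unit : A' \in unitmx.
Proof.
apply: injective_unitmx => x A'x; apply/colP => j; rewrite mxE.
apply/eqP; rewrite -cabs_eq0; apply/eqP/le_anti; rewrite cabs_ge0 andbT.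
by rewrite -(mulr0 K); apply: A'_inv => k; rewrite A'x mxE cabs0.
Qed.

Let T := invmx A'.
Let Q : 'M[R[i]]_N := 1%:M - P.

(** On the complement of [P] the matrices [A] and [A'] agree, so the inverse of [A'] inverts [A]
    there. *)
Let QT : A *m (Q *m T) = Q.
Proof.
have AQ : A *m Q = Q *m A'.
  rewrite /Q mulmxBr mulmxBl mulmx1 mul1mx AP PA' /A'.
  by rewrite scalerBl scale1r -addrA addrAC subrr add0r.
by rewrite mulmxA AQ -mulmxA mulmxV // mulmx1.
Qed.

Let Tp n : 'M[R[i]]_N := iter n (mulmx T) 1%:M.

Let Tp_le n j k : cabs (Tp n j k) <= K ^+ n.
Proof.
elim: n j => [|n IH] j.
  rewrite mxE expr0; case: (j == k); rewrite ?cabs1 ?cabs0 //.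
have -> : Tp n.+1 j k = (T *m col k (Tp n)) j 0.
  by rewrite /Tp iterS -/(Tp n) !mxE; apply: eq_bigr => i _; rewrite mxE.
rewrite exprS; apply: A'_inv => i.
by rewrite mulmxA mulmxV // mul1mx mxE.
Qed.

(** From [A Q T = Q] the resolvent [X] satisfies [X Q = w X Q T - Q T]; iteration gives a power
    series in [w]. The remainder is kept exact and is of order [(K e) ^ n]. *)
Let resolvent_expansion w n : cabs w = e ->
  invmx (w%:M - A) *m Q = - (\sum_(k < n) w ^+ k *: (Q *m Tp k.+1)) +
    w ^+ n *: (invmx (w%:M - A) *m Q *m Tp n).
Proof.
move=> we; set X := invmx _.
have base : X *m Q = w *: (X *m Q *m T) - Q *m T.
  have E : (w%:M - A) *m (w *: (X *m Q *m T) - Q *m T) = Q.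
    rewrite mulmxBr -scalemxAr (_ : (w%:M - A) *m (X *m Q *m T) = Q *m T).
      by rewrite [(w%:M - A) *m _]mulmxBl mul_scalar_mx QT opprB addrCA subrr addr0.
    by rewrite !mulmxA mulmxV ?resolvent // mul1mx.
  by rewrite -{1}E mulKmx // resolvent.
elim: n => [|n IH].
  by rewrite big_ord0 oppr0 add0r expr0 scale1r /Tp /= mulmx1.
rewrite {1}IH big_ord_recr /= opprD -addrA; congr (_ + _).
rewrite {1}base mulmxBl -scalemxAl scalerBr scalerA -exprSr addrC.
by rewrite -!mulmxA.
Qed.

(** The resolvent splits into its values on [Q] and on [P]. The first part is a power series in [w]
    without residue; the second is [(w - b)^-1] times [P], a series in [b / w] with residue [P]. *)
Lemma spectral_projection_rank_one : spectral_projection A e = P.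
Proof.
apply/matrixP => j k; rewrite mxE.
pose c n := - (Q *m Tp n.+1) j k.
pose c' n := b ^+ n * P j k.
(* One rate for both series: [K * e] for the regular part, [|b| / e] for the polar part. *)
pose q := Num.max (K * e) (cabs b / e).
have ei0 : 0 < e^-1 by rewrite invr_gt0.
have Ke0 : 0 <= K * e by rewrite mulr_ge0 // ltW.
have be0 : 0 <= cabs b / e by rewrite divr_ge0 ?cabs_ge0 // ltW.
have q0 : 0 <= q by rewrite le_max Ke0.
have q1 : q < 1 by rewrite gt_max Ke /= ltr_pdivrMr // mul1r.
have qK n : (K * e) ^+ n <= q ^+ n by rewrite lerXn2r ?nnegrE // le_max lexx.
have qb n : (cabs b / e) ^+ n <= q ^+ n by rewrite lerXn2r ?nnegrE // le_max lexx orbT.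
have row_le (B : 'M[R[i]]_N) n : cabs ((B *m Tp n) j k) <= (\sum_i cabs (B j i)) * K ^+ n.
  rewrite mxE mulr_suml; apply: le_trans (cabs_sum _ _) _; apply: ler_sum => i _.
  by rewrite cabsM ler_wpM2l ?cabs_ge0.
pose SQ := \sum_i cabs (Q j i).
have SQ0 : 0 <= SQ by apply: sumr_ge0 => i _; exact: cabs_ge0.
pose M := SQ * K + cabs (P j k).
have M0 : 0 <= M by rewrite addr_ge0 ?mulr_ge0 ?cabs_ge0.
rewrite (@circle_integral_laurent R e _ c c' M q) //.
- by rewrite /c' expr0 mul1r.
- move=> n; rewrite /c cabsN.
  apply: le_trans (ler_wpM2r _ (row_le Q n.+1)) _; first by rewrite exprn_ge0 ?ltW.
  have -> : SQ * K ^+ n.+1 * e ^+ n = SQ * K * (K * e) ^+ n by rewrite exprMn exprS; ring.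
  apply: le_trans (ler_wpM2l _ (qK n)) _; first by rewrite mulr_ge0.
  by rewrite ler_wpM2r ?exprn_ge0 // lerDl cabs_ge0.
- move=> n; rewrite /c' cabsM cabsX mulrAC -exprMn.
  rewrite mulrC; apply: le_trans (ler_wpM2l _ (qb n)) _; first exact: cabs_ge0.
  by rewrite ler_wpM2r ?exprn_ge0 // lerDr mulr_ge0.
move=> t; set w := circle e t.
have we : cabs w = e by rewrite cabs_circle // ltW.
have w0 : w != 0 by rewrite -cabs_gt0 we.
have wb : w - b != 0.
  by apply/eqP => /subr0_eq wb; move: b_lt; rewrite -wb we ltxx.
pose X := invmx (w%:M - A).
pose SX := \sum_i cabs ((X *m Q) j i).
exists (SX + cabs ((w - b)^-1 * P j k)) => n.
have XP : X *m P = (w - b)^-1 *: P.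
  have E : (w%:M - A) *m ((w - b)^-1 *: P) = P.
    by rewrite -scalemxAr mulmxBl mul_scalar_mx AP -scalerBl scalerA mulVf // scale1r.
  by rewrite -{1}E mulKmx // resolvent.
have geo : (w - b)^-1 = \sum_(i < n) b ^+ i * w^-1 ^+ i.+1 + (b / w) ^+ n * (w - b)^-1.
  elim: n => [|n IH]; first by rewrite big_ord0 add0r expr0 mul1r.
  rewrite {1}IH big_ord_recr /= -addrA; congr (_ + _).
  by rewrite !exprMn !exprS; field; rewrite wb w0.
have XE : X = X *m Q + X *m P by rewrite /Q mulmxBr mulmx1 subrK.
have XQ : (X *m Q) j k = \sum_(i < n) c i * w ^+ i + w ^+ n * (X *m Q *m Tp n) j k.
  rewrite {1}(resolvent_expansion n we) [LHS]mxE; congr (_ + _); last by rewrite mxE.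
  rewrite mxE summxE -sumrN; apply: eq_bigr => i _.
  by rewrite mxE /c mulNr mulrC.
have XPjk : (X *m P) j k = \sum_(i < n) c' i * w^-1 ^+ i.+1 +
    (b / w) ^+ n * ((w - b)^-1 * P j k).
  rewrite XP mxE {1}geo mulrDl mulr_suml -mulrA; congr (_ + _).
  by apply: eq_bigr => i _; rewrite /c'; ring.
have -> : X j k - \sum_(i < n) (c i * w ^+ i + c' i * w^-1 ^+ i.+1) =
    w ^+ n * (X *m Q *m Tp n) j k + (b / w) ^+ n * ((w - b)^-1 * P j k).
  by rewrite big_split /= {1}XE mxE XQ XPjk; ring.
apply: le_trans (cabsD _ _) _; rewrite mulrDl; apply: lerD.
  rewrite cabsM cabsX we; apply: le_trans (ler_wpM2l _ (row_le _ n)) _.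
    by rewrite exprn_ge0 // ltW.
  rewrite mulrCA -exprMn [e * K]mulrC ler_wpM2l //.
  by apply: sumr_ge0 => i _; exact: cabs_ge0.
by rewrite cabsM cabsX cabsM cabsV we mulrC ler_wpM2l ?cabs_ge0.
Qed.

End RankOneProjection.

(** * Expansion of the smallest eigenvalue *)

Section EigenpairExpansion.
Variables (R : realType) (N : nat) (L B : R) (F : 'I_N -> 'I_N -> R).
Variables (v : 'I_N -> R) (lam e : R).
Hypotheses (N_gt0 : (0 < N)%N) (L_ge1 : 1 <= L).
Hypothesis F_sym : forall j k, F j k = F k j.
Hypothesis F_bnd : forall j k, L^-1 / N%:R <= F j k <= L / N%:R.
Hypothesis v_gt0 : forall j, 0 < v j.
Hypothesis v_eig : forall j, \sum_k F j k * v k = lam * v j.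
Hypothesis v_norm : mean (fun j => v j ^+ 2) = 1.
Hypothesis lam_bnd : 2^-1 <= lam <= 1.
(* [B] is the constant of [shifted_inverse]; the later bounds only use powers of [B]. *)
Hypothesis B_E : B = 84 * L ^+ 5.
Hypothesis e_gt0 : 0 < e.
Hypothesis e_small : 96 * B ^+ 2 * L ^+ 2 * e <= 1.

Let L_gt0 : 0 < L. Proof. exact: lt_le_trans L_ge1. Qed.
Let cv j : R[i] := (v j)%:C.

Lemma const_ge84 : 84 <= B.
Proof. have := exprn_ege1 5 L_ge1; rewrite B_E; lra. Qed.
Let B84 := const_ge84.
Let B_ge1 : 1 <= B. Proof. have := B84; lra. Qed.
Let B_gt0 : 0 < B. Proof. exact: lt_le_trans B_ge1. Qed.
Let Bn0 n : 0 <= B ^+ n. Proof. by rewrite exprn_ge0 // ltW. Qed.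

Lemma L_le_const : 84 * L <= B.
Proof.
have : L <= L ^+ 5 by rewrite -{1}[L]expr1 ler_weXn2l.
rewrite B_E; lra.
Qed.
Let LB : L <= B. Proof. have := L_le_const; have := L_gt0; lra. Qed.

Lemma perron_const_le j : v j <= B.
Proof.
have := perron_le N_gt0 L_ge1 F_bnd v_gt0 v_eig v_norm lam_bnd j.
have := L_le_const; have := L_gt0; lra.
Qed.

Let mean_cvcv : mean (fun k => cv k * cv k) = 1.
Proof.
rewrite (eq_mean (y := fun k => (v k ^+ 2)%:C)) ?mean_complex ?v_norm //.
by move=> k; rewrite /cv -rmorphM expr2.
Qed.

Let cv_le j : cabs (cv j) <= B.
Proof. by rewrite cabs_real gtr0_norm // perron_const_le. Qed.

Lemma mean_prod_le (x y : 'I_N -> R[i]) X Y : 0 <= X ->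
  (forall j, cabs (x j) <= X) -> (forall j, cabs (y j) <= Y) ->
  cabs (mean (fun j => x j * y j)) <= X * Y.
Proof.
move=> X0 hx hy; apply: cabs_mean_le => // j; rewrite cabsM.
by apply: ler_pM; rewrite ?cabs_ge0.
Qed.

Lemma left_eigenvector (U r : 'I_N -> R[i]) b : (forall j, U j != 0) ->
  (forall j, MU F U r j = b * r j) -> forall x,
  mean (fun j => r j / U j * MU F U x j) = b * mean (fun j => r j / U j * x j).
Proof.
move=> U0 hr x.
have Fr k : \sum_j (F j k)%:C * r j = (1 - b) * (r k / U k).
  apply: (mulfI (U0 k)); have := hr k; rewrite /MU /Fapp.
  under eq_bigr => j _ do rewrite F_sym.
  set X := \sum_j _ => E; have -> : U k * X = r k - b * r k.
    by rewrite -E; ring.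
  by field; exact: U0.
transitivity (mean (fun j => r j / U j * x j) -
    mean (fun j => (1 - b) * (r j / U j) * x j)); last first.
  have -> : mean (fun j => (1 - b) * (r j / U j) * x j) =
     (1 - b) * mean (fun j => r j / U j * x j).
    by rewrite -meanZ; apply: eq_mean => j; ring.
  ring.
rewrite -meanB /mean; congr (_ * _); rewrite !sumrB.
rewrite (eq_bigr (fun j => r j / U j * x j - r j * Fapp F x j)); last first.
  by move=> j _; rewrite /MU; field; exact: U0.
rewrite sumrB; congr (_ - _).
rewrite /Fapp; under eq_bigr do rewrite mulr_sumr.
rewrite exchange_big /=; apply: eq_bigr => k _; rewrite -Fr mulr_suml.
by apply: eq_bigr => j _; ring.
Qed.

(** [perturbed_eigenvalue] with every constant rounded up to a power of [B], plus the estimate for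
    the left eigenvector [r / U], which loses one more power. *)
Lemma eigenpair (U : 'I_N -> R[i]) d :
  (forall j, cabs (U j - 1) <= d) -> 1 - lam <= d -> B ^+ 4 * d <= e ->
  exists (b : R[i]) (r : 'I_N -> R[i]),
  [/\ cabs b <= B ^+ 4 * d /\ (forall j, U j != 0),
      (forall j, cabs (r j - (v j)%:C) <= B ^+ 6 * d) /\
      (forall j, cabs (r j / U j - (v j)%:C) <= B ^+ 7 * d),
      mean (fun k => (v k)%:C * r k) = 1,
      forall j, MU F U r j = b * r j &
      forall w u, cabs w <= e -> (forall j, MU F U u j = w * u j) ->
        (exists j, u j != 0) ->
        w = b /\ forall j, u j = mean (fun k => (v k)%:C * u k) * r j].
Proof.
move=> hU hl hd.
have d0 : 0 <= d by apply: le_trans (hU (Ordinal N_gt0)); exact: cabs_ge0.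
have LL n : L ^+ n <= B ^+ n by rewrite lerXn2r ?nnegrE ?(ltW L_gt0) ?(ltW B_gt0).
have c1 : 16 * L ^+ 2 * B <= B ^+ 4.
  have -> : B ^+ 4 = B * B ^+ 2 * B by ring.
  rewrite ler_wpM2r ?(ltW B_gt0) //; apply: ler_pM => //.
    by rewrite exprn_ge0 // ltW.
  by have := B84; lra.
have c2 : 36 * L ^+ 3 * B ^+ 2 <= B ^+ 6.
  have -> : B ^+ 6 = B * B ^+ 3 * B ^+ 2 by ring.
  rewrite ler_wpM2r //; apply: ler_pM => //.
    by rewrite exprn_ge0 // ltW.
  by have := B84; lra.
have hd' : 16 * L ^+ 2 * B * d <= e by apply: le_trans (ler_wpM2r d0 c1) hd.
have [b [r [h1 h2 h3 h4 h5]]] := perturbed_eigenvalue N_gt0 L_ge1 F_sym F_bnd v_gt0 v_eig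
  v_norm lam_bnd B_E e_gt0 e_small hd' hU hl.
have e1 : e <= 1.
  apply: le_trans e_small; rewrite ler_peMl ?(ltW e_gt0) //.
  have := mulr_ege1 (exprn_ege1 2 B_ge1) (exprn_ege1 2 L_ge1); lra.
have dB : 84 * d <= 1.
  apply: le_trans e1; apply: le_trans hd; rewrite ler_wpM2r //.
  apply: le_trans B84 _; rewrite -{1}[B]expr1 ler_weXn2l //.
have hr j : cabs (r j - (v j)%:C) <= B ^+ 6 * d.
  by apply: le_trans (h2 j) _; rewrite ler_wpM2r.
have U2 j : 2^-1 <= cabs (U j).
  have := cabsB (U j) (U j - 1); rewrite opprB addrCA subrr addr0 cabs1.
  have := hU j; lra.
have U0 j : U j != 0.
  by rewrite -cabs_gt0; apply: lt_le_trans (U2 j); rewrite invr_gt0.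
exists b, r; split => //.
  by split => //; apply: le_trans h1 _; rewrite ler_wpM2r.
split => // j.
have -> : r j / U j - (v j)%:C = (U j)^-1 * ((r j - cv j) - (U j - 1) * cv j).
  by rewrite /cv; field; exact: U0.
rewrite cabsM cabsV.
have Ui : (cabs (U j))^-1 <= 2.
  rewrite -[2]invrK lef_pV2 ?posrE ?invr_gt0 //.
  by apply: lt_le_trans (U2 j); rewrite invr_gt0.
have q1 : cabs ((U j - 1) * cv j) <= d * B.
  by rewrite cabsM; apply: ler_pM; rewrite ?cabs_ge0.
have q2 := hr j.
have q3 : cabs (r j - cv j - (U j - 1) * cv j) <= B ^+ 6 * d + d * B.
  by apply: le_trans (cabsB _ _) _; rewrite lerD.
apply: le_trans (ler_pM _ _ Ui q3) _; rewrite ?invr_ge0 ?cabs_ge0 //.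
have B6 : B * d <= B ^+ 6 * d by rewrite ler_wpM2r // -{1}[B]expr1 ler_weXn2l.
have B7 : 84 * (B ^+ 6 * d) <= B ^+ 7 * d.
  have -> : B ^+ 7 * d = B * (B ^+ 6 * d) by ring.
  by rewrite ler_wpM2r // mulr_ge0.
have := mulr_ge0 (Bn0 6) d0; lra.
Qed.

Variables (f mm : 'I_N -> R) (ka : R).
Hypothesis f_bnd : forall j, L^-1 <= f j <= L.
Hypothesis mm_bnd : forall j, L^-1 <= mm j <= L.
Hypothesis ka_ge0 : 0 <= ka.
Hypothesis f_eq : forall j, f j - \sum_k F j k * f k = ka * mm j.
Hypothesis lam_ka : 1 - lam <= L ^+ 2 * ka.

Let sg := mean (fun k => v k * f k).
Let Li_gt0 : 0 < L^-1. Proof. by rewrite invr_gt0. Qed.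
Let f_gt0 j : 0 < f j.
Proof. by case/andP: (f_bnd j) => + _; exact: lt_le_trans. Qed.
Let mm_gt0 j : 0 < mm j.
Proof. by case/andP: (mm_bnd j) => + _; exact: lt_le_trans. Qed.

(** Only the two-sided bounds on [f] enter, so the lemma is applied later with the moduli of [m] in
    place of [f]. *)
Lemma overlap_bnd : B^-1 <= sg <= B.
Proof.
apply/andP; split.
  apply: (@le_trans _ _ (L^-1 * mean v)).
    have := perron_mean N_gt0 L_ge1 F_bnd v_gt0 v_eig v_norm lam_bnd => h.
    apply: le_trans (ler_wpM2l (ltW Li_gt0) h).
    rewrite -invfM lef_pV2 ?posrE ?mulr_gt0 // B_E.
    have h2 : L * (2 * L) <= 2 * L ^+ 5.
      rewrite mulrCA ler_wpM2l // -expr2 ler_weXn2l //.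
    have : 0 <= L ^+ 5 by rewrite exprn_ge0 // ltW.
    lra.
  rewrite -meanZ; apply: ler_mean => // k; rewrite mulrC ler_wpM2l ?(ltW (v_gt0 k)) //.
  by case/andP: (f_bnd k).
have v1 j := perron_le N_gt0 L_ge1 F_bnd v_gt0 v_eig v_norm lam_bnd j.
apply: (@le_trans _ _ (2 * L * L)).
  apply: mean_le => // k; apply: ler_pM; rewrite ?(ltW (v_gt0 k)) ?(ltW (f_gt0 k)) //.
  by case/andP: (f_bnd k).
rewrite B_E.
have h2 : L * L <= L ^+ 5 by rewrite -expr2 ler_weXn2l.
have : 0 <= L ^+ 5 by rewrite exprn_ge0 // ltW.
lra.
Qed.

(** Both [f] and [v] almost solve [(1 - F) x = 0], with errors [ka * mm] and [(1 - lam) v]. The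
    combination [f - sg v] is orthogonal to [v], so the rank-one term in [kernel_inverse_real]
    vanishes and the inverse bound applies directly. *)
Lemma perron_direction j : `|f j - sg * v j| <= 2 * B ^+ 5 * ka.
Proof.
have [s1 s2] := andP overlap_bnd.
have s0 : 0 <= sg by apply: le_trans s1; rewrite invr_ge0 ltW.
have H k : `|(f k - sg * v k) - \sum_l F k l * (f l - sg * v l) +
    v k * mean (fun l => v l * (f l - sg * v l))| <= 2 * B ^+ 4 * ka.
  have -> : mean (fun l => v l * (f l - sg * v l)) = 0.
    rewrite (eq_mean (y := fun l => v l * f l - sg * v l ^+ 2)); last by move=> l; ring.
    by rewrite meanB meanZ v_norm mulr1 subrr.
  have -> : \sum_l F k l * (f l - sg * v l) = \sum_l F k l * f l - sg * (lam * v k).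
    rewrite -v_eig mulr_sumr -sumrB; apply: eq_bigr => l _; ring.
  rewrite mulr0 addr0.
  have -> : f k - sg * v k - (\sum_l F k l * f l - sg * (lam * v k)) =
     ka * mm k - sg * (1 - lam) * v k by rewrite -f_eq; ring.
  apply: le_trans (ler_normB _ _) _.
  have m1 : `|ka * mm k| <= B ^+ 4 * ka.
    rewrite normrM ger0_norm // mulrC gtr0_norm // ler_wpM2r //.
    case/andP: (mm_bnd k) => _ h; apply: le_trans h _; apply: le_trans LB _.
    by rewrite -{1}[B]expr1 ler_weXn2l.
  have m2 : `|sg * (1 - lam) * v k| <= B ^+ 4 * ka.
    have l0 : 0 <= 1 - lam by case/andP: lam_bnd => _; lra.
    have sl0 : 0 <= sg * (1 - lam) by exact: mulr_ge0.
    rewrite (ger0_norm (mulr_ge0 sl0 (ltW (v_gt0 k)))).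
    have -> : B ^+ 4 * ka = B * (B ^+ 2 * ka) * B by ring.
    have sl : sg * (1 - lam) <= B * (B ^+ 2 * ka).
      apply: ler_pM => //; apply: le_trans lam_ka _; rewrite ler_wpM2r //.
      by rewrite lerXn2r ?nnegrE ?(ltW L_gt0) ?(ltW B_gt0).
    exact: (ler_pM sl0 (ltW (v_gt0 k)) sl (perron_const_le k)).
  by apply: le_trans (lerD m1 m2) _; rewrite le_eqVlt; apply/orP; left; apply/eqP; ring.
have := kernel_inverse_real N_gt0 L_ge1 F_sym F_bnd v_gt0 v_eig v_norm lam_bnd H j.
move=> H2; apply: le_trans H2 _.
have -> : 2 * B ^+ 5 * ka = B * (2 * B ^+ 4 * ka) by ring.
have p0 : 0 <= 2 * B ^+ 4 * ka by apply: mulr_ge0 => //; exact: mulr_ge0.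
apply: (ler_wpM2r p0); rewrite B_E.
have : 0 <= L ^+ 5 by rewrite exprn_ge0 // ltW.
lra.
Qed.

End EigenpairExpansion.

(** Exponent 30 is a common budget: every lower power is small with a factor 84 to spare, enough for
    the numerical constants of a single estimate. *)
Lemma pow_small (R : realType) (B x e : R) n : 84 <= B -> 0 <= x -> B ^+ 30 * x <= e ->
  (n <= 29)%N -> 84 * (B ^+ n * x) <= e.
Proof.
move=> B84 x0 h hn; apply: le_trans h; rewrite mulrA ler_wpM2r //.
have B1 : 1 <= B by lra.
rewrite [B ^+ 30]exprS; apply: ler_pM => //; first by rewrite exprn_ge0 //; lra.
by rewrite ler_weXn2l.
Qed.

Lemma argmax_attained (R : realType) (N : nat) (g : 'I_N -> R[i]) : (0 < N)%N ->
  exists G, (forall j, cabs (g j) <= G) /\ exists j, G = cabs (g j).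
Proof.
move=> /(argmax_cabs g)[j0 h]; exists (cabs (g j0)); split => //; by exists j0.
Qed.

(** * The difference of two solutions to leading order *)

Section Amplitude.
Variables (R : realType) (N : nat) (B : R) (F : 'I_N -> 'I_N -> R).
Variables (v mm : 'I_N -> R) (U0 : 'I_N -> R[i]) (b0 : R[i]) (r0 l0 : 'I_N -> R[i]).
(** In the application [gt] is the difference of the solutions divided by [|m|] and [G] its maximum.
    [U0] belongs to the pair of arguments [z], [z], [U1] to [z], [zeta], and [tau] is [rho] plus
    [Im z / rho]. *)
Variables (tau G : R) (gt U1 q : 'I_N -> R[i]) (w : R[i]).
Hypotheses (N_gt0 : (0 < N)%N) (B84 : 84 <= B).
Hypothesis F_le : forall u X, (forall j, cabs (u j) <= X) ->
  forall j, cabs (Fapp F u j) <= B * X.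
Hypothesis v_bnd : forall j, 0 < v j <= B.
Hypothesis v_norm : mean (fun j => v j ^+ 2) = 1.
Hypothesis inv0 : forall u X, (forall j, cabs (MU F U0 u j + Jop v u j) <= X) ->
  forall j, cabs (u j) <= B * X.
Hypothesis b0_le : cabs b0 <= B ^+ 6 * tau.
Hypothesis r0_le : forall j, cabs (r0 j - (v j)%:C) <= B ^+ 8 * tau.
Hypothesis l0_le : forall j, cabs (l0 j - (v j)%:C) <= B ^+ 9 * tau.
Hypothesis v_r0 : mean (fun k => (v k)%:C * r0 k) = 1.
Hypothesis r0_eig : forall j, MU F U0 r0 j = b0 * r0 j.
Hypothesis l0_eig : forall x, mean (fun j => l0 j * MU F U0 x j) =
  b0 * mean (fun j => l0 j * x j).
Hypothesis gt_eq : forall j, MU F U1 gt j = w * q j.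
Hypothesis U_diff : forall j, cabs (U1 j - U0 j) <= cabs (gt j).
Hypothesis q_le : forall j, cabs (q j) <= B.
Hypothesis q_diff : forall j, cabs (q j - (mm j)%:C) <= B ^+ 3 * (tau + G).
Hypothesis v_mm : B^-1 <= mean (fun j => v j * mm j).
Hypothesis G_bnd : forall j, cabs (gt j) <= G.
Hypothesis G_att : exists j, G = cabs (gt j).
Hypothesis tau_ge0 : 0 <= tau.
Hypothesis tau_small : B ^+ 30 * tau <= 1.
Hypothesis G_small : B ^+ 30 * G <= 1.

Let B_ge1 : 1 <= B. Proof. have := B84; lra. Qed.
Let B_gt0 : 0 < B. Proof. exact: lt_le_trans B_ge1. Qed.
Let B_ge0 : 0 <= B. Proof. exact: ltW. Qed.
Let Bn0 n : 0 <= B ^+ n. Proof. exact: exprn_ge0. Qed.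
Let G_ge0 : 0 <= G. Proof. by case: G_att => j ->; exact: cabs_ge0. Qed.
Let st n (hn : (n <= 29)%N) := pow_small B84 tau_ge0 tau_small hn.
Let sG n (hn : (n <= 29)%N) := pow_small B84 G_ge0 G_small hn.
Let cv j : R[i] := (v j)%:C.

Let pw n m x : (n <= m)%N -> 0 <= x -> B ^+ n * x <= B ^+ m * x.
Proof. by move=> h x0; rewrite ler_wpM2r // ler_weXn2l. Qed.

Let pwS n x : 0 <= x -> 84 * (B ^+ n * x) <= B ^+ n.+1 * x.
Proof.
move=> x0; have -> : B ^+ n.+1 * x = B * (B ^+ n * x) by rewrite exprS; ring.
by rewrite ler_wpM2r // mulr_ge0.
Qed.

Let cv_le j : cabs (cv j) <= B.
Proof. by case/andP: (v_bnd j) => h1 h2; rewrite cabs_real gtr0_norm. Qed.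

Let r0_B j : cabs (r0 j) <= 2 * B.
Proof.
have -> : r0 j = (r0 j - cv j) + cv j by rewrite subrK.
apply: le_trans (cabsD _ _) _; have := r0_le j; have := cv_le j.
rewrite /cv; have := @st 8 isT; have := B_ge1; lra.
Qed.

Let l0_B j : cabs (l0 j) <= 2 * B.
Proof.
have -> : l0 j = (l0 j - cv j) + cv j by rewrite subrK.
apply: le_trans (cabsD _ _) _; have := l0_le j; have := cv_le j.
rewrite /cv; have := @st 9 isT; have := B_ge1; lra.
Qed.

Let p := mean (fun j => l0 j * gt j).
Let A1 := mean (fun j => l0 j * r0 j).
Let A2 := mean (fun j => l0 j * cv j).
Let ga := mean (fun j => l0 j * q j).

Let mean_cvcv : mean (fun k => cv k * cv k) = 1.
Proof.
rewrite (eq_mean (y := fun k => (v k ^+ 2)%:C)) ?mean_complex ?v_norm //.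
by move=> k; rewrite /cv -rmorphM expr2.
Qed.

Let A1_1 : cabs (A1 - 1) <= 2 * (B ^+ 10 * tau).
Proof.
rewrite /A1 -v_r0 -meanB.
rewrite (eq_mean (y := fun k => (l0 k - cv k) * r0 k)); last by move=> k; rewrite /cv; ring.
have -> : 2 * (B ^+ 10 * tau) = B ^+ 9 * tau * (2 * B) by ring.
by apply: mean_prod_le => //; rewrite mulr_ge0.
Qed.

Lemma left_overlap : cabs (A2 - 1) <= B ^+ 10 * tau.
Proof.
rewrite /A2 -mean_cvcv -meanB.
rewrite (eq_mean (y := fun k => (l0 k - cv k) * cv k)); last by move=> k; ring.
have -> : B ^+ 10 * tau = B ^+ 9 * tau * B by ring.
by apply: mean_prod_le => //; rewrite mulr_ge0.
Qed.

Let near1 (x : R[i]) d : cabs (x - 1) <= d -> 2 * d <= 1 -> 2^-1 <= cabs x <= 2.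
Proof.
move=> h1 h2; have := cabsB x (x - 1); rewrite opprB addrCA subrr addr0 cabs1 => h3.
by have := cabsD (x - 1) 1; rewrite subrK cabs1 => h4; apply/andP; split; lra.
Qed.

Let A1_bnd : 2^-1 <= cabs A1 <= 2.
Proof. by apply: near1 A1_1 _; have := @st 10 isT; lra. Qed.

Lemma left_overlap_bnd : 2^-1 <= cabs A2 <= 2.
Proof. by apply: near1 left_overlap _; have := @st 10 isT; lra. Qed.

Lemma left_right_overlap_neq0 : A1 != 0.
Proof. by rewrite -cabs_gt0; apply: lt_le_trans (_ : 2^-1 <= _); case/andP: A1_bnd. Qed.
Lemma left_overlap_neq0 : A2 != 0.
Proof.
by rewrite -cabs_gt0; apply: lt_le_trans (_ : 2^-1 <= _); case/andP: left_overlap_bnd.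
Qed.

(** [inv0] concerns the operator with the projection onto [v] added. Here the true spectral
    projection is used, with [1 - b0] moving the eigenvalue to 1. The two differ by [B ^ 13 * tau],
    absorbed at the maximum of [u], which doubles the constant. *)
Lemma deflated_inverse u X :
  (forall j, cabs (MU F U0 u j +
     (1 - b0) * (r0 j * (mean (fun k => l0 k * u k) / A1))) <= X) ->
  forall j, cabs (u j) <= 2 * B * X.
Proof.
move=> hX j; have [Y [Yb [j0 Yj0]]] := argmax_attained u N_gt0.
apply: le_trans (Yb j) _.
have Y0 : 0 <= Y by rewrite Yj0 cabs_ge0.
pose P := mean (fun k => l0 k * u k); pose V := mean (fun k => cv k * u k).
have PB : cabs P <= 2 * B * Y by apply: mean_prod_le => //; rewrite mulr_ge0.
have VB : cabs V <= B * Y by exact: mean_prod_le.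
have PV : cabs (P - V) <= B ^+ 9 * tau * Y.
  rewrite /P /V -meanB (eq_mean (y := fun k => (l0 k - cv k) * u k)); last by move=> k; ring.
  by apply: mean_prod_le => //; rewrite mulr_ge0.
have i1 : cabs A1^-1 <= 2.
  rewrite cabsV -[2]invrK lef_pV2 ?posrE ?invr_gt0 ?cabs_gt0 ?left_right_overlap_neq0 //.
  by case/andP: A1_bnd.
have PA : cabs (P / A1) <= 4 * B * Y.
  rewrite cabsM; have := ler_pM (cabs_ge0 _) (cabs_ge0 _) PB i1; lra.
have d1 : cabs (P / A1 - V) <= 2 * (B ^+ 9 * tau * Y) + 4 * (B ^+ 11 * tau * Y).
  have -> : P / A1 - V = ((P - V) - V * (A1 - 1)) * A1^-1.
    by field; exact: left_right_overlap_neq0.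
  have h1 : cabs (V * (A1 - 1)) <= B * Y * (2 * (B ^+ 10 * tau)).
    by rewrite cabsM; apply: ler_pM; rewrite ?cabs_ge0.
  have h2 := le_trans (cabsB (P - V) (V * (A1 - 1))) (lerD PV h1).
  rewrite cabsM; have := ler_pM (cabs_ge0 _) (cabs_ge0 _) h2 i1; lra.
have H k : cabs (MU F U0 u k + Jop v u k) <= X + B ^+ 13 * tau * Y.
  have -> : MU F U0 u k + Jop v u k =
    (MU F U0 u k + (1 - b0) * (r0 k * (P / A1))) +
    (b0 * (r0 k * (P / A1)) - (r0 k - cv k) * (P / A1) - cv k * (P / A1 - V)).
    by rewrite /Jop -/(cv k) -/V; ring.
  apply: le_trans (cabsD _ _) _; apply: lerD; first exact: hX.
  have h1 : cabs (b0 * (r0 k * (P / A1))) <= B ^+ 6 * tau * (2 * B * (4 * B * Y)).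
    rewrite cabsM; apply: ler_pM; rewrite ?cabs_ge0 //.
    by rewrite cabsM; apply: ler_pM; rewrite ?cabs_ge0.
  have h2 : cabs ((r0 k - cv k) * (P / A1)) <= B ^+ 8 * tau * (4 * B * Y).
    by rewrite cabsM; apply: ler_pM; rewrite ?cabs_ge0.
  have h3 : cabs (cv k * (P / A1 - V)) <=
      B * (2 * (B ^+ 9 * tau * Y) + 4 * (B ^+ 11 * tau * Y)).
    by rewrite cabsM; apply: ler_pM; rewrite ?cabs_ge0.
  apply: le_trans (cabsB _ _) _; apply: le_trans (lerD (cabsB _ _) h3) _.
  have tY : 0 <= tau * Y by exact: mulr_ge0.
  have k1 := @pw 8 12 (tau * Y) isT tY; have k2 := @pw 9 12 (tau * Y) isT tY.
  have k3 := @pw 10 12 (tau * Y) isT tY; have k4 := pwS 12 tY.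
  have k0 : 0 <= B ^+ 12 * (tau * Y) by exact: mulr_ge0.
  have e1 : B ^+ 6 * tau * (2 * B * (4 * B * Y)) = 8 * (B ^+ 8 * (tau * Y)) by ring.
  have e2 : B ^+ 8 * tau * (4 * B * Y) = 4 * (B ^+ 9 * (tau * Y)) by ring.
  have e3 : B * (2 * (B ^+ 9 * tau * Y) + 4 * (B ^+ 11 * tau * Y)) =
     2 * (B ^+ 10 * (tau * Y)) + 4 * (B ^+ 12 * (tau * Y)) by ring.
  have e4 : B ^+ 13 * tau * Y = B ^+ 13 * (tau * Y) by ring.
  rewrite e1 in h1; rewrite e2 in h2; rewrite e3 e4; lra.
have := inv0 H j0; rewrite -Yj0 mulrDr => H2.
have : B * (B ^+ 13 * tau * Y) <= 2^-1 * Y.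
  rewrite [leLHS](_ : _ = (B ^+ 14 * tau) * Y); last by ring.
  by rewrite ler_wpM2r //; have := @st 14 isT; lra.
lra.
Qed.

Let ga_bnd : (2 * B)^-1 <= cabs ga.
Proof.
have e : cabs (ga - (mean (fun j => v j * mm j))%:C) <=
    B ^+ 9 * tau * B + B * (B ^+ 3 * (tau + G)).
  rewrite -mean_complex /ga -meanB.
  rewrite (eq_mean (y := fun k => (l0 k - cv k) * q k + cv k * (q k - (mm k)%:C))); last first.
    by move=> k; rewrite rmorphM /= /cv; ring.
  rewrite meanD; apply: le_trans (cabsD _ _) _; apply: lerD.
    by apply: mean_prod_le => //; rewrite mulr_ge0.
  exact: mean_prod_le.
have := cabsB ga (ga - (mean (fun j => v j * mm j))%:C).
rewrite opprB addrCA subrr addr0 cabs_real => h.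
have h2 := le_trans (ler_norm _) h.
have h3 : 84 * (B * (B ^+ 9 * tau * B + B * (B ^+ 3 * (tau + G)))) <= 3.
  have -> : B * (B ^+ 9 * tau * B + B * (B ^+ 3 * (tau + G))) =
     B ^+ 11 * tau + B ^+ 5 * tau + B ^+ 5 * G by ring.
  have := @st 11 isT; have := @st 5 isT; have := @sG 5 isT; lra.
have h4 : B * B^-1 = 1 by rewrite mulfV // gt_eqF.
have i0 : 0 < B^-1 by rewrite invr_gt0.
have h5 : B ^+ 9 * tau * B + B * (B ^+ 3 * (tau + G)) <= B^-1 / 2.
  rewrite -(ler_pM2l B_gt0) [B * (B^-1 / 2)]mulrA h4; lra.
rewrite invfM mulrC; have := v_mm; lra.
Qed.

Let EF j : cabs ((U1 j - U0 j) * Fapp F gt j) <= B * G ^+ 2.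
Proof.
rewrite cabsM; have -> : B * G ^+ 2 = G * (B * G) by ring.
apply: ler_pM; rewrite ?cabs_ge0 //; first by apply: le_trans (U_diff j) _.
exact: F_le.
Qed.

Let MU0_gt j : MU F U0 gt j = (U1 j - U0 j) * Fapp F gt j + w * q j.
Proof. by rewrite -gt_eq /MU; ring. Qed.

(** Paired with the left eigenvector, the operator at [U0] becomes the small factor [b0], and
    replacing [U1] by [U0] costs a term quadratic in [gt]. As [ga] is bounded below, [w] can be
    eliminated in favour of the amplitude. *)
Let w_le : cabs w <= 2 * (B ^+ 7 * tau * cabs p) + 4 * (B ^+ 3 * G ^+ 2).
Proof.
have E : b0 * p = mean (fun j => l0 j * ((U1 j - U0 j) * Fapp F gt j)) + w * ga.
  rewrite -l0_eig -meanZ -meanD; apply: eq_mean => j; rewrite MU0_gt; ring.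
have h1 : cabs (mean (fun j => l0 j * ((U1 j - U0 j) * Fapp F gt j))) <= 2 * B * (B * G ^+ 2).
  by apply: mean_prod_le => //; rewrite mulr_ge0.
have h2 : cabs (w * ga) <= B ^+ 6 * tau * cabs p + 2 * B * (B * G ^+ 2).
  have -> : w * ga = b0 * p - mean (fun j => l0 j * ((U1 j - U0 j) * Fapp F gt j)).
    by rewrite E addrC addKr.
  apply: le_trans (cabsB _ _) _; apply: lerD => //.
  by rewrite cabsM ler_wpM2r ?cabs_ge0.
have h3 : cabs w * (2 * B)^-1 <= cabs (w * ga).
  by rewrite cabsM ler_wpM2l ?cabs_ge0.
have := le_trans h3 h2; rewrite ler_pdivrMr ?mulr_gt0 //; lra.
Qed.

Let c := p / A1.
Let c_le : cabs c <= 2 * cabs p.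
Proof.
rewrite /c cabsM cabsV mulrC ler_wpM2r ?cabs_ge0 //.
rewrite -[2]invrK lef_pV2 ?posrE ?invr_gt0 //; first by case/andP: A1_bnd.
by rewrite cabs_gt0 left_right_overlap_neq0.
Qed.

Let y j := 1 * gt j + - c * r0 j.

Let Mlin a a' u u' j : MU F U0 (fun k => a * u k + a' * u' k) j =
  a * MU F U0 u j + a' * MU F U0 u' j.
Proof.
rewrite /MU (_ : Fapp F _ j = a * Fapp F u j + a' * Fapp F u' j); first by ring.
rewrite /Fapp !mulr_sumr -big_split; apply: eq_bigr => k _ /=; ring.
Qed.

(** [y] is [gt] without its component along [r0], so [l0] annihilates it. The rank-one term of
    [inv0] then sees only the small difference [l0 - v]. *)
Let y_le j : cabs (y j) <= 10 * (B ^+ 5 * G ^+ 2) + 12 * (B ^+ 9 * tau * cabs p).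
Proof.
have [Y [Yb [j0 Yj0]]] := argmax_attained y N_gt0.
apply: le_trans (Yb j) _.
have Y0 : 0 <= Y by rewrite Yj0 cabs_ge0.
have p0 : 0 <= cabs p by exact: cabs_ge0.
have l0y : mean (fun k => l0 k * y k) = 0.
  rewrite (eq_mean (y := fun k => l0 k * gt k + - c * (l0 k * r0 k))); last first.
    by move=> k; rewrite /y; ring.
  by rewrite meanD meanZ -/p -/A1 /c; field; exact: left_right_overlap_neq0.
have H k : cabs (MU F U0 y k + Jop v y k) <=
    (B * G ^+ 2 + B * cabs w + 4 * (B ^+ 7 * tau * cabs p)) + B ^+ 10 * tau * Y.
  apply: le_trans (cabsD _ _) _; apply: lerD.
    rewrite /y Mlin r0_eig MU0_gt mul1r.
    apply: le_trans (cabsD _ _) _; apply: lerD.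
      apply: le_trans (cabsD _ _) _; apply: lerD => //.
      by rewrite cabsM mulrC ler_wpM2r ?cabs_ge0.
    rewrite cabsM cabsM cabsN.
    have : cabs b0 * cabs (r0 k) <= B ^+ 6 * tau * (2 * B).
      by apply: ler_pM; rewrite ?cabs_ge0.
    move=> h; have := ler_pM (cabs_ge0 c) (mulr_ge0 (cabs_ge0 b0) (cabs_ge0 (r0 k))) c_le h.
    lra.
  rewrite /Jop (_ : mean (fun i => (v i)%:C * y i) = - mean (fun i => (l0 i - cv i) * y i)); last first.
    rewrite (eq_mean (x := fun i => (l0 i - cv i) * y i) (y := fun i => l0 i * y i - cv i * y i)); last by move=> i; ring.
    by rewrite meanB l0y sub0r opprK.
  rewrite cabsM cabsN.
  have -> : B ^+ 10 * tau * Y = B * (B ^+ 9 * tau * Y) by ring.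
  apply: ler_pM; rewrite ?cabs_ge0 //; first exact: cv_le.
  by apply: mean_prod_le => //; rewrite mulr_ge0.
have := inv0 H j0; rewrite -Yj0 => H2.
have Y2 : B * (B ^+ 10 * tau * Y) <= 2^-1 * Y.
  rewrite [leLHS](_ : _ = (B ^+ 11 * tau) * Y); last by ring.
  by rewrite ler_wpM2r //; have := @st 11 isT; lra.
have w2 : B * (B * cabs w) <= 2 * (B ^+ 9 * tau * cabs p) + 4 * (B ^+ 5 * G ^+ 2).
  apply: le_trans (ler_wpM2l B_ge0 (ler_wpM2l B_ge0 w_le)) _.
  rewrite le_eqVlt; apply/orP; left; apply/eqP; ring.
have g2 := sqr_ge0 G.
have k1 : B ^+ 2 * G ^+ 2 <= B ^+ 5 * G ^+ 2 by exact: pw.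
have k2 : B ^+ 8 * (tau * cabs p) <= B ^+ 9 * (tau * cabs p).
  by apply: pw => //; rewrite mulr_ge0.
have e1 : B * (B * G ^+ 2) = B ^+ 2 * G ^+ 2 by ring.
have e2 : B * (B ^+ 7 * tau * cabs p) = B ^+ 8 * (tau * cabs p) by ring.
have e3 : B ^+ 9 * tau * cabs p = B ^+ 9 * (tau * cabs p) by ring.
rewrite !mulrDr e1 [B * (4 * _)]mulrCA e2 in H2; rewrite e3 in w2 *; lra.
Qed.

(** Normalized by [<l0, v>] and not by [<l0, r0>], to match the denominator of [xi]; the change is
    of relative order [tau]. *)
Let s := p / A2.

Let p_s : cabs p <= 2 * cabs s.
Proof.
have -> : p = s * A2 by rewrite /s divfK // left_overlap_neq0.
by rewrite cabsM mulrC ler_wpM2r ?cabs_ge0 //; case/andP: left_overlap_bnd.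
Qed.

Let first_bound j : cabs (gt j - s * cv j) <= B ^+ 6 * G ^+ 2 + B ^+ 12 * tau * cabs s.
Proof.
have p0 : 0 <= cabs p by exact: cabs_ge0.
have -> : gt j - s * cv j = y j + c * (r0 j - cv j) + (c - s) * cv j by rewrite /y; ring.
have cs : cabs (c - s) <= 12 * (B ^+ 10 * tau * cabs p).
  have -> : c - s = p * (A1^-1 * A2^-1) * ((A2 - 1) - (A1 - 1)).
    by rewrite /c /s; field; rewrite left_right_overlap_neq0 left_overlap_neq0.
  rewrite cabsM cabsM (cabsM A1^-1) !cabsV.
  have i1 : (cabs A1)^-1 <= 2.
    rewrite -[2]invrK lef_pV2 ?posrE ?invr_gt0 ?cabs_gt0 ?left_right_overlap_neq0 //.
    by case/andP: A1_bnd.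
  have i2 : (cabs A2)^-1 <= 2.
    rewrite -[2]invrK lef_pV2 ?posrE ?invr_gt0 ?cabs_gt0 ?left_overlap_neq0 //.
    by case/andP: left_overlap_bnd.
  have i12 : (cabs A1)^-1 * (cabs A2)^-1 <= 2 * 2.
    by apply: ler_pM; rewrite ?invr_ge0 ?cabs_ge0.
  have d : cabs (A2 - 1 - (A1 - 1)) <= B ^+ 10 * tau + 2 * (B ^+ 10 * tau).
    by apply: le_trans (cabsB _ _) _; apply: lerD => //; exact: left_overlap.
  have i120 : 0 <= (cabs A1)^-1 * (cabs A2)^-1 by rewrite mulr_ge0 ?invr_ge0 ?cabs_ge0.
  have := ler_pM (mulr_ge0 p0 i120) (cabs_ge0 _) (ler_wpM2l p0 i12) d; lra.
have t1 := y_le j.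
have t2 : cabs (c * (r0 j - cv j)) <= 2 * cabs p * (B ^+ 8 * tau).
  by rewrite cabsM; apply: ler_pM; rewrite ?cabs_ge0.
have t3 : cabs ((c - s) * cv j) <= 12 * (B ^+ 10 * tau * cabs p) * B.
  by rewrite cabsM; apply: ler_pM; rewrite ?cabs_ge0.
have tp0 : 0 <= tau * cabs p by rewrite mulr_ge0.
have k1 := @pw 8 11 (tau * cabs p) isT tp0.
have k2 := @pw 9 11 (tau * cabs p) isT tp0.
have g2 := sqr_ge0 G.
have k3 := pwS 5 g2.
have tps : tau * cabs p <= 2 * (tau * cabs s) by rewrite [leRHS]mulrCA ler_wpM2l.
have k4 : B ^+ 11 * (tau * cabs p) <= 2 * (B ^+ 11 * (tau * cabs s)).
  by rewrite [leRHS]mulrCA ler_wpM2l.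
have ts0 : 0 <= tau * cabs s by rewrite mulr_ge0 ?cabs_ge0.
have k5 := pwS 11 ts0.
apply: le_trans (cabsD _ _) _; apply: le_trans (lerD (cabsD _ _) (lexx _)) _.
have e1 : 2 * cabs p * (B ^+ 8 * tau) = 2 * (B ^+ 8 * (tau * cabs p)) by ring.
have e2 : 12 * (B ^+ 10 * tau * cabs p) * B = 12 * (B ^+ 11 * (tau * cabs p)) by ring.
have e3 : B ^+ 9 * tau * cabs p = B ^+ 9 * (tau * cabs p) by ring.
have e4 : B ^+ 12 * tau * cabs s = B ^+ 12 * (tau * cabs s) by ring.
have k0 : 0 <= B ^+ 5 * G ^+ 2 by rewrite mulr_ge0.
have k00 : 0 <= B ^+ 11 * (tau * cabs s) by rewrite mulr_ge0.
rewrite e1 in t2; rewrite e2 in t3; rewrite e3 in t1; rewrite e4; lra.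
Qed.

Lemma amplitude_upper : cabs s <= 4 * B * G.
Proof.
have hp : cabs p <= 2 * B * G by apply: mean_prod_le => //; rewrite mulr_ge0.
have i2 : (cabs A2)^-1 <= 2.
  rewrite -[2]invrK lef_pV2 ?posrE ?invr_gt0 ?cabs_gt0 ?left_overlap_neq0 //.
  by case/andP: left_overlap_bnd.
rewrite /s cabsM cabsV.
have := ler_pM (cabs_ge0 p) _ hp i2; rewrite invr_ge0 cabs_ge0 => /(_ isT); lra.
Qed.

(** At the maximum of [gt] the remainder of [first_bound] is either quadratic in [G], hence below
    [G / 2], or carries [tau], hence below the main term. *)
Lemma amplitude_lower : G <= 4 * B * cabs s.
Proof.
have [j0 Gj0] := G_att.
have h : G <= B * cabs s + (B ^+ 6 * G ^+ 2 + B ^+ 12 * tau * cabs s).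
  rewrite {1}Gj0 -[gt j0](subrK (s * cv j0)) addrC.
  apply: le_trans (cabsD _ _) _; apply: lerD => //.
  by rewrite cabsM mulrC ler_wpM2r ?cabs_ge0.
have g : B ^+ 6 * G ^+ 2 <= 2^-1 * G.
  by rewrite expr2 mulrA ler_wpM2r //; have := @sG 6 isT; lra.
have t : B ^+ 12 * tau * cabs s <= B * cabs s.
  rewrite ler_wpM2r ?cabs_ge0 //; have := @st 12 isT; have := B_ge1; lra.
lra.
Qed.

(** Trading [G] for the amplitude by [amplitude_lower] makes the quadratic remainder proportional to
    [|s|], as a relative error requires. *)
Lemma amplitude_expansion j :
  cabs (gt j - s * cv j) <= B ^+ 12 * (cabs s * (cabs s + tau)).
Proof.
apply: le_trans (first_bound j) _.
have s0 := cabs_ge0 s.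
have g2 : G ^+ 2 <= (4 * B * cabs s) ^+ 2.
  by rewrite lerXn2r ?nnegrE // ?amplitude_lower // !mulr_ge0.
have h : B ^+ 6 * G ^+ 2 <= 16 * (B ^+ 8 * cabs s ^+ 2).
  apply: le_trans (ler_wpM2l (Bn0 6) g2) _.
  by rewrite le_eqVlt; apply/orP; left; apply/eqP; ring.
have k1 := pwS 8 (sqr_ge0 (cabs s)).
have k2 := @pw 9 12 _ isT (sqr_ge0 (cabs s)).
have k0 : 0 <= B ^+ 8 * cabs s ^+ 2 by rewrite mulr_ge0 ?sqr_ge0.
have -> : B ^+ 12 * (cabs s * (cabs s + tau)) = B ^+ 12 * cabs s ^+ 2 + B ^+ 12 * tau * cabs s.
  by ring.
lra.
Qed.

End Amplitude.

(** Here [b = w * Y / X] with [X ~ D sg], [Y ~ Y0], [P ~ sg Y0] and [f2 ~ sg ^ 2], so that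
    [Y / X ~ sg Y0 / (D sg ^ 2) ~ P / (f2 D)]. The error in [X] is relative because [D] has no lower
    bound. *)
Lemma eigenvalue_ratio (R : realType) (B sg Y0 P f2 c eps : R) (b w D X Y : R[i]) :
  1 <= B -> B^-1 <= sg <= B -> `|Y0| <= B -> 1 <= P -> 0 < f2 ->
  0 <= c -> 0 <= eps -> 2 * (c * eps) <= 1 -> D != 0 ->
  b * X = w * Y ->
  cabs (X - D * sg%:C) <= c * eps * cabs (D * sg%:C) ->
  cabs (Y - Y0%:C) <= c * eps -> `|P - sg * Y0| <= c * eps ->
  `|f2 - sg ^+ 2| <= c * eps ->
  exists r, cabs r <= 12 * B ^+ 4 * c * eps /\
    b = (P / f2)%:C * (w / D) * (1 + r).
Proof.
move=> B1 /andP[sB1 sB2] YB P1 f20 c0 e0 small D0 bX hX hY hP hf.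
have B0 : 0 < B by lra.
have sg0 : 0 < sg by apply: lt_le_trans sB1; rewrite invr_gt0.
have D_gt0 : 0 < cabs D by rewrite cabs_gt0.
set ce := c * eps in small hX hY hP hf.
have ce0 : 0 <= ce by rewrite mulr_ge0.
have DX : cabs D <= 2 * B * cabs X.
  have h1 := cabsB X (X - D * sg%:C).
  rewrite opprB addrCA subrr addr0 in h1.
  have h2 : cabs (D * sg%:C) = cabs D * sg by rewrite cabsM cabs_real gtr0_norm.
  rewrite h2 in h1 hX.
  have h3 : cabs D <= B * (cabs D * sg).
    have : 1 <= B * sg by rewrite mulrC -ler_pdivrMr // div1r.
    by move=> h; have := ler_wpM2l (ltW D_gt0) h; lra.
  have h4 : 2 * ce * (cabs D * sg) <= cabs D * sg.
    by rewrite ger_pMl ?mulr_gt0.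
  have h5 : cabs D * sg <= 2 * cabs X by lra.
  have := ler_wpM2l (ltW B0) h5; lra.
have X0 : X != 0.
  by rewrite -cabs_gt0; move: (lt_le_trans D_gt0 DX); rewrite pmulr_rgt0 // mulr_gt0.
have Pc : P%:C != 0 :> R[i] by rewrite eq_complex /= eqxx andbT gt_eqF //; lra.
have fc : f2%:C != 0 :> R[i] by rewrite eq_complex /= eqxx andbT gt_eqF.
exists (f2%:C * Y * D / (P%:C * X) - 1); split; last first.
  have -> : b = w * Y / X by rewrite -bX mulfK.
  rewrite rmorphM /= fmorphV /=; field.
  by rewrite Pc X0 fc D0.
have -> : f2%:C * Y * D / (P%:C * X) - 1 =
   (D * ((f2%:C - sg%:C ^+ 2) * Y + sg%:C ^+ 2 * (Y - Y0%:C) + sg%:C * (sg%:C * Y0%:C - P%:C))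
     - P%:C * (X - D * sg%:C)) / (P%:C * X).
  by field; rewrite Pc X0.
have PB : P <= 2 * B ^+ 2.
  have h1 : `|P| <= `|P - sg * Y0| + `|sg * Y0|.
    by rewrite -{1}[P](subrK (sg * Y0)) ler_normD.
  have h2 : `|sg * Y0| <= B * B by rewrite normrM gtr0_norm //; apply: ler_pM => //; exact: ltW.
  have h3 := ler_norm P.
  have : 1 <= B ^+ 2 by rewrite exprn_ege1.
  rewrite expr2 in h2 *; lra.
rewrite cabsM cabsV cabsM [cabs P%:C]cabs_real gtr0_norm; last by lra.
have X_gt0 : 0 < cabs X by rewrite cabs_gt0.
rewrite ler_pdivrMr ?mulr_gt0 //; last by lra.
have YB2 : cabs Y <= 2 * B.
  have := cabsD (Y - Y0%:C) Y0%:C; rewrite subrK cabs_real; lra.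
have t1 : cabs ((f2%:C - sg%:C ^+ 2) * Y) <= ce * (2 * B).
  have -> : f2%:C - sg%:C ^+ 2 = (f2 - sg ^+ 2)%:C by rewrite rmorphB rmorphXn.
  by rewrite cabsM cabs_real; apply: ler_pM; rewrite ?cabs_ge0.
have s2 : cabs (sg%:C ^+ 2) <= B ^+ 2.
  rewrite cabsX cabs_real gtr0_norm // lerXn2r ?nnegrE //; exact: ltW.
have t2 : cabs (sg%:C ^+ 2 * (Y - Y0%:C)) <= B ^+ 2 * ce.
  by rewrite cabsM; apply: ler_pM; rewrite ?cabs_ge0.
have t3 : cabs (sg%:C * (sg%:C * Y0%:C - P%:C)) <= B * ce.
  have -> : sg%:C * Y0%:C - P%:C = (sg * Y0 - P)%:C by rewrite rmorphB rmorphM.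
  rewrite cabsM !cabs_real gtr0_norm // distrC.
  by apply: ler_pM => //; exact: ltW.
have t4 : cabs (P%:C * (X - D * sg%:C)) <= 2 * B ^+ 2 * (ce * (cabs D * B)).
  rewrite cabsM cabs_real gtr0_norm; last by lra.
  apply: ler_pM; rewrite ?cabs_ge0 //; first by lra.
  apply: le_trans hX _; rewrite ler_wpM2l // cabsM cabs_real gtr0_norm //.
  by rewrite ler_wpM2l // ltW.
have t5 : cabs (D * ((f2%:C - sg%:C ^+ 2) * Y + sg%:C ^+ 2 * (Y - Y0%:C) + sg%:C * (sg%:C * Y0%:C - P%:C)))
   <= cabs D * (ce * (2 * B) + B ^+ 2 * ce + B * ce).
  rewrite cabsM ler_wpM2l ?(ltW D_gt0) //.
  apply: le_trans (cabsD _ _) _; apply: lerD => //.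
  by apply: le_trans (cabsD _ _) _; apply: lerD.
apply: le_trans (cabsB _ _) _; apply: le_trans (lerD t5 t4) _.
have b1 : B <= B ^+ 3 by rewrite -{1}[B]expr1 ler_weXn2l.
have b2 : B ^+ 2 <= B ^+ 3 by rewrite ler_weXn2l.
have ceD : 0 <= ce * cabs D by rewrite mulr_ge0 // ltW.
have q1 := ler_wpM2l ceD b1; have q2 := ler_wpM2l ceD b2.
apply: (@le_trans _ _ (6 * B ^+ 3 * (ce * cabs D))); first by lra.
have -> : 12 * B ^+ 4 * c * eps * (P * cabs X) = 12 * B ^+ 4 * ce * (P * cabs X).
  by rewrite /ce; ring.
have B3 : 0 <= B ^+ 3 by rewrite exprn_ge0 // ltW.
have q3 : cabs X <= P * cabs X by rewrite ler_peMl // ltW.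
have q4 : cabs D <= 2 * B * (P * cabs X).
  by apply: le_trans DX _; rewrite ler_wpM2l // mulr_ge0 // ltW.
have q5 := ler_wpM2l (mulr_ge0 B3 ce0) q4.
lra.
Qed.

Section TestAgainstLeft.
Variables (R : realType) (N : nat) (B : R) (v mm : 'I_N -> R) (l : 'I_N -> R[i]).
Variable E2 : R.
Hypotheses (N_gt0 : (0 < N)%N) (B_ge1 : 1 <= B).
Hypothesis v_bnd : forall j, 0 < v j <= B.
Hypothesis mm_bnd : forall j, 0 < mm j <= B.
Hypothesis v_norm : mean (fun j => v j ^+ 2) = 1.
Hypothesis l_le : forall j, cabs (l j - (v j)%:C) <= E2.
Hypothesis E2_le : E2 <= B.

Let cv_le j : cabs (v j)%:C <= B.
Proof. by case/andP: (v_bnd j) => h1 h2; rewrite cabs_real gtr0_norm. Qed.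

Let E2_ge0 : 0 <= E2.
Proof. by apply: le_trans (l_le (Ordinal N_gt0)); exact: cabs_ge0. Qed.

Let l_B j : cabs (l j) <= 2 * B.
Proof.
have -> : l j = (l j - (v j)%:C) + (v j)%:C by rewrite subrK.
apply: le_trans (cabsD _ _) _; have := l_le j; have := cv_le j; have := E2_le; lra.
Qed.

Let B0 : 0 <= B. Proof. exact: le_trans B_ge1. Qed.

Lemma test_direction (x : 'I_N -> R[i]) D E1 :
  (forall j, cabs (x j - D * (v j)%:C) <= E1 * cabs D) ->
  cabs (mean (fun j => l j * x j) - D) <= (2 * B * E1 + E2 * B) * cabs D.
Proof.
move=> hx.
have vv : mean (fun k => (v k)%:C * (v k)%:C) = 1 :> R[i].
  rewrite (eq_mean (y := fun k => (v k ^+ 2)%:C)) ?mean_complex ?v_norm //.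
  by move=> k; rewrite -rmorphM expr2.
have -> : mean (fun j => l j * x j) - D =
  mean (fun j => l j * (x j - D * (v j)%:C)) + D * mean (fun j => (l j - (v j)%:C) * (v j)%:C).
  rewrite -[X in _ - X]mulr1 -vv -!meanZ -meanB -meanD.
  by apply: eq_mean => j; ring.
apply: le_trans (cabsD _ _) _; rewrite mulrDl; apply: lerD.
  by rewrite -mulrA; apply: mean_prod_le => //; rewrite mulr_ge0.
rewrite cabsM mulrC ler_wpM2r ?cabs_ge0 //.
by apply: mean_prod_le.
Qed.

Lemma test_source (q : 'I_N -> R[i]) E3 :
  (forall j, cabs (q j - (mm j)%:C) <= E3) ->
  cabs (mean (fun j => l j * q j) - (mean (fun j => v j * mm j))%:C) <=
    2 * B * E3 + E2 * B.
Proof.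
move=> hq.
rewrite -mean_complex -meanB.
rewrite (eq_mean (y := fun k => l k * (q k - (mm k)%:C) + (l k - (v k)%:C) * (mm k)%:C)); last first.
  by move=> k; rewrite rmorphM /=; ring.
rewrite meanD; apply: le_trans (cabsD _ _) _; apply: lerD.
  by apply: mean_prod_le => //; rewrite mulr_ge0.
apply: mean_prod_le => // k; case/andP: (mm_bnd k) => h1 h2.
by rewrite cabs_real gtr0_norm.
Qed.

End TestAgainstLeft.

(** * Both expansions in symmetrized form *)

Section Expansion.
Variables (R : realType) (N : nat) (L B : R) (S : 'I_N -> 'I_N -> R).
Variables (v : 'I_N -> R) (lam e : R) (m m' : 'I_N -> R[i]).
Variables (f : 'I_N -> R) (rho ka : R).
Local Notation mm := (fun j => cabs (m j)).
Local Notation F := (fun j k => cabs (m j) * S j k * cabs (m k)).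
Hypotheses (N_gt0 : (0 < N)%N) (L_ge1 : 1 <= L).
Hypothesis F_sym : forall j k, F j k = F k j.
Hypothesis F_bnd : forall j k, L^-1 / N%:R <= F j k <= L / N%:R.
Hypothesis v_gt0 : forall j, 0 < v j.
Hypothesis v_eig : forall j, \sum_k F j k * v k = lam * v j.
Hypothesis v_norm : mean (fun j => v j ^+ 2) = 1.
Hypothesis lam_bnd : 2^-1 <= lam <= 1.
Hypothesis B_E : B = 84 * L ^+ 5.
Hypothesis e_gt0 : 0 < e.
Hypothesis e_small : 96 * B ^+ 2 * L ^+ 2 * e <= 1.
Hypothesis m_bnd : forall j, L^-1 <= cabs (m j) <= L.
Hypothesis m'_bnd : forall j, L^-1 <= cabs (m' j) <= L.
Hypothesis f_bnd : forall j, L^-1 <= f j <= L.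
Hypothesis rho_gt0 : 0 < rho.
Hypothesis ka_ge0 : 0 <= ka.
Hypothesis f_E : forall j, complex.Im (m j) = rho * (f j * cabs (m j)).
Hypothesis m'_im : forall j, 0 <= complex.Im (m' j).
Hypothesis f_eq : forall j, f j - \sum_k F j k * f k = ka * mm j.
Hypothesis lam_ka : 1 - lam <= L ^+ 2 * ka.
Hypothesis f_pi : mean (fun j => f j * cabs (m j)) = pi.

Let tau := rho + ka.
Let tau_gt0 : 0 < tau. Proof. by rewrite ltr_pwDl. Qed.
Let L_gt0 : 0 < L. Proof. exact: lt_le_trans L_ge1. Qed.
Let B84 : 84 <= B. Proof. exact: const_ge84 L_ge1 B_E. Qed.
Let B_ge1 : 1 <= B. Proof. have := B84; lra. Qed.
Let B_gt0 : 0 < B. Proof. exact: lt_le_trans B_ge1. Qed.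
Let B_ge0 : 0 <= B. Proof. exact: ltW. Qed.
Let Bn0 n : 0 <= B ^+ n. Proof. exact: exprn_ge0. Qed.
Let LB84 : 84 * L <= B. Proof. exact: L_le_const L_ge1 B_E. Qed.
Let LB : L <= B. Proof. have := LB84; have := L_gt0; lra. Qed.
Let pw n k x : (n <= k)%N -> 0 <= x -> B ^+ n * x <= B ^+ k * x.
Proof. by move=> h x0; rewrite ler_wpM2r // ler_weXn2l. Qed.
Let pwS n x : 0 <= x -> 84 * (B ^+ n * x) <= B ^+ n.+1 * x.
Proof.
move=> x0; have -> : B ^+ n.+1 * x = B * (B ^+ n * x) by rewrite exprS; ring.
by rewrite ler_wpM2r // mulr_ge0.
Qed.

Let m_neq0 j : m j != 0. Proof. exact: (cabs_bounded_neq0 L_ge1 m_bnd). Qed.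
Let mm_gt0 j : 0 < cabs (m j). Proof. by rewrite cabs_gt0. Qed.
Let mm_B j : 0 < cabs (m j) <= B.
Proof. by rewrite mm_gt0; apply: le_trans LB; case/andP: (m_bnd j). Qed.
Let mmC j : (cabs (m j))%:C != 0 :> R[i].
Proof. by rewrite eq_complex /= eqxx andbT gt_eqF. Qed.
Let v_B j : 0 < v j <= B.
Proof.
by rewrite v_gt0; exact: (perron_const_le N_gt0 L_ge1 F_bnd v_gt0 v_eig v_norm lam_bnd B_E).
Qed.
Let f_gt0 j : 0 < f j.
Proof. by case/andP: (f_bnd j) => + _; apply: lt_le_trans; rewrite invr_gt0. Qed.
Let f_B j : f j <= B.
Proof. by apply: le_trans LB; case/andP: (f_bnd j). Qed.

Let e_le1 : e <= 1.
Proof.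
apply: le_trans e_small; rewrite ler_peMl ?(ltW e_gt0) //.
have := mulr_ege1 (exprn_ege1 2 B_ge1) (exprn_ege1 2 L_ge1); lra.
Qed.

(* Conjugation by [|m|] turns [1 - a b S] into [1 - U F] with [F = |m| S |m|] and [U = U_of a b]. *)
Definition U_of (a b : 'I_N -> R[i]) j : R[i] := a j * b j / (cabs (m j))%:C ^+ 2.
Definition q_of (a b : 'I_N -> R[i]) j : R[i] := a j * b j / (cabs (m j))%:C.

(** The factor [a] is [m] for the first expansion and its conjugate for the second; both differences
    solve an equation of this form. *)
Lemma rescaled_equation (a g : 'I_N -> R[i]) w :
  (forall j, g j = a j * m' j * (w + \sum_k (S j k)%:C * g k)) ->
  forall j, MU F (U_of a m') (fun k => g k / (cabs (m k))%:C) j = w * q_of a m' j.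
Proof.
move=> hg j; rewrite /MU /U_of /q_of.
have -> : Fapp F (fun k => g k / (cabs (m k))%:C) j =
    (cabs (m j))%:C * \sum_k (S j k)%:C * g k.
  rewrite /Fapp mulr_sumr; apply: eq_bigr => k _.
  by rewrite !rmorphM /=; field; exact: mmC.
by rewrite {1}hg; field; exact: mmC.
Qed.

Let mmE j : (cabs (m j))%:C ^+ 2 = m j * conjc (m j).
Proof.
rewrite -rmorphXn cabs_sqr; case: (m j) => a b.
by apply/eqP; rewrite eq_complex /=; apply/andP; split; apply/eqP; ring.
Qed.

Local Notation U0 := (U_of m m).

(** [U0] is [m] over its conjugate, so its distance to 1 is twice [Im m / |m|], that is
    [2 * rho * f]. *)
Let U0_1 j : cabs (U0 j - 1) <= 2 * B * rho.
Proof.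
have cm0 : conjc (m j) != 0 by rewrite conjc_eq0.
have -> : U0 j - 1 = (m j - conjc (m j)) / conjc (m j).
  by rewrite /U_of mmE; field; rewrite cm0 m_neq0.
rewrite cabsM cabsV cabs_conj cabsC cabs_diff_conj f_E.
rewrite normrM !gtr0_norm ?mulr_gt0 //.
have -> : 2 * (rho * (f j * cabs (m j))) / cabs (m j) = 2 * rho * f j.
  by field; rewrite gt_eqF.
have := ler_wpM2l (ltW rho_gt0) (f_B j); lra.
Qed.

Let sg := mean (fun k => v k * f k).
Let sg_bnd : B^-1 <= sg <= B.
Proof. exact: (overlap_bnd N_gt0 L_ge1 F_bnd v_gt0 v_eig v_norm lam_bnd B_E f_bnd). Qed.
Let sg_gt0 : 0 < sg.
Proof. by case/andP: sg_bnd => + _; apply: lt_le_trans; rewrite invr_gt0. Qed.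

Let f_dir j : `|f j - sg * v j| <= 2 * B ^+ 5 * ka.
Proof.
exact: (perron_direction N_gt0 L_ge1 F_sym F_bnd v_gt0 v_eig v_norm lam_bnd B_E
  f_bnd m_bnd ka_ge0 f_eq lam_ka).
Qed.

Hypothesis tau_small : B ^+ 30 * tau <= e.
Let tau_small1 : B ^+ 30 * tau <= 1. Proof. exact: le_trans tau_small e_le1. Qed.

Let lam_B : 1 - lam <= B ^+ 2 * ka.
Proof.
apply: le_trans lam_ka _; rewrite ler_wpM2r // lerXn2r ?nnegrE //.
exact: ltW.
Qed.

Let U0_dist : [/\ forall j, cabs (U0 j - 1) <= B ^+ 2 * tau, 1 - lam <= B ^+ 2 * tau &
  B ^+ 4 * (B ^+ 2 * tau) <= e].
Proof.
have t0 := ltW tau_gt0.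
have d1 j : cabs (U0 j - 1) <= B ^+ 2 * tau.
  apply: le_trans (U0_1 j) _.
  have h : B * rho <= B * tau by rewrite ler_wpM2l // lerDl.
  have := @pwS 1 tau t0; rewrite expr1; have := mulr_ge0 B_ge0 t0; lra.
have d2 : 1 - lam <= B ^+ 2 * tau.
  by apply: le_trans lam_B _; rewrite ler_wpM2l // lerDr ltW.
have d3 : B ^+ 4 * (B ^+ 2 * tau) <= e.
  have := @pow_small _ B tau e 6 B84 t0 tau_small isT.
  have -> : B ^+ 4 * (B ^+ 2 * tau) = B ^+ 6 * tau by ring.
  have := mulr_ge0 (Bn0 6) t0; lra.
by [].
Qed.

Lemma base_eigenpair : exists (b : R[i]) (r : 'I_N -> R[i]),
  [/\ cabs b <= B ^+ 6 * tau /\ (forall j, U0 j != 0),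
      (forall j, cabs (r j - (v j)%:C) <= B ^+ 8 * tau) /\
      (forall j, cabs (r j / U0 j - (v j)%:C) <= B ^+ 9 * tau),
      mean (fun k => (v k)%:C * r k) = 1,
      forall j, MU F U0 r j = b * r j &
      forall w u, cabs w <= e -> (forall j, MU F U0 u j = w * u j) ->
        (exists j, u j != 0) ->
        w = b /\ forall j, u j = mean (fun k => (v k)%:C * u k) * r j].
Proof.
have [d1 d2 d3] := U0_dist.
have [b [r [[h1 h1'] [h2 h3] h4 h5 h6]]] := eigenpair N_gt0 L_ge1 F_sym F_bnd v_gt0 v_eig
  v_norm lam_bnd B_E e_gt0 e_small d1 d2 d3.
have e1 : B ^+ 4 * (B ^+ 2 * tau) = B ^+ 6 * tau by ring.
have e2 : B ^+ 6 * (B ^+ 2 * tau) = B ^+ 8 * tau by ring.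
have e3 : B ^+ 7 * (B ^+ 2 * tau) = B ^+ 9 * tau by ring.
rewrite e1 in h1; rewrite e2 in h2; rewrite e3 in h3.
by exists b, r.
Qed.

Variables (b0 : R[i]) (r0 : 'I_N -> R[i]) (G : R) (w : R[i]).
Let l0 j := r0 j / U0 j.
Hypothesis b0_le : cabs b0 <= B ^+ 6 * tau.
Hypothesis U0_neq0 : forall j, U0 j != 0.
Hypothesis r0_le : forall j, cabs (r0 j - (v j)%:C) <= B ^+ 8 * tau.
Hypothesis l0_le : forall j, cabs (r0 j / U0 j - (v j)%:C) <= B ^+ 9 * tau.
Hypothesis v_r0 : mean (fun k => (v k)%:C * r0 k) = 1.
Hypothesis r0_eig : forall j, MU F U0 r0 j = b0 * r0 j.
Let gt j := (m' j - m j) / (cabs (m j))%:C.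
Hypothesis diff_eq : forall j, m' j - m j =
  m j * m' j * (w + \sum_k (S j k)%:C * (m' k - m k)).
Hypothesis G_bnd : forall j, cabs (gt j) <= G.
Hypothesis G_att : exists j, G = cabs (gt j).
Hypothesis G_small : B ^+ 30 * G <= e.

Let G_ge0 : 0 <= G. Proof. by case: G_att => j ->; exact: cabs_ge0. Qed.
Let tau_ge0 : 0 <= tau. Proof. exact: ltW. Qed.
Let st n (hn : (n <= 29)%N) := pow_small B84 tau_ge0 tau_small hn.
Let sG n (hn : (n <= 29)%N) := pow_small B84 G_ge0 G_small hn.
Local Notation U1 := (U_of m m').
Local Notation q1 := (q_of m m').

Let F_le u X : (forall j, cabs (u j) <= X) -> forall j, cabs (Fapp F u j) <= B * X.
Proof.
move=> hu j; have X0 : 0 <= X by apply: le_trans (hu j); exact: cabs_ge0.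
apply: le_trans (cabs_Fapp N_gt0 L_ge1 F_bnd hu j) _.
by rewrite ler_wpM2r.
Qed.

Let inv0 u X : (forall j, cabs (MU F U0 u j + Jop v u j) <= X) ->
  forall j, cabs (u j) <= B * X.
Proof.
move=> hX; rewrite B_E; have [d1 _ _] := U0_dist.
have w0 : cabs (0 : R[i]) <= 0 by rewrite cabs0.
apply: (shifted_inverse N_gt0 L_ge1 F_sym F_bnd v_gt0 v_eig v_norm lam_bnd d1 w0).
  rewrite addr0 -B_E.
  have h : B ^+ 2 * tau * L * B <= B ^+ 4 * tau.
    have -> : B ^+ 4 * tau = B ^+ 2 * tau * B * B by ring.
    rewrite ler_wpM2r // ler_wpM2l // mulr_ge0 //.
  have := @st 4 isT; have := mulr_ge0 (Bn0 4) tau_ge0; have := e_le1; lra.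
by move=> j; rewrite mul0r subr0.
Qed.

Lemma base_overlap_neq0 : mean (fun j => r0 j / U0 j * r0 j) != 0.
Proof.
exact: (@left_right_overlap_neq0 R N B v r0 l0 tau N_gt0 B84 v_B r0_le l0_le v_r0 tau_ge0 tau_small1).
Qed.

Lemma base_inverse u X :
  (forall j, cabs (MU F U0 u j + (1 - b0) *
     (r0 j * (mean (fun k => r0 k / U0 k * u k) / mean (fun k => r0 k / U0 k * r0 k)))) <= X) ->
  forall j, cabs (u j) <= 2 * B * X.
Proof.
exact: (@deflated_inverse R N B F v U0 b0 r0 l0 tau N_gt0 B84 v_B inv0 b0_le r0_le l0_le v_r0 tau_ge0 tau_small1).
Qed.

Let s := mean (fun j => l0 j * gt j) / mean (fun j => l0 j * (v j)%:C).
Let gt_eq j : MU F U1 gt j = w * q1 j.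
Proof. exact: (rescaled_equation diff_eq). Qed.

Let U_diff j : cabs (U1 j - U0 j) <= cabs (gt j).
Proof.
have -> : U1 j - U0 j = m j / (cabs (m j))%:C * gt j.
  by rewrite /U_of /gt; field; exact: mmC.
rewrite cabsM (cabsM (m j)) cabsV cabs_real gtr0_norm // mulfV ?gt_eqF //.
by rewrite mul1r.
Qed.

Let q_le (a : 'I_N -> R[i]) j : cabs (a j) = cabs (m j) -> cabs (q_of a m' j) <= B.
Proof.
move=> ha; rewrite /q_of cabsM cabsM cabsV cabs_real gtr0_norm // ha mulrAC.
rewrite mulfV ?gt_eqF // mul1r; apply: le_trans LB.
by case/andP: (m'_bnd j).
Qed.

Let q1_diff j : cabs (q1 j - (cabs (m j))%:C) <= B ^+ 3 * (tau + G).
Proof.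
have -> : q1 j - (cabs (m j))%:C = (cabs (m j))%:C * ((U0 j - 1) + m j / (cabs (m j))%:C * gt j).
  by rewrite /q_of /U_of /gt; field; exact: mmC.
rewrite cabsM cabs_real gtr0_norm //.
have h : cabs (U0 j - 1 + m j / (cabs (m j))%:C * gt j) <= B ^+ 2 * (tau + G).
  apply: le_trans (cabsD _ _) _.
  rewrite [cabs (_ * gt j)]cabsM (cabsM (m j)) cabsV cabs_real gtr0_norm // mulfV ?gt_eqF // mul1r.
  have [d1 _ _] := U0_dist; have := d1 j; have := G_bnd j.
  have : G <= B ^+ 2 * G by rewrite ler_peMl // exprn_ege1.
  lra.
have -> : B ^+ 3 * (tau + G) = B * (B ^+ 2 * (tau + G)) by ring.
by apply: ler_pM; rewrite ?cabs_ge0 ?(ltW (mm_gt0 j)) //; case/andP: (mm_B j).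
Qed.

Let v_mm : B^-1 <= mean (fun j => v j * cabs (m j)).
Proof. by case/andP: (overlap_bnd N_gt0 L_ge1 F_bnd v_gt0 v_eig v_norm lam_bnd B_E m_bnd). Qed.

Let l0_eig x := left_eigenvector F_sym U0_neq0 r0_eig x.
Let G_small1 : B ^+ 30 * G <= 1. Proof. exact: le_trans G_small e_le1. Qed.

Let A2_0 : mean (fun j => l0 j * (v j)%:C) != 0.
Proof.
exact: (left_overlap_neq0 N_gt0 B84 v_B v_norm l0_le tau_ge0 tau_small1).
Qed.

Let s_upper : cabs s <= 4 * B * G.
Proof.
exact: (amplitude_upper N_gt0 B84 v_B v_norm l0_le G_bnd tau_ge0 tau_small1).
Qed.

Let s_lower : G <= 4 * B * cabs s.
Proof.
exact: (amplitude_lower N_gt0 B84 F_le v_B v_norm inv0 b0_le r0_le l0_le v_r0 r0_eig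
  l0_eig gt_eq U_diff (fun j => @q_le m j erefl) q1_diff v_mm G_bnd G_att tau_ge0 tau_small1 G_small1).
Qed.

Let s_exp j : cabs (gt j - s * (v j)%:C) <= B ^+ 12 * (cabs s * (cabs s + tau)).
Proof.
exact: (amplitude_expansion N_gt0 B84 F_le v_B v_norm inv0 b0_le r0_le l0_le v_r0 r0_eig
  l0_eig gt_eq U_diff (fun j => @q_le m j erefl) q1_diff v_mm G_bnd G_att tau_ge0 tau_small1 G_small1).
Qed.

Let A2 := mean (fun j => l0 j * (v j)%:C).
(* The matrix-free form of [xi], see [xi_amplitude]. *)
Definition amplitude : R[i] :=
  mean (fun j => r0 j / U0 j * ((m' j - m j) / (cabs (m j))%:C)) /
  (sg%:C * mean (fun j => r0 j / U0 j * (v j)%:C)).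
Let xi := amplitude.
Let err := cabs xi + tau.
Let sgC : sg%:C != 0 :> R[i]. Proof. by rewrite eq_complex /= eqxx andbT gt_eqF. Qed.

Let s_xi : s = xi * sg%:C.
Proof. by rewrite /s /xi /amplitude; field; rewrite sgC andbT; exact: A2_0. Qed.

Let cabs_s : cabs s = cabs xi * sg.
Proof. by rewrite s_xi cabsM cabs_real gtr0_norm. Qed.

Let s_le_xi : cabs s <= B * cabs xi.
Proof.
by rewrite cabs_s mulrC ler_wpM2r ?cabs_ge0 //; case/andP: sg_bnd.
Qed.

Let Bsg : 1 <= B * sg.
Proof. by rewrite mulrC -ler_pdivrMr // div1r; case/andP: sg_bnd. Qed.

Let xi_le_s : cabs xi <= B * cabs s.
Proof. rewrite cabs_s; have := ler_wpM2l (cabs_ge0 xi) Bsg; lra. Qed.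

Let err_ge0 : 0 <= err. Proof. by rewrite addr_ge0 ?cabs_ge0. Qed.

Let err_small n : (n <= 27)%N -> 84 * (B ^+ n * err) <= 5 * e.
Proof.
move=> hn; have h1 := @sG n.+2 hn; have h2 := @st n (leq_trans hn (isT : (27 <= 29)%N)).
have h3 : B ^+ n * cabs xi <= 4 * (B ^+ n.+2 * G).
  have -> : 4 * (B ^+ n.+2 * G) = B ^+ n * (B * (4 * B * G)) by rewrite !exprS; ring.
  by rewrite ler_wpM2l //; apply: le_trans xi_le_s _; rewrite ler_wpM2l.
rewrite /err mulrDr; lra.
Qed.

Let err_pos n : 0 <= B ^+ n * err. Proof. exact: mulr_ge0. Qed.

(** The common core: [x] is the rescaled difference, [om] the difference of the spectral parameters,
    [D] the denominator. Comparison with the eigenvalue of [eigenpair] places the minimal [b] in the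
    disc of radius [e], where that eigenvalue is the only one; pairing with its left eigenvector
    then feeds [eigenvalue_ratio]. *)
Let half (U q x : 'I_N -> R[i]) (om D b : R[i]) :
  (forall j, cabs (U j - 1) <= B ^+ 3 * err) ->
  (forall j, cabs (q j - (cabs (m j))%:C) <= B ^+ 7 * err) ->
  (forall j, MU F U x j = om * q j) ->
  (forall j, cabs (x j - D * sg%:C * (v j)%:C) <= B ^+ 20 * err * cabs (D * sg%:C)) ->
  D != 0 ->
  (exists u, (exists j, u j != 0) /\ forall j, MU F U u j = b * u j) ->
  (forall b' u, (exists j, u j != 0) -> (forall j, MU F U u j = b' * u j) -> cabs b <= cabs b') ->
  exists r, cabs r <= 12 * B ^+ 4 * B ^+ 22 * err /\
    b = (pi / mean (fun j => f j * f j))%:C * (om / D) * (1 + r).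
Proof.
move=> hU hq hx hxv D0 [u [u0 hu]] bmin.
have ka_err : ka <= err by rewrite /err /tau addrA lerDr addr_ge0 ?cabs_ge0 // ltW.
have d2 : 1 - lam <= B ^+ 3 * err.
  apply: le_trans lam_B _; apply: ler_pM => //; by rewrite ler_weXn2l.
have d3 : B ^+ 4 * (B ^+ 3 * err) <= e.
  have -> : B ^+ 4 * (B ^+ 3 * err) = B ^+ 7 * err by ring.
  have := @err_small 7 isT; have := err_pos 7; lra.
have [b1 [r1 [[h1 h1'] [h2 h3] h4 h5 h6]]] := eigenpair N_gt0 L_ge1 F_sym F_bnd v_gt0 v_eig
  v_norm lam_bnd B_E e_gt0 e_small hU d2 d3.
have r1_0 : exists j, r1 j != 0.
  apply: contrapT => H; have r10 j : r1 j = 0.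
    by apply/eqP; apply: contrapT => /negP hj; apply: H; exists j.
  move: h4; rewrite (eq_mean (y := fun k => 0 * r1 k)); last by move=> k; rewrite r10 !mulr0.
  by rewrite meanZ mul0r => /eqP; rewrite eq_sym oner_eq0.
have be : cabs b <= e by apply: le_trans (bmin _ _ r1_0 h5) _; exact: le_trans h1 d3.
have [bb1 _] := h6 _ _ be hu u0; rewrite bb1.
pose l1 j := r1 j / U j.
pose X := mean (fun j => l1 j * x j); pose Y := mean (fun j => l1 j * q j).
pose Y0 := mean (fun j => v j * cabs (m j)).
have bX : b1 * X = om * Y.
  rewrite /X -(left_eigenvector F_sym h1' h5) -meanZ.
  by apply: eq_mean => j; rewrite hx /l1; ring.
have e10 : B ^+ 7 * (B ^+ 3 * err) = B ^+ 10 * err by ring.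
rewrite e10 in h3.
have E2B : B ^+ 10 * err <= B.
  have := @err_small 10 isT; have := B_ge1; have := e_le1; lra.
have c11 : B ^+ 11 * err <= B ^+ 21 * err by exact: pw.
have c8 : B ^+ 8 * err <= B ^+ 21 * err by exact: pw.
have c6 : B ^+ 6 * ka <= B ^+ 21 * err by apply: ler_pM => //; rewrite ler_weXn2l.
have c22 : 84 * (B ^+ 21 * err) <= B ^+ 22 * err by exact: pwS.
have p21 := err_pos 21.
have f_ge j : B^-1 <= f j.
  apply: (@le_trans _ _ L^-1); last by case/andP: (f_bnd j).
  by rewrite lef_pV2 ?posrE.
have ff0 : 0 < mean (fun j => f j * f j) by apply: mean_gt0 => // j; rewrite mulr_gt0.
apply: (@eigenvalue_ratio R B sg Y0 pi (mean (fun j => f j * f j)) (B ^+ 22) err b1 om D X Y) => //.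
- have /andP[h7 h8] := overlap_bnd N_gt0 L_ge1 F_bnd v_gt0 v_eig v_norm lam_bnd B_E m_bnd.
  by rewrite ger0_norm //; apply: le_trans h7; rewrite invr_ge0.
- by apply: le_trans (pi_ge2 R); lra.
- have := @err_small 22 isT; have := e_le1; have := err_pos 22; lra.
- apply: le_trans (test_direction N_gt0 B_ge1 v_B v_norm h3 E2B hxv) _.
  rewrite ler_wpM2r ?cabs_ge0 //.
  have -> : 2 * B * (B ^+ 20 * err) + B ^+ 10 * err * B = 2 * (B ^+ 21 * err) + B ^+ 11 * err by ring.
  lra.
- apply: le_trans (test_source N_gt0 B_ge1 v_B mm_B h3 E2B hq) _.
  have -> : 2 * B * (B ^+ 7 * err) + B ^+ 10 * err * B = 2 * (B ^+ 8 * err) + B ^+ 11 * err by ring.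
  lra.
(* [pi] is [<f, |m|>], so the gap is [f - sg v] tested against [|m|]; the last goal is the same with
   [f] as test function. *)
- have -> : pi - sg * Y0 = mean (fun j => (f j - sg * v j) * cabs (m j)).
    rewrite -f_pi /Y0 -meanZ -meanB; apply: eq_mean => j; ring.
  apply: le_trans (ler_norm_mean N_gt0 _) _; apply: mean_le => // j.
  rewrite normrM [`|cabs _|]ger0_norm ?cabs_ge0 //.
  have := ler_pM (normr_ge0 _) (cabs_ge0 (m j)) (f_dir j) (proj2 (andP (mm_B j))).
  lra.
- have -> : mean (fun j => f j * f j) - sg ^+ 2 = mean (fun j => (f j - sg * v j) * f j).
    rewrite expr2 {2}/sg -meanZ -meanB; apply: eq_mean => j; ring.
  apply: le_trans (ler_norm_mean N_gt0 _) _; apply: mean_le => // j.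
  rewrite normrM [`|f j|]gtr0_norm //.
  have := ler_pM (normr_ge0 _) (ltW (f_gt0 j)) (f_dir j) (f_B j).
  lra.
Qed.

Let G_err : G <= 4 * (B ^+ 2 * cabs xi).
Proof.
apply: le_trans s_lower _; have := ler_wpM2l B_ge0 s_le_xi; lra.
Qed.

Let G_err3 : 2 * (B ^+ 2 * tau) + G <= B ^+ 3 * err.
Proof.
have h := pwS 2 err_ge0.
have E : B ^+ 2 * err = B ^+ 2 * cabs xi + B ^+ 2 * tau by rewrite -mulrDr.
rewrite E in h.
have := G_err; have := mulr_ge0 (Bn0 2) tau_ge0.
have := mulr_ge0 (Bn0 2) (cabs_ge0 xi); lra.
Qed.

Lemma expansion_same b : w != 0 ->
  (exists u, (exists j, u j != 0) /\ forall j, MU F U1 u j = b * u j) ->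
  (forall b' u, (exists j, u j != 0) -> (forall j, MU F U1 u j = b' * u j) -> cabs b <= cabs b') ->
  amplitude != 0 /\
  exists r, cabs r <= 12 * B ^+ 4 * B ^+ 22 * (cabs amplitude + (rho + ka)) /\
    b = (pi / mean (fun j => f j * f j))%:C * (w / amplitude) * (1 + r).
Proof.
move=> w0 hb bmin.
(* A vanishing amplitude would make [G] vanish by [s_lower], hence the difference of the solutions,
   and the equation would then read [w * q1 = 0] with both factors nonzero. *)
have xi0 : xi != 0.
  apply/eqP => xi0; have s0 : s = 0 by rewrite s_xi xi0 mul0r.
  have G0 : G = 0.
    by apply/le_anti; rewrite G_ge0 andbT; have := s_lower; rewrite s0 cabs0 mulr0.
  have gt0 j : gt j = 0.
    by apply/eqP; rewrite -cabs_eq0; apply/eqP/le_anti; rewrite cabs_ge0 andbT -G0.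
  pose j0 := Ordinal N_gt0.
  have := gt_eq j0; rewrite /MU /Fapp gt0 big1 ?mulr0 ?subr0 => [/esym/eqP|k _]; last by rewrite gt0 mulr0.
  rewrite mulf_eq0 (negPf w0) /= /q_of !mulf_eq0 invr_eq0 (negPf (mmC j0)) orbF.
  rewrite (negPf (m_neq0 j0)) /=; apply/negP.
  exact: (cabs_bounded_neq0 L_ge1 m'_bnd).
split => //.
have B2t : 0 <= B ^+ 2 * tau by rewrite mulr_ge0.
apply: (half _ _ gt_eq _ xi0 hb bmin) => j.
- have [d1 _ _] := U0_dist.
  have -> : U1 j - 1 = (U0 j - 1) + (U1 j - U0 j) by ring.
  apply: le_trans (cabsD _ _) _; have := d1 j; have := le_trans (U_diff j) (G_bnd j).
  have := G_err3; lra.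
- apply: le_trans (q1_diff j) _.
  have h : tau + G <= B ^+ 3 * err.
    apply: le_trans G_err3; rewrite lerD2r.
    have : tau <= B ^+ 2 * tau by rewrite ler_peMl // exprn_ege1.
    lra.
  apply: le_trans (ler_wpM2l (Bn0 3) h) _.
  by rewrite mulrA -exprD pw.
- rewrite -s_xi; apply: le_trans (s_exp j) _.
  rewrite mulrCA [cabs s * _]mulrC ler_wpM2r ?cabs_ge0 //.
  have h : cabs s + tau <= B * err.
    rewrite /err mulrDr; apply: lerD => //; by rewrite ler_peMl.
  apply: le_trans (ler_wpM2l (Bn0 12) h) _.
  by rewrite mulrA -exprSr pw.
Qed.

Local Notation U2 := (U_of (fun j => conjc (m j)) m').

Lemma expansion_conj b w' :
  (forall j, m' j - conjc (m j) =
    conjc (m j) * m' j * (w' + \sum_k (S j k)%:C * (m' k - conjc (m k)))) ->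
  (exists u, (exists j, u j != 0) /\ forall j, MU F U2 u j = b * u j) ->
  (forall b' u, (exists j, u j != 0) -> (forall j, MU F U2 u j = b' * u j) -> cabs b <= cabs b') ->
  amplitude + 2 * 'i%C * rho%:C != 0 /\
  exists r, cabs r <= 12 * B ^+ 4 * B ^+ 22 * (cabs amplitude + (rho + ka)) /\
    b = (pi / mean (fun j => f j * f j))%:C * (w' / (amplitude + 2 * 'i%C * rho%:C)) * (1 + r).
Proof.
move=> eq2 hb bmin; rewrite -/xi.
set D := xi + 2 * 'i%C * rho%:C.
pose x j := (m' j - conjc (m j)) / (cabs (m j))%:C.
have rho0 := ltW rho_gt0.
have xE j : x j = gt j + 2 * 'i%C * rho%:C * (f j)%:C.
  have h : m j - conjc (m j) = 2 * 'i%C * rho%:C * ((f j)%:C * (cabs (m j))%:C).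
    rewrite -!mulrA -!rmorphM -f_E.
    by case: (m j) => a b'; apply/eqP; rewrite eq_complex /=; apply/andP; split; apply/eqP; ring.
  have -> : x j = (m' j - m j + (m j - conjc (m j))) / (cabs (m j))%:C by rewrite /x; ring.
  by rewrite h /gt; field; exact: mmC.
have ci : cabs (2 * 'i%C * rho%:C) = 2 * rho.
  have -> : 2 * 'i%C * rho%:C = 'i%C * (2 * rho)%:C :> R[i].
    by rewrite rmorphM rmorph_nat; ring.
  by rewrite cabsM cabs_i mul1r cabs_real ger0_norm // mulr_ge0.
have x_near j : cabs (x j - D * sg%:C * (v j)%:C) <= B ^+ 14 * err * (cabs xi + rho).
  have -> : x j - D * sg%:C * (v j)%:C = (gt j - s * (v j)%:C) +
      2 * 'i%C * rho%:C * (f j - sg * v j)%:C.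
    have E : (f j - sg * v j)%:C = (f j)%:C - sg%:C * (v j)%:C.
      by rewrite rmorphB rmorphM.
    by rewrite xE /D s_xi E; ring.
  apply: le_trans (cabsD _ _) _.
  have t2 : cabs (2 * 'i%C * rho%:C * (f j - sg * v j)%:C) <= 2 * rho * (2 * B ^+ 5 * ka).
    by rewrite cabsM ci cabs_real ler_wpM2l // mulr_ge0.
  have t1 : cabs s * (cabs s + tau) <= B * cabs xi * (B * err).
    apply: ler_pM; rewrite ?cabs_ge0 ?addr_ge0 ?cabs_ge0 //.
    by rewrite /err mulrDr; apply: lerD => //; rewrite ler_peMl.
  have t3 := le_trans (s_exp j) (ler_wpM2l (Bn0 12) t1).
  have t4 : 2 * rho * (2 * B ^+ 5 * ka) <= B ^+ 14 * err * rho.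
    have -> : 2 * rho * (2 * B ^+ 5 * ka) = 4 * (B ^+ 5 * ka) * rho by ring.
    rewrite ler_wpM2r //.
    have k1 : B ^+ 5 * ka <= B ^+ 5 * err.
      rewrite ler_wpM2l // /err /tau addrA lerDr addr_ge0 ?cabs_ge0 //.
    have k2 := pwS 5 err_ge0; have k3 := @pw 6 14 err isT err_ge0.
    have := err_pos 5; lra.
  have e1 : B ^+ 12 * (B * cabs xi * (B * err)) = B ^+ 14 * err * cabs xi by ring.
  rewrite e1 in t3; rewrite mulrDr; lra.
(* The terms [xi] and [2 i rho] could cancel in [D]. The imaginary part of [x], where those of both
   solutions add, is at least [rho * f] and so bounds [rho] by a multiple of [|D|]. *)
have xiD : cabs xi <= cabs D + 2 * rho.
  have -> : xi = D - 2 * 'i%C * rho%:C by rewrite /D addrK.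
  by apply: le_trans (cabsB _ _) _; rewrite ci.
pose j0 := Ordinal N_gt0.
have rho_D : rho <= 2 * B ^+ 3 * cabs D.
  have h1 : rho * B^-1 <= cabs (x j0).
    apply: le_trans (cabs_Im _); apply: le_trans (ler_norm _).
    have -> : complex.Im (x j0) = (complex.Im (m' j0) + complex.Im (m j0)) / cabs (m j0).
      rewrite /x mulrC -fmorphV cImMr cImD cImN mulrC; congr (_ / _).
      by case: (m j0) => a b' /=; rewrite opprK.
    rewrite f_E mulrDl mulrA mulfK ?gt_eqF //.
    have h2 : 0 <= complex.Im (m' j0) / cabs (m j0) by rewrite divr_ge0 ?cabs_ge0.
    have h3 : rho * B^-1 <= rho * f j0.
      rewrite ler_wpM2l //; apply: (@le_trans _ _ L^-1); last by case/andP: (f_bnd j0).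
      by rewrite lef_pV2 ?posrE.
    lra.
  have h2 : cabs (x j0) <= cabs D * B ^+ 2 + B ^+ 14 * err * (cabs xi + rho).
    rewrite -[x j0](subrK (D * sg%:C * (v j0)%:C)).
    apply: le_trans (cabsD _ _) _; rewrite addrC; apply: lerD => //.
    rewrite cabsM cabsM !cabs_real !gtr0_norm // -mulrA ler_wpM2l ?cabs_ge0 //.
    rewrite expr2; apply: ler_pM => //; rewrite ?(ltW sg_gt0) ?(ltW (v_gt0 _)) //.
      by case/andP: sg_bnd.
    by case/andP: (v_B j0).
  have h3 := ler_wpM2l B_ge0 (le_trans h1 h2).
  have e1 : B * (rho * B^-1) = rho by field; rewrite gt_eqF.
  rewrite e1 mulrDr in h3.
  have e2 : B * (cabs D * B ^+ 2) = B ^+ 3 * cabs D by ring.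
  have e3 : B * (B ^+ 14 * err * (cabs xi + rho)) = B ^+ 15 * err * (cabs xi + rho) by ring.
  rewrite e2 e3 in h3.
  have sm : B ^+ 15 * err <= 12^-1.
    have := @err_small 15 isT; have := e_le1; have := err_pos 15; lra.
  have h4 : B ^+ 15 * err * (cabs xi + rho) <= 12^-1 * (cabs D + 3 * rho).
    apply: ler_pM => //; first by rewrite addr_ge0 ?cabs_ge0.
    have := xiD; lra.
  have h5 : cabs D <= B ^+ 3 * cabs D by rewrite ler_peMl ?cabs_ge0 // exprn_ege1.
  lra.
have D0 : D != 0.
  apply/eqP => D0; move: rho_D; rewrite D0 cabs0 mulr0; have := rho_gt0; lra.
split => //.
(* Consequently an error relative to [|xi| + rho] is also relative to [|D|], the form that [half]
   asks for. *)
have xirho : cabs xi + rho <= B ^+ 4 * cabs D.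
  have D3 := pwS 3 (cabs_ge0 D).
  have h5 : cabs D <= B ^+ 3 * cabs D by rewrite ler_peMl ?cabs_ge0 // exprn_ege1.
  have := cabs_ge0 D; lra.
have xq j : MU F U2 x j = w' * q_of (fun j => conjc (m j)) m' j.
  exact: (rescaled_equation eq2).
have cm j : m j * conjc (m j) = (cabs (m j))%:C ^+ 2 by rewrite mmE.
apply: (half _ _ xq _ D0 hb bmin) => j.
(* Since [|m| ^ 2] is [m] times its conjugate, the deviation from 1 is exactly proportional to [gt],
   with no term in [rho]. *)
- have -> : U2 j - 1 = conjc (m j) / (cabs (m j))%:C * gt j.
    have -> : gt j = m' j / (cabs (m j))%:C - m j / (cabs (m j))%:C by rewrite /gt; ring.
    rewrite mulrBr; congr (_ - _); first by rewrite /U_of; field; exact: mmC.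
    have -> : conjc (m j) / (cabs (m j))%:C * (m j / (cabs (m j))%:C) =
       (m j * conjc (m j)) / (cabs (m j))%:C ^+ 2 by field; exact: mmC.
    by rewrite cm mulfV // expf_neq0 // mmC.
  rewrite cabsM (cabsM (conjc _)) cabsV cabs_conj cabs_real gtr0_norm // mulfV ?gt_eqF // mul1r.
  apply: le_trans (G_bnd j) _; have := G_err3; have := mulr_ge0 (Bn0 2) tau_ge0; lra.
- have -> : q_of (fun j => conjc (m j)) m' j - (cabs (m j))%:C = conjc (m j) * gt j.
    rewrite /q_of /gt mulrA mulrBr mulrBl; congr (_ - _).
    by rewrite [conjc _ * m j]mulrC cm; field; exact: mmC.
  rewrite cabsM cabs_conj.
  have h : G <= B ^+ 3 * err.
    have := G_err3; have := mulr_ge0 (Bn0 2) tau_ge0; lra.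
  have h2 : cabs (m j) * cabs (gt j) <= B * (B ^+ 3 * err).
    apply: ler_pM; rewrite ?cabs_ge0 //; first by case/andP: (mm_B j).
    exact: le_trans (G_bnd j) h.
  apply: le_trans h2 _.
  have -> : B * (B ^+ 3 * err) = B ^+ 4 * err by ring.
  exact: pw.
- apply: le_trans (x_near j) _.
  have h : cabs xi + rho <= B ^+ 5 * cabs (D * sg%:C).
    apply: le_trans xirho _; rewrite cabsM cabs_real gtr0_norm //.
    have -> : B ^+ 5 * (cabs D * sg) = B ^+ 4 * (cabs D * (B * sg)) by ring.
    by rewrite ler_wpM2l // ler_peMr ?cabs_ge0.
  apply: le_trans (ler_wpM2l (err_pos 14) h) _.
  have -> : B ^+ 14 * err * (B ^+ 5 * cabs (D * sg%:C)) = B ^+ 19 * err * cabs (D * sg%:C) by ring.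
  by rewrite ler_wpM2r ?cabs_ge0 // pw.
Qed.

End Expansion.

(** * Solutions near a singular point *)

Lemma pi_le4 (R : realType) : pi <= 4 :> R.
Proof.
have := @pihalf_lt2 R; rewrite ltr_pdivrMr // => h; lra.
Qed.

Section SolutionData.
Variables (R : realType) (N : nat) (L0 : R) (S : 'I_N -> 'I_N -> R).
Hypotheses (N_gt0 : (0 < N)%N) (L0_ge1 : 1 <= L0).
Hypothesis S_sym : forall j k, S j k = S k j.
Hypothesis S_bnd : forall j k, L0^-1 / N%:R <= S j k <= L0 / N%:R.
Variables (z : R[i]) (m : 'I_N -> R[i]).
Hypotheses (z_im : 0 < complex.Im z) (m_sol : solves S z m).
Hypothesis m_bnd : forall j, L0^-1 <= cabs (m j) <= L0.

Let L0_gt0 : 0 < L0. Proof. exact: lt_le_trans L0_ge1. Qed.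
Let Li_gt0 : 0 < L0^-1. Proof. by rewrite invr_gt0. Qed.
Let L0n n : 0 < L0 ^+ n. Proof. exact: exprn_gt0. Qed.
Let L0_pw n k : (n <= k)%N -> L0 ^+ n <= L0 ^+ k. Proof. by move=> h; rewrite ler_weXn2l. Qed.
Let mm_gt0 j : 0 < cabs (m j).
Proof. by case/andP: (m_bnd j) => + _; exact: lt_le_trans. Qed.

Definition density : R := pi^-1 * mean (fun j => complex.Im (m j)).
Definition profile j : R := density^-1 * (complex.Im (m j) / cabs (m j)).
(** Dominates [pi * (2 * L0 ^ 4) * L0], the upper bound for the profile, by [pi <= 4]. *)
Let L := 8 * L0 ^+ 5.

Lemma profile_const_ge1 : 1 <= L.
Proof. have := exprn_ege1 5 L0_ge1; rewrite /L; lra. Qed.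

Lemma density_gt0 : 0 < density.
Proof. by rewrite mulr_gt0 ?invr_gt0 ?pi_gt0 // (mean_im_gt0 N_gt0 m_sol). Qed.

Let le_L x n : (n <= 5)%N -> x <= L0 ^+ n -> x <= L.
Proof.
move=> hn h; apply: le_trans h _; have := L0_pw hn; have := L0n 5.
rewrite /L; lra.
Qed.

Let ge_L x n : (n <= 5)%N -> L0^-1 ^+ n <= x -> L^-1 <= x.
Proof.
move=> hn h; apply: le_trans h; rewrite exprVn lef_pV2 ?posrE //.
  exact: le_L hn _.
by rewrite mulr_gt0.
Qed.

Lemma profile_modulus_bnd j : L^-1 <= cabs (m j) <= L.
Proof.
case/andP: (m_bnd j) => h1 h2; apply/andP; split.
  by apply: (@ge_L _ 1); rewrite ?expr1.
by apply: (@le_L _ 1); rewrite ?expr1.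
Qed.

Lemma symmetrized_bnd j k :
  L^-1 / N%:R <= cabs (m j) * S j k * cabs (m k) <= L / N%:R.
Proof.
have -> : cabs (m j) * S j k * cabs (m k) = S j k * (cabs (m j) * cabs (m k)) by ring.
have [h1 h2] := andP (S_bnd j k); have [h3 h4] := andP (m_bnd j); have [h5 h6] := andP (m_bnd k).
have N0 : 0 < N%:R :> R by rewrite ltr0n.
have S0 : 0 <= S j k by apply: le_trans h1; rewrite divr_ge0 ?ltW.
have p : 0 <= cabs (m j) * cabs (m k) by rewrite mulr_ge0 ?cabs_ge0.
apply/andP; split.
  apply: (@le_trans _ _ (L0^-1 / N%:R * (L0^-1 * L0^-1))).
    rewrite mulrAC ler_pM2r ?invr_gt0 // mulrA.
    by apply: (@ge_L _ 3) => //; rewrite !exprS expr0 mulr1 mulrA.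
  apply: ler_pM => //; first by rewrite divr_ge0 ?ltW.
    by rewrite mulr_ge0 ?ltW.
  by apply: ler_pM; rewrite ?(ltW Li_gt0).
apply: (@le_trans _ _ (L0 / N%:R * (L0 * L0))).
  by apply: ler_pM => //; apply: ler_pM; rewrite ?cabs_ge0.
rewrite mulrAC ler_pM2r ?invr_gt0 // mulrA.
by apply: (@le_L _ 3) => //; rewrite !exprS expr0 mulr1 mulrA.
Qed.

Lemma symmetrized_sym j k :
  cabs (m j) * S j k * cabs (m k) = cabs (m k) * S k j * cabs (m j).
Proof. by rewrite (S_sym j k); ring. Qed.

Lemma profile_bnd j : L^-1 <= profile j <= L.
Proof.
have [/andP[h1 h2] _ _] := normalized_im_bounds N_gt0 L0_ge1 S_bnd z_im m_sol m_bnd j.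
have [h3 h4] := andP (m_bnd j).
have al0 := mean_im_gt0 N_gt0 m_sol.
have -> : profile j = pi * (complex.Im (m j) / mean (fun j => complex.Im (m j))) * (cabs (m j))^-1.
  by rewrite /profile /density invfM invrK mulrA [pi * _ * _]mulrAC mulrA mulrAC.
have p2 := pi_ge2 R; have p4 := pi_le4 R.
have im1 : (cabs (m j))^-1 <= L0 by rewrite -[L0]invrK lef_pV2 ?posrE.
have im2 : L0^-1 <= (cabs (m j))^-1 by rewrite lef_pV2 ?posrE.
move: h1 h2; set x := complex.Im (m j) / _ => h1 h2.
have B0 : 0 < (2 * L0 ^+ 4)^-1 by rewrite invr_gt0 mulr_gt0.
have x0 : 0 < x by apply: lt_le_trans h1.
apply/andP; split.
  apply: (@ge_L _ 5) => //.
  apply: (@le_trans _ _ (2 * (2 * L0 ^+ 4)^-1 * L0^-1)).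
    by rewrite le_eqVlt; apply/orP; left; apply/eqP; field; rewrite gt_eqF.
  have h : 2 * (2 * L0 ^+ 4)^-1 <= pi * x := ler_pM (ler0n _ 2) (ltW B0) p2 h1.
  apply: (ler_pM _ (ltW Li_gt0) h im2); exact: mulr_ge0 (ler0n _ 2) (ltW B0).
apply: (@le_trans _ _ (4 * (2 * L0 ^+ 4) * L0)).
  have h : pi * x <= 4 * (2 * L0 ^+ 4) := ler_pM (pi_ge0 R) (ltW x0) p4 h2.
  apply: (ler_pM _ _ h im1); last by rewrite invr_ge0 cabs_ge0.
  exact: mulr_ge0 (pi_ge0 R) (ltW x0).
by rewrite le_eqVlt; apply/orP; left; apply/eqP; rewrite /L; ring.
Qed.

Lemma profile_im j : complex.Im (m j) = density * (profile j * cabs (m j)).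
Proof. by rewrite /profile; field; rewrite !gt_eqF ?density_gt0. Qed.

Lemma profile_eq j : profile j - \sum_k cabs (m j) * S j k * cabs (m k) * profile k =
  complex.Im z / density * cabs (m j).
Proof.
have d0 := density_gt0.
have -> : \sum_k cabs (m j) * S j k * cabs (m k) * profile k =
  cabs (m j) / density * \sum_k S j k * complex.Im (m k).
  rewrite mulr_sumr; apply: eq_bigr => k _; rewrite /profile; field.
  by rewrite !gt_eqF.
rewrite {1}/profile (solves_im m_sol j); field.
by rewrite !gt_eqF.
Qed.

Lemma profile_pi : mean (fun j => profile j * cabs (m j)) = pi.
Proof.
have al0 := mean_im_gt0 N_gt0 m_sol.
rewrite (eq_mean (y := fun j => density^-1 * complex.Im (m j))); last first.
  by move=> j; rewrite /profile; field; rewrite !gt_eqF ?density_gt0.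
by rewrite meanZ /density invfM invrK -mulrA mulVf ?mulr1 // gt_eqF.
Qed.

Lemma ratio_ge0 : 0 <= complex.Im z / density.
Proof. by rewrite divr_ge0 ?ltW // density_gt0. Qed.

(** Pairing [profile_eq] with [v] and using symmetry of the kernel,
    [(1 - lam) <v, f> = ka <v, |m|>], where [f] is the profile. Positivity gives the sign, the
    two-sided bounds on profile and modulus the size. *)
Lemma perron_value (v : 'I_N -> R) lam : (forall j, 0 < v j) ->
  (forall j, \sum_k cabs (m j) * S j k * cabs (m k) * v k = lam * v j) ->
  0 <= 1 - lam <= L ^+ 2 * (complex.Im z / density).
Proof.
move=> v0 hv; set ka := complex.Im z / density.
have ka0 : 0 <= ka := ratio_ge0.
have vf0 : 0 < mean (fun j => v j * profile j).
  apply: mean_gt0 => // j; rewrite mulr_gt0 //.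
  by case/andP: (profile_bnd j) => + _; apply: lt_le_trans; rewrite invr_gt0 mulr_gt0.
have e : (1 - lam) * mean (fun j => v j * profile j) = ka * mean (fun j => v j * cabs (m j)).
  transitivity (mean (fun j => v j * (profile j -
      \sum_k cabs (m j) * S j k * cabs (m k) * profile k))); last first.
    by rewrite -meanZ; apply: eq_mean => j; rewrite profile_eq -/ka; ring.
  rewrite mulrBl mul1r -meanZ (eq_mean (x := fun j => v j * (profile j - _))
    (y := fun j => v j * profile j - v j * \sum_k cabs (m j) * S j k * cabs (m k) * profile k)); last first.
    by move=> j; rewrite mulrBr.
  rewrite meanB; congr (_ - _); rewrite /mean; congr (_ * _).
  under [RHS]eq_bigr do rewrite mulr_sumr.
  rewrite exchange_big /=; apply: eq_bigr => k _.
  rewrite mulrA -hv mulr_suml; apply: eq_bigr => j _.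
  by rewrite (S_sym j k); ring.
have m0 : 0 <= mean (fun j => v j * cabs (m j)).
  by apply: mean_ge0 => // j; rewrite mulr_ge0 ?cabs_ge0 // ltW.
apply/andP; split.
  rewrite -(pmulr_lge0 _ vf0) e; exact: mulr_ge0.
rewrite -(ler_pM2r vf0) e [leRHS]mulrAC [leRHS]mulrC ler_wpM2l //.
rewrite -meanZ; apply: ler_mean => // j.
have -> : L ^+ 2 * (v j * profile j) = v j * (L * (L * profile j)) by ring.
rewrite ler_wpM2l ?(ltW (v0 j)) //.
have Lp : 0 < L by rewrite mulr_gt0.
have h : 1 <= L * profile j.
  rewrite mulrC -ler_pdivrMr // div1r; by case/andP: (profile_bnd j).
case/andP: (profile_modulus_bnd j) => _ h2; apply: le_trans h2 _.
by rewrite ler_peMr // ltW.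
Qed.

End SolutionData.

(** With [y = Im m / |m|] one has [(1 - |m| S |m|) y = Im z |m|], and likewise for [y']. Testing
    each equation against the other function and subtracting leaves the difference of the two
    kernels, of order [dl]. Division by the product of the mean imaginary parts keeps the bound
    uniform down to the real axis. *)
Lemma ratio_comparison (R : realType) (N : nat) (L : R) (S : 'I_N -> 'I_N -> R)
    (z z' : R[i]) (m m' : 'I_N -> R[i]) (dl : R) :
  (0 < N)%N -> 1 <= L ->
  (forall j k, S j k = S k j) ->
  (forall j k, L^-1 / N%:R <= S j k <= L / N%:R) ->
  0 < complex.Im z -> 0 < complex.Im z' -> solves S z m -> solves S z' m' ->
  (forall j, L^-1 <= cabs (m j) <= L) -> (forall j, L^-1 <= cabs (m' j) <= L) ->
  (forall j, cabs (m' j - m j) <= dl) ->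
  complex.Im z / density m <= L ^+ 4 * (complex.Im z' / density m') + 8 * L ^+ 6 * dl.
Proof.
move=> N_gt0 L_ge1 S_sym S_bnd zi z'i ms m's mb m'b hd.
have L_gt0 : 0 < L by exact: lt_le_trans L_ge1.
have pos (u : 'I_N -> R[i]) j : (forall j, L^-1 <= cabs (u j) <= L) -> 0 < cabs (u j).
  by move=> h; case/andP: (h j) => + _; apply: lt_le_trans; rewrite invr_gt0.
pose al := mean (fun j => complex.Im (m j)); pose al' := mean (fun j => complex.Im (m' j)).
have al0 : 0 < al := mean_im_gt0 N_gt0 ms.
have al'0 : 0 < al' := mean_im_gt0 N_gt0 m's.
pose y j := complex.Im (m j) / cabs (m j); pose y' j := complex.Im (m' j) / cabs (m' j).
have ratio (u : 'I_N -> R[i]) j : (forall j, L^-1 <= cabs (u j) <= L) -> 0 < complex.Im (u j) ->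
    L^-1 * complex.Im (u j) <= complex.Im (u j) / cabs (u j) <= L * complex.Im (u j).
  move=> h u0; have [h1 h2] := andP (h j); have c0 := pos u j h.
  rewrite mulrC [L * _]mulrC !ler_pM2l // lef_pV2 ?posrE // h2 /=.
  by rewrite -[leRHS]invrK lef_pV2 ?posrE ?invr_gt0.
have yb j : L^-1 * complex.Im (m j) <= y j <= L * complex.Im (m j) by apply: ratio => //; case: ms.
have y'b j : L^-1 * complex.Im (m' j) <= y' j <= L * complex.Im (m' j) by apply: ratio => //; case: m's.
have y0 j : 0 <= y j by rewrite divr_ge0 ?cabs_ge0 // ltW //; case: ms.
have y'0 j : 0 <= y' j by rewrite divr_ge0 ?cabs_ge0 // ltW //; case: m's.
have yE j : y j - \sum_k cabs (m j) * S j k * cabs (m k) * y k = complex.Im z * cabs (m j).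
  have -> : \sum_k cabs (m j) * S j k * cabs (m k) * y k = cabs (m j) * \sum_k S j k * complex.Im (m k).
    by rewrite mulr_sumr; apply: eq_bigr => k _; rewrite /y; field; rewrite gt_eqF // pos.
  by rewrite {1}/y (solves_im ms j); field; rewrite gt_eqF // pos.
have y'E j : y' j - \sum_k cabs (m' j) * S j k * cabs (m' k) * y' k = complex.Im z' * cabs (m' j).
  have -> : \sum_k cabs (m' j) * S j k * cabs (m' k) * y' k = cabs (m' j) * \sum_k S j k * complex.Im (m' k).
    by rewrite mulr_sumr; apply: eq_bigr => k _; rewrite /y'; field; rewrite gt_eqF // pos.
  by rewrite {1}/y' (solves_im m's j); field; rewrite gt_eqF // pos.
have dl0 : 0 <= dl by apply: le_trans (hd (Ordinal N_gt0)); exact: cabs_ge0.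
have E : complex.Im z * mean (fun j => y' j * cabs (m j)) =
   complex.Im z' * mean (fun j => y j * cabs (m' j)) +
   mean (fun j => \sum_k (cabs (m' j) * cabs (m' k) - cabs (m j) * cabs (m k)) * S j k * (y j * y' k)).
  transitivity (mean (fun j => y' j * y j) - mean (fun j => \sum_k cabs (m j) * S j k * cabs (m k) * (y j * y' k))).
    rewrite -meanZ -[mean (fun j => \sum_k _)](_ : mean (fun k => y' k * \sum_j cabs (m k) * S k j * cabs (m j) * y j) = _).
      by rewrite -meanB; apply: eq_mean => j; rewrite -mulrBr yE; ring.
    rewrite /mean; congr (_ * _); under eq_bigr do rewrite mulr_sumr.
    rewrite exchange_big /=; apply: eq_bigr => j _; apply: eq_bigr => k _.
    by rewrite (S_sym k j); ring.
  have -> : complex.Im z' * mean (fun j => y j * cabs (m' j)) =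
     mean (fun j => y' j * y j) - mean (fun j => \sum_k cabs (m' j) * S j k * cabs (m' k) * (y j * y' k)).
    rewrite -meanZ -meanB; apply: eq_mean => j.
    have -> : \sum_k cabs (m' j) * S j k * cabs (m' k) * (y j * y' k) =
      y j * \sum_k cabs (m' j) * S j k * cabs (m' k) * y' k.
      by rewrite mulr_sumr; apply: eq_bigr => k _; ring.
    by rewrite mulrCA -y'E; ring.
  rewrite -addrA; congr (_ + _); rewrite -meanN -meanN -meanD; apply: eq_mean => j.
  rewrite -!sumrN -big_split; apply: eq_bigr => k _ /=; ring.
have lower : L^-1 ^+ 2 * al' <= mean (fun j => y' j * cabs (m j)).
  rewrite -meanZ; apply: ler_mean => // j.
  have -> : L^-1 ^+ 2 * complex.Im (m' j) = (L^-1 * complex.Im (m' j)) * L^-1 by ring.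
  apply: ler_pM; rewrite ?invr_ge0 ?(ltW L_gt0) //.
  - by rewrite mulr_ge0 ?invr_ge0 ?(ltW L_gt0) // ltW //; case: m's.
  - by case/andP: (y'b j).
  - by case/andP: (mb j).
have upper1 : mean (fun j => y j * cabs (m' j)) <= L ^+ 2 * al.
  rewrite -meanZ; apply: ler_mean => // j.
  have -> : L ^+ 2 * complex.Im (m j) = (L * complex.Im (m j)) * L by ring.
  apply: ler_pM; rewrite ?cabs_ge0 //; first by case/andP: (yb j).
  by case/andP: (m'b j).
have upper2 : mean (fun j => \sum_k (cabs (m' j) * cabs (m' k) - cabs (m j) * cabs (m k)) * S j k * (y j * y' k))
    <= 2 * L ^+ 4 * dl * (al * al').
  have -> : 2 * L ^+ 4 * dl * (al * al') = (2 * L ^+ 4 * dl * al') * al by ring.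
  rewrite -meanZ; apply: ler_mean => // j.
  have step k : (cabs (m' j) * cabs (m' k) - cabs (m j) * cabs (m k)) * S j k * (y j * y' k) <=
     S j k * (2 * L ^+ 3 * dl * complex.Im (m j) * complex.Im (m' k)).
    have S0 : 0 <= S j k.
      case/andP: (S_bnd j k) => + _; apply: le_trans.
      by rewrite divr_ge0 ?ler0n // invr_ge0 ltW.
    have h1 i : cabs (m' i) <= cabs (m i) + dl.
      have := cabsD (m' i - m i) (m i); rewrite subrK; have := hd i; lra.
    have h2 : cabs (m' j) * cabs (m' k) - cabs (m j) * cabs (m k) <= 2 * L * dl.
      have e1 : (cabs (m' j) - cabs (m j)) * cabs (m' k) <= dl * L.
        apply: (@le_trans _ _ (dl * cabs (m' k))).
          by rewrite ler_wpM2r ?cabs_ge0 //; have := h1 j; lra.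
        by rewrite ler_wpM2l //; case/andP: (m'b k).
      have e2 : (cabs (m' k) - cabs (m k)) * cabs (m j) <= dl * L.
        apply: (@le_trans _ _ (dl * cabs (m j))).
          by rewrite ler_wpM2r ?cabs_ge0 //; have := h1 k; lra.
        by rewrite ler_wpM2l //; case/andP: (mb j).
      lra.
    have h3 : y j * y' k <= L * complex.Im (m j) * (L * complex.Im (m' k)).
      apply: ler_pM => //; first by case/andP: (yb j).
      by case/andP: (y'b k).
    have yy0 : 0 <= y j * y' k by exact: mulr_ge0.
    have d0 : 0 <= 2 * L * dl by rewrite mulr_ge0 // mulr_ge0 // ltW.
    have h4 := ler_wpM2r yy0 h2; have h5 := ler_wpM2l d0 h3.
    have h6 := ler_wpM2l S0 (le_trans h4 h5); lra.
  apply: le_trans (ler_sum _ (fun k _ => step k)) _.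
  have a0 : 0 <= complex.Im (m j) by apply: ltW; case: ms.
  have -> : \sum_i S j i * (2 * L ^+ 3 * dl * complex.Im (m j) * complex.Im (m' i)) =
     2 * L ^+ 3 * dl * complex.Im (m j) * \sum_i S j i * complex.Im (m' i).
    by rewrite mulr_sumr; apply: eq_bigr => k _; ring.
  have h : \sum_i S j i * complex.Im (m' i) <= L * al'.
    apply: ker_le => k; first by case/andP: (S_bnd j k).
    by apply: ltW; case: m's.
  have c0 : 0 <= 2 * L ^+ 3 * dl * complex.Im (m j).
    apply: mulr_ge0 => //; apply: mulr_ge0 => //; apply: mulr_ge0 => //.
    by rewrite exprn_ge0 // ltW.
  have := ler_wpM2l c0 h; lra.
have zi0 := ltW zi.
have z'i0 := ltW z'i.
have K : complex.Im z * (L^-1 ^+ 2 * al') <=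
    complex.Im z' * (L ^+ 2 * al) + 2 * L ^+ 4 * dl * (al * al').
  apply: le_trans (ler_wpM2l zi0 lower) _; rewrite E; apply: lerD => //.
  by rewrite ler_wpM2l.
have K2 : complex.Im z / al <= L ^+ 4 * (complex.Im z' / al') + 2 * L ^+ 6 * dl.
  have Q : 0 <= L ^+ 2 / (al * al') by rewrite divr_ge0 ?sqr_ge0 // mulr_ge0 // ltW.
  have := ler_wpM2r Q K.
  have -> : complex.Im z * (L^-1 ^+ 2 * al') * (L ^+ 2 / (al * al')) = complex.Im z / al.
    by field; rewrite !gt_eqF.
  have -> : (complex.Im z' * (L ^+ 2 * al) + 2 * L ^+ 4 * dl * (al * al')) * (L ^+ 2 / (al * al')) =
     L ^+ 4 * (complex.Im z' / al') + 2 * L ^+ 6 * dl.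
    by field; rewrite !gt_eqF.
  by [].
have dE (u : 'I_N -> R[i]) (x : R) : x / density u = pi * (x / mean (fun j => complex.Im (u j))).
  by rewrite /density invfM invrK; ring.
rewrite !dE.
have := ler_wpM2l (pi_ge0 R) K2; have := pi_le4 R.
have D0 : 0 <= L ^+ 6 * dl by rewrite mulr_ge0 // exprn_ge0 // ltW.
move=> p4; have := ler_wpM2r D0 p4; rewrite -/al -/al'; lra.
Qed.

(** * Boundary values and points close to the singularity *)

Section BoundaryValues.
Variables (R : realType) (N : nat) (m : R[i] -> 'cV[R[i]]_N).

(** Extracts a vertical approach from the limit along the filter. Radii of balls in [R[i]] are
    themselves elements of [R[i]], whence the passage to the real part of [ep]. *)
Lemma boundary_approx (E : R) :
  (forall j, m z j 0 @[z --> within (@Hplane R) (nbhs (E%:C : R[i]^o))]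
          --> (m E%:C j 0 : R[i]^o)) ->
  forall dl, 0 < dl -> exists t, 0 < t <= dl /\
    forall j, cabs (m (E +i* t) j 0 - m E%:C j 0) <= dl.
Proof.
move=> cv dl dl0.
have dlC : 0 < dl%:C :> R[i] by rewrite ltcR.
have near_all : \forall z \near within (@Hplane R) (nbhs (E%:C : R[i]^o)),
    forall j, `|m E%:C j 0 - m z j 0| <= dl%:C.
  apply: filter_forall => j.
  have H := @cvgrPdist_le R[i] (R[i]^o : normedModType R[i]) R[i] (within (@Hplane R) (nbhs (E%:C : R[i]^o))) _ (fun z => m z j 0) (m E%:C j 0).
  have FF : Filter (within (@Hplane R) (nbhs (E%:C : R[i]^o))) by exact: within_filter.
  exact: (proj1 (H FF) (cv j) _ dlC).
move: near_all; rewrite /within /= => /nbhs_ballP[ep /= ep0 hep].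
have ep_real : ep = (complex.Re ep)%:C.
  by move: ep0; rewrite ltcE /= => /andP[/eqP h _]; case: (ep) h => a b /= ->.
have re0 : 0 < complex.Re ep by move: ep0; rewrite ltcE /= => /andP[].
pose t := Num.min dl (complex.Re ep / 2).
have t0 : 0 < t by rewrite lt_min dl0 divr_gt0.
exists t; split; first by rewrite t0 ge_min lexx.
move=> j; rewrite cabsC.
have : `|m E%:C j 0 - m (E +i* t) j 0| <= dl%:C.
  apply: hep => //; rewrite -ball_normE /=.
  have -> : E%:C - (E +i* t) = - (t%:C * 'i%C).
    by apply/eqP; rewrite eq_complex /=; apply/andP; split; apply/eqP; ring.
  rewrite normrN normrM ep_real normc_def /= normc_def /=.
  rewrite expr0n /= addr0 add0r expr1n sqrtr1 sqrtr_sqr mulr1 ltcR gtr0_norm //.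
  apply: (@le_lt_trans _ _ (complex.Re ep / 2)); first by rewrite ge_min lexx orbT.
  by rewrite ltr_pdivrMr // ltr_pMr // ltr1n.
rewrite normc_def lecR /cabs.
by case: (_ - _).
Qed.

End BoundaryValues.

Section SpectralEdge.
Variables (R : realType) (N : nat) (S : 'M[R]_N) (m : R[i] -> 'cV[R[i]]_N).
Hypotheses (N_gt0 : (0 < N)%N) (m_qve : qve_solution S m).

Local Notation Sf := (fun j k => S j k).
Local Notation mf z := (fun j => m z j 0).

Lemma qve_solves z : 0 < complex.Im z -> solves Sf z (mf z).
Proof.
move=> z0; have [h1 h2 _] := m_qve.
have zn : complex.Im z != 0 by rewrite gt_eqF.
have im0 j : 0 < complex.Im (m z j 0).
  by have := h2 z j zn; rewrite pmulr_lgt0.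
split => // j; have mn : m z j 0 != 0.
  by apply/eqP => e; move: (im0 j); rewrite e ltxx.
by rewrite -(h1 z j zn) mulrN mulfV.
Qed.

(** A second solution at the same [z]; its uniqueness, proved later, is the symmetry of [m] under
    conjugation. *)
Lemma qve_solves_conj z : 0 < complex.Im z ->
  solves Sf z (fun j => conjc (m (conjc z) j 0)).
Proof.
move=> z0; have [h1 h2 _] := m_qve.
have zc : complex.Im (conjc z) = - complex.Im z by case: (z).
have zn : complex.Im (conjc z) != 0 by rewrite zc oppr_eq0 gt_eqF.
have imc (x : R[i]) : complex.Im (conjc x) = - complex.Im x by case: x.
have im0 j : 0 < complex.Im (conjc (m (conjc z) j 0)).
  by have := h2 _ j zn; rewrite zc mulrN -mulNr pmulr_lgt0 // imc.
split => // j; have mn : m (conjc z) j 0 != 0.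
  by apply/eqP => e; move: (im0 j); rewrite e imc oppr0 ltxx.
have -> : z + \sum_k (S j k)%:C * conjc (m (conjc z) k 0) =
   conjc (conjc z + \sum_k (S j k)%:C * m (conjc z) k 0).
  rewrite rmorphD rmorph_sum /= conjcK; congr (_ + _).
  apply: eq_bigr => k _; case: (m _ k 0) => a b.
  by apply/eqP; rewrite eq_complex /=; apply/andP; split; apply/eqP; ring.
by rewrite -rmorphM -(h1 _ j zn) mulrN mulfV //; apply/eqP; rewrite eq_complex /= !oppr0 !eqxx.
Qed.

Lemma rho_density z : rho m z = density (mf z).
Proof.
by rewrite /rho /density /avg /mean; under eq_bigr do rewrite mxE.
Qed.

Let density_lip (u u' : 'I_N -> R[i]) dl : (forall j, cabs (u j - u' j) <= dl) ->
  density u <= density u' + dl.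
Proof.
move=> h.
have dl0 : 0 <= dl by apply: le_trans (h (Ordinal N_gt0)); exact: cabs_ge0.
have : mean (fun j => complex.Im (u j)) <= mean (fun j => complex.Im (u' j)) + dl.
  rewrite -[dl in leRHS](mean_const N_gt0) -meanD; apply: ler_mean => // j.
  have := le_trans (ler_norm _) (cabs_Im (u j - u' j)).
  rewrite cImD cImN; have := h j; lra.
have p0 : 0 < pi^-1 :> R by rewrite invr_gt0 pi_gt0.
have p1 : pi^-1 <= 1 :> R by rewrite invf_le1 ?pi_gt0 //; have := pi_ge2 R; lra.
move=> /(ler_wpM2l (ltW p0)); rewrite mulrDr /density => H; apply: le_trans H _.
by rewrite lerD2l ler_piMl.
Qed.

Let boundary E dl : 0 < dl -> exists t, 0 < t <= dl /\
  forall j, cabs (m (E +i* t) j 0 - m E%:C j 0) <= dl.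
Proof. by apply: boundary_approx => j; case: m_qve. Qed.

Let dist_pt (E E0 t a : R) : `|E - E0| <= a -> 0 < t -> t <= a ->
  cabs (E +i* t - E0%:C) <= 2 * a.
Proof.
move=> h1 h2 h3; apply: le_trans (cabs_le_ReIm _) _.
by rewrite /= subr0 (gtr0_norm h2); lra.
Qed.

(** Each half comes from one part of being singular. Since [rho] vanishes at [E0], points just above
    it have small density. Since [E0] is a limit of real points where [rho] is nonzero, [Im y] can
    be made small against the density above one of those. The two points may differ; the Hoelder
    bound reconciles them. *)
Lemma edge_points E0 dl : singular_set m E0 -> 0 < dl ->
  (exists y, [/\ 0 < complex.Im y, cabs (y - E0%:C) <= dl & density (mf y) <= dl]) /\
  (exists y, [/\ 0 < complex.Im y, cabs (y - E0%:C) <= dl &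
    complex.Im y <= dl * density (mf y)]).
Proof.
move=> [cl r0] dl0; have dl2 : 0 < dl / 2 by rewrite divr_gt0.
split.
  have [t [/andP[t0 t1] ht]] := boundary E0 dl2.
  exists (E0 +i* t); split => //.
    have -> : dl = 2 * (dl / 2) by field.
    by apply: dist_pt => //; rewrite subrr normr0 ltW.
  have := density_lip ht; rewrite -(rho_density E0%:C) r0; lra.
have [x [/= rx bx]] : ([set x : R | rho m x%:C != 0] `&` ball E0 (dl / 2)) !=set0.
  by apply: cl; exact: nbhsx_ballx.
(* At a real point [m] is only a limit from the upper half-plane, so strict positivity is lost. *)
have im_ge0 j : 0 <= complex.Im (m x%:C j 0).
  rewrite -oppr_le0; apply/ler_addgt0Pr => ee ee0; rewrite add0r.
  have [t [/andP[t0 _] ht]] := boundary x ee0.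
  have im0 : 0 < complex.Im (m (x +i* t) j 0) by have [] := @qve_solves (x +i* t) t0.
  have := le_trans (ler_norm _) (cabs_Im (m (x +i* t) j 0 - m x%:C j 0)).
  rewrite cImD cImN; have := ht j; lra.
have d_ge0 : 0 <= density (mf x%:C).
  by rewrite /density mulr_ge0 ?invr_ge0 ?pi_ge0 // mean_ge0.
have d0 : 0 < density (mf x%:C).
  by rewrite lt0r d_ge0 andbT -rho_density.
set d := density _ in d0 d_ge0.
(* The three caps keep the point near [E0], its density above [d / 2], and its imaginary part below
   [dl * d / 2]. *)
pose a := Num.min (dl / 2) (Num.min (d / 2) (dl * d / 2)).
have a0 : 0 < a by rewrite !lt_min dl2 !divr_gt0 // mulr_gt0.
have [t [/andP[t0 t1] ht]] := boundary x a0.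
have a1 : a <= dl / 2 by rewrite ge_min lexx.
have a2 : a <= d / 2 by rewrite !ge_min lexx !orbT.
have a3 : a <= dl * d / 2 by rewrite !ge_min lexx !orbT.
exists (x +i* t); split => //.
  have -> : dl = 2 * (dl / 2) by field.
  apply: dist_pt => //; last exact: le_trans t1 a1.
  by move: bx; rewrite -ball_normE /= distrC => /ltW.
have hd : d <= density (mf (x +i* t)) + a.
  by apply: density_lip => j; rewrite cabsC.
have h2 : d / 2 <= density (mf (x +i* t)) by lra.
have h3 := ler_wpM2l (ltW dl0) h2; rewrite /=; lra.
Qed.

(** For larger [|z|] the equation forces [|m| <= (2 + C)^-1]. Then [Im m = |m| ^ 2 (Im z + S Im m)],
    with [Im z] at most the density, would make the mean of [Im m] smaller than itself. This is a
    crude form of boundedness of the support. *)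
Lemma energy_bound (C Cm : R) z : 0 < C -> 0 < Cm ->
  (forall j k, 0 <= S j k <= C / N%:R) -> 0 < complex.Im z ->
  (forall j, cabs (m z j 0) <= Cm) -> complex.Im z <= density (mf z) ->
  cabs z <= C * Cm + 2 + C.
Proof.
move=> C0 Cm0 hS z0 hm hz; rewrite leNgt; apply/negP => big.
have sol := qve_solves z0; have u0 := solves_neq0 sol.
have [eq im0] := sol.
pose al := mean (fun j => complex.Im (m z j 0)).
have al0 : 0 < al by exact: mean_gt0.
have K0 : 0 < 2 + C by lra.
have ml j : cabs (m z j 0) <= (2 + C)^-1.
  have h : cabs (\sum_k (S j k)%:C * m z k 0) <= C * Cm.
    by apply: cabs_ker_le => //; exact: ltW.
  have h2 : 2 + C <= cabs (z + \sum_k (S j k)%:C * m z k 0).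
    have := cabsB (z + \sum_k (S j k)%:C * m z k 0) (\sum_k (S j k)%:C * m z k 0).
    rewrite addrK; lra.
  have := congr1 (@cabs R) (eq j); rewrite cabsM cabsN cabs1 => h3.
  have h4 := ler_wpM2l (cabs_ge0 (m z j 0)) h2; rewrite h3 in h4.
  by rewrite -div1r ler_pdivlMr.
have al_le : al <= (2 + C)^-1 ^+ 2 * ((1 + C) * al).
  apply: mean_le => // j; rewrite (solves_im sol j); apply: ler_pM.
  - exact: sqr_ge0.
  - rewrite addr_ge0 ?(ltW z0) // sumr_ge0 // => k _; rewrite mulr_ge0 //.
      by case/andP: (hS j k).
    exact: ltW.
  - by rewrite lerXn2r ?nnegrE ?cabs_ge0 // invr_ge0 ltW.
  - have h1 : \sum_k S j k * complex.Im (m z k 0) <= C * al.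
      apply: ker_le => k; first by case/andP: (hS j k).
      exact: ltW.
    have h2 : density (mf z) <= al.
      rewrite /density ler_piMl ?(ltW al0) // invf_le1 ?pi_gt0 //.
      have := pi_ge2 R; lra.
    lra.
have : (2 + C) ^+ 2 * al <= (1 + C) * al.
  have h := ler_wpM2l (sqr_ge0 (2 + C)) al_le; apply: le_trans h _.
  by rewrite mulrA -exprMn mulfV ?expr1n ?mul1r // gt_eqF.
rewrite ler_pM2r // leNgt => /negP; apply.
have := mulr_gt0 C0 C0; rewrite expr2; nra.
Qed.

End SpectralEdge.

(** * The stability matrix *)

Section StabilityMatrix.
Variables (R : realType) (N : nat) (S : 'I_N -> 'I_N -> R) (m : 'I_N -> R[i]).
Local Notation F := (fun j k => cabs (m j) * S j k * cabs (m k)).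
Hypotheses (N_gt0 : (0 < N)%N) (S_sym : forall j k, S j k = S k j).
Hypothesis m_neq0 : forall j, m j != 0.

Let mmC j : (cabs (m j))%:C != 0 :> R[i].
Proof. by rewrite eq_complex /= eqxx andbT gt_eqF // cabs_gt0. Qed.

Definition stability_mx (a b : 'I_N -> R[i]) : 'M[R[i]]_N :=
  1%:M - \matrix_(j, k) (a j * b j * (S j k)%:C).

Lemma stability_mul (a b u : 'I_N -> R[i]) j :
  (stability_mx a b *m \col_k ((cabs (m k))%:C * u k)) j 0 =
  (cabs (m j))%:C * MU F (U_of m a b) u j.
Proof.
rewrite mulmxBl mul1mx !mxE /MU mulrBr; congr (_ - _).
rewrite /Fapp /U_of !mulr_sumr; apply: eq_bigr => k _; rewrite !mxE !rmorphM /=.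
by field; exact: mmC.
Qed.

(** [eigenvalue] refers to row vectors. For symmetric [S], the weights [|m| / (a b)] turn the action
    on rows into the same [1 - U F] that governs columns. *)
Lemma mul_stability (a b u : 'I_N -> R[i]) k : a k * b k != 0 ->
  (forall j, a j * b j != 0) ->
  ((\row_j ((cabs (m j))%:C * u j / (a j * b j))) *m stability_mx a b) 0 k =
  (cabs (m k))%:C / (a k * b k) * MU F (U_of m a b) u k.
Proof.
move=> k0 h; rewrite mulmxBr mulmx1 !mxE /MU mulrBr; congr (_ - _); first by rewrite mulrAC.
rewrite /Fapp /U_of !mulr_sumr; apply: eq_bigr => j _.
rewrite !mxE !rmorphM /= (S_sym k j).
have := h j; have := h k; rewrite !mulf_eq0 !negb_or => /andP[? ?] /andP[? ?].
by field; rewrite mmC; apply/and5P; split.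
Qed.

Lemma left_eigen_function (a b : 'I_N -> R[i]) w (l : 'rV_N) : (forall j, a j * b j != 0) ->
  l *m stability_mx a b = w *: l ->
  forall k, MU F (U_of m a b) (fun j => l 0 j * (a j * b j) / (cabs (m j))%:C) k =
    w * (l 0 k * (a k * b k) / (cabs (m k))%:C).
Proof.
move=> h hl; pose u j := l 0 j * (a j * b j) / (cabs (m j))%:C.
have lE : l = \row_j ((cabs (m j))%:C * u j / (a j * b j)).
  apply/rowP => j; rewrite mxE /u; have := h j; rewrite mulf_eq0 negb_or => /andP[h1 h2].
  by field; rewrite mmC h1 h2.
move=> k; have := mul_stability u (h k) h; rewrite -lE hl mxE => E.
apply: (mulfI (_ : (cabs (m k))%:C / (a k * b k) != 0)).
  by apply: mulf_neq0; rewrite ?invr_eq0.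
rewrite -E {1}lE mxE /u; ring.
Qed.

Lemma eigenvalue_stabilityP (a b : 'I_N -> R[i]) w : (forall j, a j * b j != 0) ->
  eigenvalue (stability_mx a b) w <->
  exists u, (exists j, u j != 0) /\ forall j, MU F (U_of m a b) u j = w * u j.
Proof.
move=> h; split.
  move=> /eigenvalueP[l hl l0].
  have [j0 lj0] : exists j, l 0 j != 0.
    apply: contrapT => H; move/eqP: l0; apply; apply/rowP => j; rewrite mxE.
    by apply/eqP; apply: contrapT => /negP hj; apply: H; exists j.
  exists (fun j => l 0 j * (a j * b j) / (cabs (m j))%:C); split; last exact: left_eigen_function.
  by exists j0; apply: mulf_neq0; [exact: mulf_neq0 | rewrite invr_eq0].
move=> [u [[j0 uj0] hu]]; apply/eigenvalueP.
exists (\row_j ((cabs (m j))%:C * u j / (a j * b j))).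
  by apply/rowP => k; rewrite mul_stability // hu !mxE; ring.
apply/eqP => /rowP/(_ j0); rewrite !mxE => /eqP; apply/negP.
by apply: mulf_neq0; [exact: mulf_neq0 | rewrite invr_eq0].
Qed.

Variables (v : 'I_N -> R) (b0 : R[i]) (r0 : 'I_N -> R[i]) (e B L : R).
Local Notation U0 := (U_of m m m).
Let A1 := mean (fun j => r0 j / U0 j * r0 j).
Hypotheses (e_gt0 : 0 < e) (B_ge0 : 0 <= B) (L_ge1 : 1 <= L).
Hypothesis Ke : 2 * B * L ^+ 2 * e < 1.
Hypothesis m_bnd : forall j, L^-1 <= cabs (m j) <= L.
Hypothesis b0_lt : cabs b0 < e.
Hypothesis v_r0 : mean (fun k => (v k)%:C * r0 k) = 1.
Hypothesis r0_eig : forall j, MU F U0 r0 j = b0 * r0 j.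
Hypothesis r0_unique : forall w u, cabs w <= e -> (forall j, MU F U0 u j = w * u j) ->
  (exists j, u j != 0) -> w = b0 /\ forall j, u j = mean (fun k => (v k)%:C * u k) * r0 j.
Hypothesis A1_neq0 : A1 != 0.
Hypothesis deflated : forall u X, (forall j, cabs (MU F U0 u j + (1 - b0) *
     (r0 j * (mean (fun k => r0 k / U0 k * u k) / A1))) <= X) ->
  forall j, cabs (u j) <= 2 * B * X.

Local Notation A := (stability_mx m m).
Definition right_eigenvector : 'cV[R[i]]_N := \col_j ((cabs (m j))%:C * r0 j).
(** The factor [(N%:R * A1)^-1] makes the pairing with the right eigenvector equal to 1; [N]
    compensates for the average inside [A1]. *)
Definition left_eigenvector_mx : 'rV[R[i]]_N :=
  \row_j ((cabs (m j))%:C * ((N%:R * A1)^-1 * r0 j) / (m j * m j)).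
Local Notation rB := right_eigenvector.
Local Notation lB := left_eigenvector_mx.

Let mm0 j : m j * m j != 0. Proof. exact: mulf_neq0. Qed.
Let NC : N%:R != 0 :> R[i]. Proof. by rewrite pnatr_eq0 -lt0n. Qed.

Lemma right_eigenvectorE : A *m rB = b0 *: rB.
Proof.
by apply/colP => j; rewrite stability_mul r0_eig !mxE; ring.
Qed.

Lemma left_eigenvectorE : lB *m A = b0 *: lB.
Proof.
apply/rowP => j; rewrite mul_stability //.
have -> : MU F U0 (fun k => (N%:R * A1)^-1 * r0 k) j = (N%:R * A1)^-1 * (b0 * r0 j).
  rewrite -r0_eig /MU mulrBr; congr (_ - _).
  rewrite /Fapp !mulr_sumr; apply: eq_bigr => k _; ring.
by rewrite !mxE; ring.
Qed.

Lemma left_pairing (x : 'cV[R[i]]_N) :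
  (lB *m x) 0 0 = mean (fun j => r0 j / U0 j * (x j 0 / (cabs (m j))%:C)) / A1.
Proof.
rewrite mxE /mean -mulrA mulrC -mulrA -invfM mulr_suml; apply: eq_bigr => j _.
rewrite !mxE /U_of; by field; rewrite mmC A1_neq0 NC m_neq0.
Qed.

Lemma left_right_pairing : lB *m rB = 1%:M.
Proof.
apply/matrixP => i k; rewrite !ord1 left_pairing !mxE eqxx mulr1n.
rewrite (eq_mean (y := fun j => r0 j / U0 j * r0 j)) ?divff // => j.
by congr (_ * _); rewrite mxE mulrAC divff // mul1r.
Qed.

Lemma stability_isolated : isolated_simple_eigenvalue A e.
Proof.
have [j0 rj0] : exists j, r0 j != 0.
  apply: contrapT => H; move/eqP: A1_neq0; apply.
  rewrite /A1 (eq_mean (y := fun k => 0 * r0 k)) ?meanZ ?mul0r // => j.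
  have -> : r0 j = 0 by apply/eqP; apply: contrapT => /negP hj; apply: H; exists j.
  by rewrite !mulr0.
exists b0; split => //.
- by apply/(eigenvalue_stabilityP _ mm0); exists r0; split=> //; exists j0.
- apply: (simple_eigenvalue_mup right_eigenvectorE left_eigenvectorE).
    by rewrite left_right_pairing mxE eqxx.
  move=> u hu; have H := left_eigen_function mm0 hu.
  have [->|u0] := eqVneq u 0; first by exists 0; rewrite scale0r.
  have [j1 uj1] : exists j, u 0 j != 0.
    apply: contrapT => H'; move/eqP: u0; apply; apply/rowP => j; rewrite mxE.
    by apply/eqP; apply: contrapT => /negP hj; apply: H'; exists j.
  have [|_ E] := r0_unique (ltW b0_lt) H.
    by exists j1; apply: mulf_neq0; [exact: mulf_neq0 | rewrite invr_eq0].
  set c := mean _ in E.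
  exists (c * (N%:R * A1)); apply/rowP => j; rewrite !mxE.
  have -> : u 0 j = c * r0 j * (cabs (m j))%:C / (m j * m j).
    by rewrite -E; field; rewrite mmC m_neq0.
  by field; rewrite A1_neq0 NC m_neq0.
- move=> w /(eigenvalue_stabilityP _ mm0)[u [u0 hu]] we.
  by have [] := r0_unique we hu u0.
Qed.

(** Transports the bound [deflated] through the conjugation by [|m|], which costs a factor [L] on
    either side, hence [2 * B * L ^ 2] as the bound for the inverse. *)
Lemma stability_projection : spectral_projection A e = rB *m lB.
Proof.
have L0 : 0 < L by exact: lt_le_trans L_ge1.
apply: (spectral_projection_rank_one e_gt0 (K := 2 * B * L ^+ 2) _ Ke b0_lt
  right_eigenvectorE left_eigenvectorE left_right_pairing).
- by apply: mulr_ge0; [exact: mulr_ge0 | rewrite exprn_ge0 // ltW].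
- move=> u X hX j.
  pose y k := u k 0 / (cabs (m k))%:C.
  have uE : u = \col_k ((cabs (m k))%:C * y k).
    by apply/colP => k; rewrite mxE /y mulrC divfK.
  have X0 : 0 <= X by apply: le_trans (hX j); exact: cabs_ge0.
  have mg k : 0 < cabs (m k) by rewrite cabs_gt0.
  have H k : cabs (MU F U0 y k + (1 - b0) *
     (r0 k * (mean (fun i => r0 i / U0 i * y i) / A1))) <= L * X.
    have := hX k; rewrite (_ : (_ *m u) k 0 = (cabs (m k))%:C * (MU F U0 y k + (1 - b0) *
     (r0 k * (mean (fun i => r0 i / U0 i * y i) / A1)))); last first.
      rewrite mulmxDl -scalemxAl -mulmxA mulrDr; set s := (1 - b0) *: _.
      rewrite [LHS]mxE {1}uE stability_mul; congr (_ + _).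
      by rewrite /s !mxE big_ord1 mxE left_pairing; ring.
    rewrite cabsM cabs_real gtr0_norm // => h.
    apply: le_trans (_ : L * (cabs (m k) * _) <= _); last exact: ler_wpM2l (ltW L0) _ _ h.
    rewrite mulrA ler_peMl ?cabs_ge0 //.
    have /andP[h1 _] := m_bnd k; rewrite -(mulfV (lt0r_neq0 L0)) ler_wpM2l // ltW //.
  have yb := deflated H j; rewrite uE mxE cabsM cabs_real gtr0_norm //.
  have /andP[_ h2] := m_bnd j.
  have := ler_pM (ltW (mg j)) (cabs_ge0 _) h2 yb; lra.
- move=> w we; apply: injective_unitmx => x hx.
  have xE : x = \col_k ((cabs (m k))%:C * (x k 0 / (cabs (m k))%:C)).
    by apply/colP => k; rewrite mxE mulrC divfK.
  have H k : MU F U0 (fun k => x k 0 / (cabs (m k))%:C) k = w * (x k 0 / (cabs (m k))%:C).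
    apply: (mulfI (mmC k)); rewrite -stability_mul -xE.
    move: hx; rewrite mulmxBl mul_scalar_mx => /eqP; rewrite subr_eq0 => /eqP <-.
    by rewrite mxE; field; exact: mmC.
  apply/colP => k; rewrite mxE; apply/eqP; apply: contrapT => /negP xk.
  have we' : cabs w <= e by rewrite we.
  have [|wb _] := r0_unique we' H.
    by exists k; apply: mulf_neq0; rewrite ?invr_eq0.
  by move: b0_lt; rewrite -wb we ltxx.
Qed.

End StabilityMatrix.

Lemma cdot_adjmx (R : realType) (N : nat) (P : 'M[R[i]]_N) (y : 'cV[R]_N) (x : 'cV[R[i]]_N) :
  cdot (adjmx P *m cvec y) x = mean (fun k => (y k 0)%:C * (P *m x) k 0).
Proof.
rewrite /cdot /avg /mean; congr (_ * _).
under eq_bigr do rewrite mxE mxE mxE raddf_sum /= mulr_suml.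
rewrite exchange_big /=; apply: eq_bigr => k _; rewrite [(P *m x) k 0]mxE mulr_sumr.
apply: eq_bigr => j _; rewrite !mxE.
have -> : conjc (conjc (P k j) * (y k 0)%:C) = P k j * (y k 0)%:C.
  by case: (P k j) => a b; apply/eqP; rewrite eq_complex /=; apply/andP; split; apply/eqP; ring.
ring.
Qed.

(** With the projection written as right times left eigenvector, the normalization [<v, r0> = 1]
    reduces the pairing with [b_left] to [sg] times the left eigenvector. In the quotient this [sg]
    and the normalization of the left eigenvector cancel; the [sg] from [b_right] remains. *)
Lemma xi_amplitude (R : realType) (N : nat) (S : 'M[R]_N) (e : R)
    (m : R[i] -> 'cV[R[i]]_N) (v : R[i] -> 'cV[R]_N) (z zeta : R[i]) (r0 : 'I_N -> R[i]) :
  let mz := fun j => m z j 0 in let vz := fun j => v z j 0 in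
  (0 < N)%N -> (forall j, mz j != 0) ->
  mean (fun j => r0 j / U_of mz mz mz j * r0 j) != 0 ->
  mean (fun j => (vz j)%:C * r0 j) = 1 ->
  mean (fun j => vz j * profile mz j) != 0 ->
  spectral_projection (Bop S m z z) e = right_eigenvector mz r0 *m left_eigenvector_mx mz r0 ->
  xi S e m v z zeta = amplitude vz mz (fun j => m zeta j 0) (profile mz) r0.
Proof.
move=> mz vz N_gt0 m0 A1_0 v_r0 sg0 proj.
have mmC j : (cabs (mz j))%:C != 0 :> R[i].
  by rewrite eq_complex /= eqxx andbT gt_eqF // cabs_gt0.
pose sg := avg (vmul (v z) (fvec m z)).
have sgE : sg = mean (fun j => vz j * profile mz j).
  rewrite /sg /avg /mean; congr (_ * _); apply: eq_bigr => j _.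
  by rewrite !mxE rho_density.
have sgC : sg%:C != 0 :> R[i] by rewrite sgE eq_complex /= eqxx andbT.
have left_form x : cdot (b_left S e m v z) x = sg%:C * (left_eigenvector_mx mz r0 *m x) 0 0.
  have -> : cdot (b_left S e m v z) x = sg%:C * cdot (adjmx (spectral_projection (Bop S m z z) e)
      *m cvec (vmul (map_mx GRing.inv (abs_vec (m z))) (v z))) x.
    rewrite /cdot /avg [RHS]mulrCA; congr (_ * _); rewrite mulr_sumr; apply: eq_bigr => j _.
    rewrite [LHS]mxE [in RHS]mxE mulrA; congr (_ * _); rewrite mxE [in RHS]mxE /b_left -/sg.
    by rewrite mxE; case: (_ j 0) => a b; apply/eqP; rewrite eq_complex /=;
       apply/andP; split; apply/eqP; ring.
  rewrite cdot_adjmx proj; congr (_ * _); rewrite -mulmxA.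
  set c := (left_eigenvector_mx mz r0 *m x) 0 0.
  rewrite (eq_mean (y := fun k => c * ((vz k)%:C * r0 k))) ?meanZ ?v_r0 ?mulr1 // => k.
  rewrite [(right_eigenvector _ _ *m _) k 0]mxE big_ord1 -/c !mxE.
  rewrite rmorphM fmorphV /vz; field; exact: mmC.
have right_form : (left_eigenvector_mx mz r0 *m b_right S e m v z) 0 0 = sg%:C *
    (left_eigenvector_mx mz r0 *m cvec (vmul (abs_vec (m z)) (v z))) 0 0.
  rewrite /b_right -/sg -scalemxAr proj mulmxA mulmxA left_right_pairing // mul1mx.
  by rewrite mxE.
rewrite /xi !left_form right_form !left_pairing //.
rewrite /amplitude -sgE.
have e1 : mean (fun j => r0 j / U_of mz mz mz j * ((m zeta - m z) j 0 / (cabs (mz j))%:C)) =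
  mean (fun j => r0 j / U_of mz mz mz j * ((m zeta j 0 - mz j) / (cabs (mz j))%:C)).
  by apply: eq_mean => j; rewrite !mxE.
have e2 : mean (fun j => r0 j / U_of mz mz mz j *
    (cvec (vmul (abs_vec (m z)) (v z)) j 0 / (cabs (mz j))%:C)) =
  mean (fun j => r0 j / U_of mz mz mz j * (vz j)%:C).
  apply: eq_mean => j; congr (_ * _); rewrite !mxE rmorphM.
  by rewrite mulrAC /mz divff ?mul1r //; exact: mmC.
rewrite e1 e2; move: A1_0.
move: (mean (fun j => r0 j / U_of mz mz mz j * r0 j)).
move: (mean (fun j => r0 j / U_of mz mz mz j * (vz j)%:C)).
move: (mean (fun j => r0 j / U_of mz mz mz j * ((m zeta j 0 - mz j) / (cabs (mz j))%:C))).
move=> p a2 a1 a1_0; rewrite !invfM !invrK; move: a2^-1 => a2'; field.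
by rewrite a1_0 sgC.
Qed.

(** * The expansion for a pair of nearby points *)

Section PairExpansion.
Variables (R : realType) (N : nat) (L0 L B e dl : R) (S : 'M[R]_N).
Variables (m : R[i] -> 'cV[R[i]]_N) (v : R[i] -> 'cV[R]_N) (z zeta : R[i]).
Local Notation mz := (fun j => m z j 0).
Local Notation mzeta := (fun j => m zeta j 0).
Local Notation mzc := (fun j => conjc (m z j 0)).
Local Notation Sf := (fun j k => S j k).
Local Notation vz := (fun j => v z j 0).
Local Notation F := (fun j k => cabs (m z j 0) * S j k * cabs (m z k 0)).
Hypotheses (N_gt0 : (0 < N)%N) (L0_ge1 : 1 <= L0).
Hypotheses (L_E : L = 8 * L0 ^+ 5) (B_E : B = 84 * L ^+ 5).
Hypothesis S_sym : forall j k, S j k = S k j.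
Hypothesis S_bnd : forall j k, L0^-1 / N%:R <= S j k <= L0 / N%:R.
Hypothesis z_im : 0 < complex.Im z.
Hypothesis z_sol : solves Sf z mz.
Hypothesis z_bnd : forall j, L0^-1 <= cabs (m z j 0) <= L0.
Hypothesis v_top : top_eigenvector (Fop S m z) (v z).
Hypotheses (e_gt0 : 0 < e) (e_small : 96 * B ^+ 2 * L ^+ 2 * e <= 1).
Hypothesis tau_small : B ^+ 30 * (rho m z + (rho m z)^-1 * `|complex.Im z|) <= e.

Let rh := density mz.
Let ka := complex.Im z / density mz.
Let f := profile mz.

Let L_ge1 : 1 <= L. Proof. by rewrite L_E; exact: profile_const_ge1. Qed.
Let L_gt0 : 0 < L. Proof. exact: lt_le_trans L_ge1. Qed.
Let B84 : 84 <= B. Proof. exact: const_ge84 L_ge1 B_E. Qed.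
Let B_ge0 : 0 <= B. Proof. have := B84; lra. Qed.
Let L_le_B : L <= B.
Proof. have := L_le_const L_ge1 B_E; have := L_ge1; lra. Qed.
Let rh_gt0 : 0 < rh. Proof. by rewrite /rh; exact: (density_gt0 N_gt0 z_sol). Qed.
Let ka_ge0 : 0 <= ka. Proof. by rewrite /ka; exact: (ratio_ge0 N_gt0 z_im z_sol). Qed.
Let tauE : rho m z + (rho m z)^-1 * `|complex.Im z| = rh + ka.
Proof. by rewrite rho_density gtr0_norm // [_^-1 * _]mulrC. Qed.
Let tau_le : B ^+ 30 * (rh + ka) <= e. Proof. by rewrite -tauE. Qed.
Let tau_ge0 : 0 <= rh + ka. Proof. by rewrite addr_ge0 // ltW. Qed.
Let e_le1 : 84 * e <= 1.
Proof.
apply: le_trans e_small; apply: ler_pM => //; rewrite ?(ltW e_gt0) //.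
have h := mulr_ege1 (exprn_ege1 2 (_ : 1 <= B)) (exprn_ege1 2 L_ge1).
have := h (le_trans (_ : 1 <= 84) B84); lra.
Qed.
Let f_bnd j : L^-1 <= f j <= L.
Proof. by rewrite L_E; exact: (profile_bnd N_gt0 L0_ge1 S_bnd z_im z_sol z_bnd). Qed.
Let m_bnd j : L^-1 <= cabs (m z j 0) <= L.
Proof. by rewrite L_E; exact: (profile_modulus_bnd L0_ge1 z_bnd). Qed.
Let F_bnd j k : L^-1 / N%:R <= F j k <= L / N%:R.
Proof. by rewrite L_E; exact: (symmetrized_bnd N_gt0 L0_ge1 S_bnd z_bnd). Qed.
Let F_sym j k : F j k = F k j.
Proof. exact: (symmetrized_sym (S := Sf) S_sym mz). Qed.
Let m_neq0 j : m z j 0 != 0. Proof. exact: (solves_neq0 z_sol j). Qed.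
Let v_gt0 j : 0 < v z j 0. Proof. by case: v_top. Qed.
Let v_norm : mean (fun j => v z j 0 ^+ 2) = 1.
Proof.
case: v_top => _ _ <-; rewrite /avg /mean; congr (_ * _); apply: eq_bigr => j _.
by rewrite mxE expr2.
Qed.

Let perron : exists2 lam, forall j, \sum_k F j k * v z k 0 = lam * v z j 0 &
  2^-1 <= lam <= 1 /\ 1 - lam <= L ^+ 2 * ka.
Proof.
have [_ [lam [_ hv _]] _] := v_top; exists lam.
  move=> j; have /colP/(_ j) := hv; rewrite !mxE => <-.
  by apply: eq_bigr => k _; rewrite mxE.
have E j : \sum_k F j k * v z k 0 = lam * v z j 0.
  have /colP/(_ j) := hv; rewrite !mxE => <-.
  by apply: eq_bigr => k _; rewrite mxE.
have := perron_value N_gt0 L0_ge1 S_sym S_bnd z_im z_sol z_bnd v_gt0 E.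
rewrite -L_E -/ka => /andP[h1 h2]; split => //.
have h3 : L ^+ 2 * ka <= B ^+ 2 * (rh + ka).
  apply: ler_pM => //; rewrite ?exprn_ge0 ?(ltW L_gt0) //.
    by rewrite lerXn2r ?nnegrE // ltW.
  by rewrite lerDr ltW.
have := @pow_small _ B _ e 2 B84 tau_ge0 tau_le isT; have := e_le1; have := e_gt0.
move=> h4 h5 h6; apply/andP; split; lra.
Qed.

Let base : exists b0 r0, 
  [/\ cabs b0 <= B ^+ 6 * (rh + ka) /\ (forall j, U_of mz mz mz j != 0),
   (forall j, cabs (r0 j - (v z j 0)%:C) <= B ^+ 8 * (rh + ka)) /\
   (forall j, cabs (r0 j / U_of mz mz mz j - (v z j 0)%:C) <= B ^+ 9 * (rh + ka)),
   mean (fun k => (v z k 0)%:C * r0 k) = 1,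
   forall j, MU F (U_of mz mz mz) r0 j = b0 * r0 j &
   forall w u, cabs w <= e -> (forall j, MU F (U_of mz mz mz) u j = w * u j) ->
     (exists j, u j != 0) ->
     w = b0 /\ forall j, u j = mean (fun k => (v z k 0)%:C * u k) * r0 j].
Proof.
have [lam v_eig [lam_bnd lam_ka]] := perron.
exact: (base_eigenpair N_gt0 L_ge1 F_sym F_bnd v_gt0 v_eig v_norm lam_bnd B_E e_gt0 e_small
  m_bnd f_bnd rh_gt0 ka_ge0 (profile_im N_gt0 L0_ge1 z_sol z_bnd) lam_ka tau_le).
Qed.

Lemma isolated_at : isolated_simple_eigenvalue (Bop S m z z) e.
Proof.
have [lam v_eig [lam_bnd lam_ka]] := perron.
have [b0 [r0 [[b0_le U_neq0] [r0_le l0_le] v_r0 r0_eig r0_unique]]] := base.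
have A1_0 := base_overlap_neq0 N_gt0 L_ge1 F_bnd v_gt0 v_eig v_norm lam_bnd B_E e_gt0 e_small
  rh_gt0 ka_ge0 tau_le r0_le l0_le v_r0.
have b0_lt : cabs b0 < e.
  apply: le_lt_trans b0_le _.
  by have := @pow_small _ B _ e 6 B84 tau_ge0 tau_le isT; have := e_gt0; lra.
exact: (stability_isolated (S := Sf) N_gt0 S_sym m_neq0 b0_lt r0_eig r0_unique A1_0).
Qed.

Hypothesis zeta_im : 0 < complex.Im zeta.
Hypothesis zeta_sol : solves Sf zeta mzeta.
Hypothesis zeta_bnd : forall j, L0^-1 <= cabs (m zeta j 0) <= L0.
Hypothesis m_conj : forall j, m (conjc z) j 0 = conjc (m z j 0).
Hypothesis near : forall j, cabs (m zeta j 0 - m z j 0) <= dl.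
Hypothesis dl_small : B ^+ 30 * (L * dl) <= e.

Let mzeta_bnd j : L^-1 <= cabs (m zeta j 0) <= L.
Proof. by rewrite L_E; exact: (profile_modulus_bnd L0_ge1 zeta_bnd). Qed.
Let mzeta_neq0 j : m zeta j 0 != 0. Proof. exact: (solves_neq0 zeta_sol j). Qed.

Let conj_diff j : m zeta j 0 - mzc j =
  mzc j * m zeta j 0 * (zeta - conjc z + \sum_k (S j k)%:C * (m zeta k 0 - mzc k)).
Proof.
have E1 := (proj1 zeta_sol j); have := congr1 (@conjc R) (proj1 z_sol j).
rewrite rmorphM rmorphD rmorph_sum rmorphN1 /= => E2.
have E3 : mzc j * (conjc z + \sum_k (S j k)%:C * mzc k) = -1.
  rewrite -E2; congr (_ * (_ + _)); apply: eq_bigr => k _.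
  by case: (m z k 0) => a b; apply/eqP; rewrite eq_complex /=; apply/andP; split; apply/eqP; ring.
have -> : \sum_k (S j k)%:C * (m zeta k 0 - mzc k) =
  \sum_k (S j k)%:C * m zeta k 0 - \sum_k (S j k)%:C * mzc k.
  by rewrite -sumrB; apply: eq_bigr => k _; rewrite mulrBr.
transitivity (mzc j * (m zeta j 0 * (zeta + \sum_k (S j k)%:C * m zeta k 0)) -
  m zeta j 0 * (mzc j * (conjc z + \sum_k (S j k)%:C * mzc k))); last by ring.
by rewrite E1 E3; ring.
Qed.

Let minimal (a b : 'I_N -> R[i]) beta : (forall j, a j * b j != 0) ->
  smallest_eigenvalue (stability_mx Sf a b) beta ->
  (exists u, (exists j, u j != 0) /\ forall j, MU F (U_of mz a b) u j = beta * u j) /\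
  (forall b' u, (exists j, u j != 0) -> (forall j, MU F (U_of mz a b) u j = b' * u j) ->
    cabs beta <= cabs b').
Proof.
move=> ab [h1 h2]; split; first by apply/(eigenvalue_stabilityP S_sym m_neq0 beta ab).
move=> b' u u0 hu; apply: h2; apply/(eigenvalue_stabilityP S_sym m_neq0 b' ab).
by exists u.
Qed.

Lemma pair_expansion :
  (z != zeta -> forall beta, smallest_eigenvalue (Bop S m z zeta) beta ->
     beta_expansion m z (12 * B ^+ 4 * B ^+ 22) (error_bound S e m v z zeta)
       (zeta - z) (xi S e m v z zeta) beta) /\
  (forall beta, smallest_eigenvalue (Bop S m (conjc z) zeta) beta ->
     beta_expansion m z (12 * B ^+ 4 * B ^+ 22) (error_bound S e m v z zeta)
       (zeta - conjc z) (xi S e m v z zeta + 2 * 'i%C * (rho m z)%:C) beta).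
Proof.
have [lam v_eig [lam_bnd lam_ka]] := perron.
have [b0 [r0 [[b0_le U_neq0] [r0_le l0_le] v_r0 r0_eig r0_unique]]] := base.
have f_E := profile_im N_gt0 L0_ge1 z_sol z_bnd.
have A1_0 := base_overlap_neq0 N_gt0 L_ge1 F_bnd v_gt0 v_eig v_norm lam_bnd B_E e_gt0 e_small
  rh_gt0 ka_ge0 tau_le r0_le l0_le v_r0.
have inv := base_inverse N_gt0 L_ge1 F_sym F_bnd v_gt0 v_eig v_norm lam_bnd B_E e_gt0 e_small
  m_bnd f_bnd rh_gt0 ka_ge0 f_E lam_ka tau_le b0_le r0_le l0_le v_r0.
have b0_lt : cabs b0 < e.
  apply: le_lt_trans b0_le _.
  by have := @pow_small _ B _ e 6 B84 tau_ge0 tau_le isT; have := e_gt0; lra.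
have Ke : 2 * B * L ^+ 2 * e < 1.
  have B1 : B <= B ^+ 2 by rewrite expr2 ler_peMl //; have := B84; lra.
  have p : 0 < B * (L ^+ 2 * e) by rewrite !mulr_gt0 ?exprn_gt0 //; have := B84; lra.
  have h : B * (L ^+ 2 * e) <= B ^+ 2 * (L ^+ 2 * e).
    by rewrite ler_wpM2r // mulr_ge0 ?(ltW e_gt0) ?exprn_ge0 // ltW.
  have := e_small; lra.
have proj := stability_projection (S := Sf) N_gt0 S_sym m_neq0 e_gt0 B_ge0 L_ge1 Ke m_bnd
  b0_lt r0_eig r0_unique A1_0 inv.
have sg0 : mean (fun j => v z j 0 * profile mz j) != 0.
  rewrite gt_eqF // mean_gt0 // => j; rewrite mulr_gt0 //.
  by case/andP: (f_bnd j) => + _; apply: lt_le_trans; rewrite invr_gt0.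
have xiE := xi_amplitude zeta N_gt0 m_neq0 A1_0 v_r0 sg0 proj.
have errE : error_bound S e m v z zeta =
  cabs (amplitude vz mz mzeta f r0) + (rh + ka) by rewrite /error_bound xiE -addrA tauE.
have ffE : avg (vmul (fvec m z) (fvec m z)) = mean (fun j => f j * f j).
  rewrite /avg /mean; congr (_ * _); apply: eq_bigr => j _.
  by rewrite !mxE rho_density.
have [G [G_bnd G_att]] := argmax_attained
  (fun j => (m zeta j 0 - m z j 0) / (cabs (m z j 0))%:C) N_gt0.
have G_small : B ^+ 30 * G <= e.
  apply: le_trans dl_small; rewrite ler_wpM2l ?exprn_ge0 //.
  case: G_att => j ->; rewrite cabsM cabsV cabs_real gtr0_norm ?cabs_gt0 // mulrC.
  apply: ler_pM; rewrite ?invr_ge0 ?cabs_ge0 //.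
  rewrite -[L]invrK lef_pV2 ?posrE ?invr_gt0 ?cabs_gt0 //.
  by case/andP: (m_bnd j).
have f_eq := profile_eq N_gt0 L0_ge1 z_sol z_bnd.
have f_pi := profile_pi N_gt0 L0_ge1 z_sol z_bnd.
have diff := solution_diff z_sol zeta_sol.
split.
  move=> zz beta hb.
  have w0 : zeta - z != 0 by rewrite subr_eq0 eq_sym.
  have ab j : mz j * mzeta j != 0 by rewrite mulf_neq0.
  have [h1 h2] := minimal ab hb.
  rewrite /beta_expansion errE ffE xiE.
  exact: (expansion_same N_gt0 L_ge1 F_sym F_bnd v_gt0 v_eig v_norm lam_bnd B_E e_gt0 e_small
    m_bnd mzeta_bnd f_bnd rh_gt0 ka_ge0 f_E f_eq lam_ka f_pi tau_le b0_le U_neq0 r0_le l0_le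
    v_r0 r0_eig diff G_bnd G_att G_small w0 h1 h2).
move=> beta hb.
have ab j : mzc j * mzeta j != 0 by rewrite mulf_neq0 // conjc_eq0.
have BE : Bop S m (conjc z) zeta = stability_mx Sf mzc mzeta.
  by rewrite /Bop /stability_mx; congr (_ - _); apply/matrixP => j k; rewrite !mxE m_conj.
rewrite BE in hb.
have [h1 h2] := minimal ab hb.
rewrite /beta_expansion errE ffE xiE rho_density.
have im0 j : 0 <= complex.Im (m zeta j 0) by rewrite ltW //; case: zeta_sol.
exact: (expansion_conj N_gt0 L_ge1 F_sym F_bnd v_gt0 v_eig v_norm lam_bnd B_E e_gt0 e_small
  m_bnd mzeta_bnd f_bnd rh_gt0 ka_ge0 f_E im0 f_eq lam_ka f_pi tau_le b0_le U_neq0 r0_le l0_le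
  v_r0 r0_eig diff G_bnd G_att G_small conj_diff h1 h2).
Qed.

End PairExpansion.

(** * Smallness in a disk around a singular point *)

Section EdgeDisk.
Variables (R : realType) (N : nat) (S : 'M[R]_N) (m : R[i] -> 'cV[R[i]]_N).
Variables (c_inf C_sup C_m L0 Ch dl r E0 : R).
Local Notation Sf := (fun j k => S j k).
Hypotheses (N_gt0 : (0 < N)%N) (c_inf_gt0 : 0 < c_inf).
Hypotheses (C_sup_gt0 : 0 < C_sup) (C_m_gt0 : 0 < C_m).
(** [c_inf^-1] and [C_sup] bound the entries of [S], and [C_m] bounds [|m|]. The inverse
    [|m|^-1 = |z + S m|] is at most [C_sup * C_m + C_sup + 4] from [z] plus [C_sup * C_m] from
    [S m]. *)
Hypothesis L0_E : L0 = c_inf^-1 + C_sup + C_m + 2 * (C_sup * C_m) + 4.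
(* The numeral is kept behind an equation: unary naturals make [384 * 800] unmanageable. *)
Hypothesis Ch_E : forall c, c = 384 * 800 ->
  Ch = 8 * (2 * L0 ^+ 4) ^+ 4 + c * (2 * L0 ^+ 4) ^+ 36.
Hypothesis S_sym : forall j k, S j k = S k j.
Hypothesis S_A : assumptionA c_inf C_sup S.
Hypothesis m_qve : qve_solution S m.
Hypothesis m_C : assumptionC C_m m.
Hypothesis E0_sing : singular_set m E0.
Hypotheses (dl_gt0 : 0 < dl) (r_gt0 : 0 < r) (r_dl : r <= dl) (r_le1 : r <= 1).
Hypothesis r_cube : Ch * (2 * r) <= dl ^+ 3.

Lemma edge_const_ge1 : 1 <= L0.
Proof.
have h1 : 0 < c_inf^-1 by rewrite invr_gt0.
have h2 : 0 < C_sup * C_m by exact: mulr_gt0.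
rewrite L0_E; move: c_inf^-1 (C_sup * C_m) h1 h2 C_sup_gt0 C_m_gt0 => a b; lra.
Qed.
Let L0_ge1 := edge_const_ge1.
Let L0_gt0 : 0 < L0. Proof. exact: lt_le_trans L0_ge1. Qed.
Let N0 : 0 < N%:R :> R. Proof. by rewrite ltr0n. Qed.
Let Cp : 0 < C_sup * C_m. Proof. exact: mulr_gt0. Qed.

Lemma edge_variance_bnd j k : L0^-1 / N%:R <= S j k <= L0 / N%:R.
Proof.
have [h1 h2] := andP (S_A j k); have i0 : 0 < c_inf^-1 by rewrite invr_gt0.
apply/andP; split.
  apply: le_trans h1; rewrite ler_wpM2r ?invr_ge0 ?(ltW N0) //.
  rewrite -[c_inf]invrK lef_pV2 ?posrE // L0_E.
  move: c_inf^-1 (C_sup * C_m) i0 Cp C_sup_gt0 C_m_gt0 => a b; lra.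
apply: le_trans h2 _; rewrite ler_wpM2r ?invr_ge0 ?(ltW N0) // L0_E.
move: c_inf^-1 (C_sup * C_m) i0 Cp C_sup_gt0 C_m_gt0 => a b; lra.
Qed.

Let S_pos j k : 0 <= S j k <= C_sup / N%:R.
Proof.
have [h1 ->] := andP (S_A j k); rewrite andbT; apply: le_trans h1.
by rewrite divr_ge0 // ltW.
Qed.

Let lower z (u : 'I_N -> R[i]) : solves Sf z u -> (forall j, cabs (u j) <= C_m) ->
  cabs z <= C_sup * C_m + C_sup + 4 -> forall j, L0^-1 <= cabs (u j) <= L0.
Proof.
move=> u_sol u_le z_le j; have i0 : 0 < c_inf^-1 by rewrite invr_gt0.
apply/andP; split; last first.
  apply: le_trans (u_le j) _; rewrite L0_E.
  move: c_inf^-1 (C_sup * C_m) i0 Cp C_sup_gt0 C_m_gt0 => a b; lra.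
have ug : 0 < cabs (u j) by rewrite cabs_gt0 (solves_neq0 u_sol).
rewrite -[cabs (u j)]invrK.
rewrite lef_pV2 ?posrE ?invr_gt0 //.
have E : cabs (u j) * cabs (z + \sum_k (S j k)%:C * u k) = 1.
  by rewrite -cabsM (proj1 u_sol) cabsN cabs1.
have -> : (cabs (u j))^-1 = cabs (z + \sum_k (S j k)%:C * u k).
  by rewrite -[LHS]mulr1 -E mulKf // gt_eqF.
have h : cabs (\sum_k (S j k)%:C * u k) <= C_sup * C_m.
  apply: le_trans (cabs_sum _ _) _.
  apply: le_trans (ler_sum _ (_ : forall k, true -> _ <= C_sup / N%:R * C_m)) _.
    move=> k _; have /andP[s0 s1] := S_pos j k; rewrite cabsM cabs_real ger0_norm //.
    by apply: ler_pM; rewrite ?cabs_ge0.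
  rewrite sumr_const card_ord -[_ *+ N]mulr_natr le_eqVlt; apply/orP; left; apply/eqP.
  by field; rewrite gt_eqF.
apply: le_trans (cabsD _ _) _; rewrite L0_E.
move: c_inf^-1 (C_sup * C_m) i0 Cp C_sup_gt0 C_m_gt0 z_le h => a b; lra.
Qed.

Let in_disk z := 0 < complex.Im z /\ cabs (z - E0%:C) <= r.

Let m_le z : 0 < complex.Im z -> forall j, cabs (m z j 0) <= C_m.
Proof. by move=> z0 j; apply: m_C; rewrite gt_eqF. Qed.

Let points : (exists y, in_disk y /\ density (fun j => m y j 0) <= r) /\
  exists y, in_disk y /\ complex.Im y <= r * density (fun j => m y j 0).
Proof.
by have [[y [h1 h2 h3]] [y' [h1' h2' h3']]] := edge_points N_gt0 m_qve E0_sing r_gt0;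
  split; [exists y | exists y'].
Qed.

Let dist z z' : in_disk z -> in_disk z' -> cabs (z' - z) <= 2 * r.
Proof.
move=> [_ h1] [_ h2]; have -> : z' - z = (z' - E0%:C) - (z - E0%:C) by ring.
by apply: le_trans (cabsB _ _) _; lra.
Qed.

(** [energy_bound] applies at the point where [Im y] is below the density; the diameter [2 * r <= 2]
    raises its constant 2 to 4. *)
Let disk_size z : in_disk z -> cabs z <= C_sup * C_m + C_sup + 4.
Proof.
move=> hz; have [_ [y [hy hyr]]] := points.
have [y0 _] := hy.
have ysol := qve_solves m_qve y0.
have d0 := density_gt0 N_gt0 ysol.
have y1 : complex.Im y <= density (fun j => m y j 0).
  by apply: le_trans hyr _; rewrite ler_piMl // ltW.
have := energy_bound N_gt0 m_qve C_sup_gt0 C_m_gt0 S_pos y0 (m_le y0) y1.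
have -> : z = y + (z - y) by ring.
have := dist hy hz; have := cabsD y (z - y); have := r_le1.
move: (C_sup * C_m) => b; lra.
Qed.

Lemma edge_modulus_bnd z : 0 < complex.Im z -> cabs (z - E0%:C) <= r ->
  forall j, L0^-1 <= cabs (m z j 0) <= L0.
Proof.
move=> z0 zr; apply: (lower (qve_solves m_qve z0) (m_le z0)).
exact: disk_size.
Qed.

(** Two solutions at the same [z]: [holder_cube] at distance 0 makes them equal. *)
Lemma edge_conj z : 0 < complex.Im z -> cabs (z - E0%:C) <= r ->
  forall j, m (conjc z) j 0 = conjc (m z j 0).
Proof.
move=> z0 zr j.
have c_sol := qve_solves_conj m_qve z0.
have zc : complex.Im (conjc z) != 0 by case: (z) z0 => a b /= b0; rewrite oppr_eq0 gt_eqF.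
have c_le k : cabs (conjc (m (conjc z) k 0)) <= C_m by rewrite cabs_conj; exact: m_C.
have c_bnd := lower c_sol c_le (disk_size (conj z0 zr)).
have := holder_cube N_gt0 L0_ge1 S_sym edge_variance_bnd z0 z0 (qve_solves m_qve z0) c_sol
  (edge_modulus_bnd z0 zr) c_bnd erefl erefl j; rewrite -(Ch_E erefl).
rewrite subrr cabs0 mulr0 => h.
have : cabs (conjc (m (conjc z) j 0) - m z j 0) ^+ 3 == 0.
  by rewrite eq_le h exprn_ge0 // cabs_ge0.
by rewrite expf_eq0 /= cabs_eq0 subr_eq0 => /eqP <-; rewrite conjcK.
Qed.

Lemma edge_near z z' : 0 < complex.Im z -> cabs (z - E0%:C) <= r ->
  0 < complex.Im z' -> cabs (z' - E0%:C) <= r ->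
  forall j, cabs (m z' j 0 - m z j 0) <= dl.
Proof.
move=> z0 zr z0' zr' j.
rewrite -(@ler_pXn2r _ 3) ?nnegrE ?cabs_ge0 ?(ltW dl_gt0) //.
apply: le_trans r_cube.
apply: le_trans (holder_cube N_gt0 L0_ge1 S_sym edge_variance_bnd z0 z0' (qve_solves m_qve z0)
  (qve_solves m_qve z0') (edge_modulus_bnd z0 zr) (edge_modulus_bnd z0' zr') erefl erefl j) _.
have [c cE] : exists c : R, c = 384 * 800 by eexists.
have c_ge0 : 0 <= c by rewrite cE mulr_ge0 ?ler0n.
rewrite -(Ch_E erefl); apply: ler_wpM2l; last by apply: dist.
have p : 0 <= 2 * L0 ^+ 4 by rewrite mulr_ge0 ?ler0n // exprn_ge0 // ltW.
rewrite (Ch_E cE) addr_ge0 // mulr_ge0 ?ler0n //; exact: exprn_ge0.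
Qed.

Lemma edge_density z : 0 < complex.Im z -> cabs (z - E0%:C) <= r ->
  density (fun j => m z j 0) <= 2 * dl.
Proof.
move=> z0 zr; have [[y [[y0 yr] hy]] _] := points.
have d : mean (fun j => complex.Im (m z j 0)) - mean (fun j => complex.Im (m y j 0)) <= dl.
  rewrite -meanB; apply: mean_le => // j.
  apply: le_trans (edge_near y0 yr z0 zr j); apply: le_trans (cabs_Im _).
  by rewrite cImD cImN ler_norm.
have p1 : 0 < pi^-1 :> R by rewrite invr_gt0 pi_gt0.
have p2 : pi^-1 <= 1 :> R.
  by rewrite invf_le1 ?pi_gt0 //; apply: le_trans (pi_ge2 R); lra.
move: hy; rewrite /density; move: (mean _) (mean _) d => a b d hy.
have := ler_wpM2l (ltW p1) d; have := ler_wpM2r (ltW dl_gt0) p2.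
have := r_dl; move: (pi^-1) hy => p hy; lra.
Qed.

(** Compared with the point of [points] whose ratio is at most [dl]: that point gives [L0 ^ 4 * dl],
    the comparison [8 * L0 ^ 6 * dl]. *)
Lemma edge_ratio z : 0 < complex.Im z -> cabs (z - E0%:C) <= r ->
  complex.Im z / density (fun j => m z j 0) <= 9 * L0 ^+ 6 * dl.
Proof.
move=> z0 zr; have [_ [y [[y0 yr] hy]]] := points.
have d0 := density_gt0 N_gt0 (qve_solves m_qve y0).
apply: le_trans (ratio_comparison N_gt0 L0_ge1 S_sym edge_variance_bnd z0 y0
  (qve_solves m_qve z0) (qve_solves m_qve y0) (edge_modulus_bnd z0 zr) (edge_modulus_bnd y0 yr)
  (edge_near z0 zr y0 yr)) _.
have h : complex.Im y / density (fun j => m y j 0) <= dl.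
  by rewrite ler_pdivrMr //; apply: le_trans hy _; rewrite ler_wpM2r // ltW.
have h1 : L0 ^+ 4 * (complex.Im y / density (fun j => m y j 0)) <= L0 ^+ 6 * dl.
  apply: ler_pM => //; first by rewrite exprn_ge0 // ltW.
    by rewrite divr_ge0 // ltW.
  by rewrite ler_weXn2l.
by apply: le_trans (lerD h1 (lexx _)) _; rewrite le_eqVlt; apply/orP; left; apply/eqP; ring.
Qed.

End EdgeDisk.

(** * Choice of constants and conclusion *)

Lemma constants_exist (R : realType) (c_inf C_sup C_m : R) :
  0 < c_inf -> 0 < C_sup -> 0 < C_m ->
  exists L0 L B e Ch dl r : R,
  [/\ L0 = c_inf^-1 + C_sup + C_m + 2 * (C_sup * C_m) + 4, L = 8 * L0 ^+ 5, B = 84 * L ^+ 5,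
      0 < e & 96 * B ^+ 2 * L ^+ 2 * e <= 1] /\
  [/\ forall c, c = 384 * 800 -> Ch = 8 * (2 * L0 ^+ 4) ^+ 4 + c * (2 * L0 ^+ 4) ^+ 36,
      0 < dl & B ^+ 30 * (11 * L0 ^+ 6 * dl) <= e] /\
  [/\ 0 < r, r <= dl, r <= 1 & Ch * (2 * r) <= dl ^+ 3].
Proof.
move=> c0 C0 Cm0.
have [L0 L0_E] : exists L0, L0 = c_inf^-1 + C_sup + C_m + 2 * (C_sup * C_m) + 4 by eexists.
have L0_1 : 1 <= L0 := edge_const_ge1 c0 C0 Cm0 L0_E.
have [L LE] : exists L, L = 8 * L0 ^+ 5 by eexists.
have L_1 : 1 <= L by rewrite LE; exact: profile_const_ge1.
have [B BE] : exists B, B = 84 * L ^+ 5 by eexists.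
have B_1 : 1 <= B by have := const_ge84 L_1 BE; lra.
have L0n n : 1 <= L0 ^+ n by exact: exprn_ege1.
have K1 : 1 <= B ^+ 2 * L ^+ 2 := mulr_ege1 (exprn_ege1 2 B_1) (exprn_ege1 2 L_1).
have [K KE] : exists K, K = 96 * B ^+ 2 * L ^+ 2 by eexists.
have K1' : 1 <= K by rewrite KE -mulrA; move: (_ * _) K1 => y; lra.
have K0 : 0 < K by exact: lt_le_trans K1'.
have e0 : 0 < K^-1 by rewrite invr_gt0.
have e1 : K^-1 <= 1 by rewrite invf_le1.
(* The factor 11 is [2 + 9], from the bounds on density and ratio, and also covers [L = 8 * L0 ^ 5].
   Below, the radius is cubic in [dl] because of the Hoelder exponent 1/3. *)
have [D DE] : exists D, D = B ^+ 30 * (11 * L0 ^+ 6) by eexists.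
have D1 : 1 <= D.
  rewrite DE; apply: mulr_ege1; first exact: exprn_ege1.
  have := L0n 6; lra.
have D0 : 0 < D by exact: lt_le_trans D1.
have [Ch ChE] : exists Ch, forall c, c = 384 * 800 ->
    Ch = 8 * (2 * L0 ^+ 4) ^+ 4 + c * (2 * L0 ^+ 4) ^+ 36.
  by exists (8 * (2 * L0 ^+ 4) ^+ 4 + (384 * 800) * (2 * L0 ^+ 4) ^+ 36) => c ->.
have p1 : 1 <= 2 * L0 ^+ 4 by have := L0n 4; lra.
have Ch1 : 1 <= Ch.
  rewrite (ChE _ erefl); apply: (@le_trans _ _ (8 * (2 * L0 ^+ 4) ^+ 4)).
    have := exprn_ege1 4 p1; lra.
  rewrite lerDl; apply: mulr_ge0; first by rewrite mulr_ge0 ?ler0n.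
  by rewrite exprn_ge0 // (le_trans _ p1).
have Ch0 : 0 < Ch by exact: lt_le_trans Ch1.
have [dl dlE] : exists dl, dl = K^-1 / D by eexists.
have dl0 : 0 < dl by rewrite dlE divr_gt0.
have dl1 : dl <= 1.
  by rewrite dlE ler_pdivrMr // mul1r; apply: le_trans e1 D1.
have rE : Ch * (2 * (dl ^+ 3 / (2 * Ch))) = dl ^+ 3 by field; rewrite gt_eqF.
have r0 : 0 < dl ^+ 3 / (2 * Ch) by rewrite divr_gt0 ?exprn_gt0 ?mulr_gt0.
have r1 : dl ^+ 3 / (2 * Ch) <= dl.
  rewrite ler_pdivrMr ?mulr_gt0 // exprS; apply: ler_wpM2l; first exact: ltW.
  apply: (@le_trans _ _ 1); last by move: Ch1; clear; lra.
  by rewrite exprn_ile1 // ltW.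
exists L0, L, B, K^-1, Ch, dl, (dl ^+ 3 / (2 * Ch)); split; first split => //.
  by rewrite -KE divff // gt_eqF.
split; first split => //.
  have -> : B ^+ 30 * (11 * L0 ^+ 6 * dl) = D * dl by rewrite DE; ring.
  by rewrite dlE mulrCA divff ?mulr1 // gt_eqF.
by split => //; [exact: le_trans r1 dl1 | rewrite rE].
Qed.

Lemma variance_sym (R : realType) (d : measure_display) (T : measurableType d)
    (P : probability T R) (N : nat) (H : T -> 'M[R[i]]_N) j k :
  (forall w, H w = adjmx (H w)) -> variance_mx P H j k = variance_mx P H k j.
Proof.
move=> hH; rewrite !mxE; congr (fine ('E_P[_])%E); apply: funext => w.
by rewrite {1}hH !mxE cabs_conj.
Qed.

Theorem proposition6p4 (R : realType) (c_inf C_sup C_m : R) (C_mom : nat -> R)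
    (c_inf_gt0 : 0 < c_inf) (C_sup_gt0 : 0 < C_sup) (C_m_gt0 : 0 < C_m)
    (C_mom_gt0 : forall p, 0 < C_mom p) :
  exists eps C : R, [/\ 0 < eps, 0 < C &
  forall eps0 : R, 0 < eps0 ->
  exists2 c_star : R, 0 < c_star &
  forall c0 : R, 0 < c0 -> c0 <= c_star ->
  forall (N : nat) (d : measure_display) (T : measurableType d)
    (P : probability T R) (H : T -> 'M[R[i]]_N)
    (m : R[i] -> 'cV[R[i]]_N) (v : R[i] -> 'cV[R]_N) (E0 : R),
  let S := variance_mx P H in
  let DH := Ddisk N E0 eps0 c0 `&` @Hplane R in
  (0 < N)%N ->
  wigner_type P H ->
  assumptionA c_inf C_sup S ->
  assumptionB P C_mom H ->
  qve_solution S m ->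
  assumptionC C_m m ->
  (forall z, Hplane z -> top_eigenvector (Fop S m z) (v z)) ->
  singular_set m E0 ->
  (forall z, DH z -> isolated_simple_eigenvalue (Bop S m z z) eps) /\
  (forall z zeta, DH z -> DH zeta ->
    (z != zeta -> forall beta, smallest_eigenvalue (Bop S m z zeta) beta ->
       beta_expansion m z C (error_bound S eps m v z zeta)
         (zeta - z) (xi S eps m v z zeta) beta) /\
    (forall beta, smallest_eigenvalue (Bop S m (conjc z) zeta) beta ->
       beta_expansion m z C (error_bound S eps m v z zeta)
         (zeta - conjc z)
         (xi S eps m v z zeta + 2 * 'i%C * (rho m z)%:C) beta))].
Proof.
have [L0 [L [B [e [Ch [dl [r [[L0_E L_E B_E e_gt0 e_small] [[Ch_E dl_gt0 dl_e]
  [r_gt0 r_dl r_le1 r_cube]]]]]]]]]] := constants_exist c_inf_gt0 C_sup_gt0 C_m_gt0.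
have L0_ge1 : 1 <= L0 := edge_const_ge1 c_inf_gt0 C_sup_gt0 C_m_gt0 L0_E.
have L_ge1 : 1 <= L by rewrite L_E; exact: profile_const_ge1.
have B_gt0 : 0 < B by have := const_ge84 L_ge1 B_E; lra.
exists e, (12 * B ^+ 4 * B ^+ 22); split => //; first by rewrite !mulr_gt0 ?exprn_gt0.
(* The threshold [c_star] is the radius [r], fixed before [N] and [H] appear. *)
move=> eps0 eps0_gt0; exists r => // c0 c0_gt0 c0_r N d T P H m v E0 S DH N_gt0 [_ H_sym _ _ _].
move=> S_A _ m_qve m_C v_top E0_sing.
have S_sym j k : S j k = S k j by exact: variance_sym.
(* [N >= 1] and a nonpositive exponent make the power of [N] at most 1, so the shrinking disk lies
   in the fixed disk of radius [r]. *)
have inDH z : DH z -> 0 < complex.Im z /\ cabs (z - E0%:C) <= r.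
  move=> [hz z0]; split => //; apply: le_trans hz _; apply: le_trans c0_r.
  rewrite ler_piMr ?(ltW c0_gt0) //.
  apply: (@le_trans _ _ (N%:R `^ 0)); last by rewrite powRr0.
  by apply: ler_powR; rewrite ?ler1n // oppr_le0 divr_ge0 // ltW.
have S_bnd := edge_variance_bnd N_gt0 c_inf_gt0 C_sup_gt0 C_m_gt0 L0_E S_A.
have z_bnd z (hz : DH z) := edge_modulus_bnd N_gt0 c_inf_gt0 C_sup_gt0 C_m_gt0 L0_E S_A m_qve
  m_C E0_sing r_gt0 r_le1 (proj1 (inDH z hz)) (proj2 (inDH z hz)).
have z_conj z (hz : DH z) := edge_conj N_gt0 c_inf_gt0 C_sup_gt0 C_m_gt0 L0_E Ch_E S_sym S_A m_qve
  m_C E0_sing r_gt0 r_le1 (proj1 (inDH z hz)) (proj2 (inDH z hz)).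
have near z z' (hz : DH z) (hz' : DH z') := edge_near N_gt0 c_inf_gt0 C_sup_gt0 C_m_gt0 L0_E Ch_E
  S_sym S_A m_qve m_C E0_sing dl_gt0 r_gt0 r_le1 r_cube
  (proj1 (inDH z hz)) (proj2 (inDH z hz)) (proj1 (inDH z' hz')) (proj2 (inDH z' hz')).
have tau_small z : DH z -> B ^+ 30 * (rho m z + (rho m z)^-1 * `|complex.Im z|) <= e.
  move=> hz; have [z0 zr] := inDH z hz.
  apply: le_trans dl_e; apply: ler_wpM2l; first by rewrite exprn_ge0 // ltW.
  rewrite rho_density gtr0_norm // [_^-1 * _]mulrC.
  have h1 := edge_density N_gt0 c_inf_gt0 C_sup_gt0 C_m_gt0 L0_E Ch_E S_sym S_A m_qve m_C
    E0_sing dl_gt0 r_gt0 r_dl r_le1 r_cube z0 zr.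
  have h2 := edge_ratio N_gt0 c_inf_gt0 C_sup_gt0 C_m_gt0 L0_E Ch_E S_sym S_A m_qve m_C
    E0_sing dl_gt0 r_gt0 r_dl r_le1 r_cube z0 zr.
  apply: le_trans (lerD h1 h2) _.
  have h3 : 2 * dl <= 2 * (L0 ^+ 6 * dl).
    by rewrite ler_wpM2l // ler_peMl ?(ltW dl_gt0) // exprn_ege1.
  have -> : 11 * L0 ^+ 6 * dl = 2 * (L0 ^+ 6 * dl) + 9 * L0 ^+ 6 * dl by ring.
  by rewrite lerD2r.
have dl_small : B ^+ 30 * (L * dl) <= e.
  apply: le_trans dl_e; apply: ler_wpM2l; first by rewrite exprn_ge0 // ltW.
  rewrite L_E; apply: ler_wpM2r; first exact: ltW.
  have : L0 ^+ 5 <= L0 ^+ 6 by rewrite ler_weXn2l.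
  have : 0 <= L0 ^+ 6 by rewrite exprn_ge0 // (le_trans _ L0_ge1).
  clear; lra.
split=> [z hz | z zeta hz hzeta].
  have [z0 _] := inDH z hz.
  exact: (isolated_at N_gt0 L0_ge1 L_E B_E S_sym S_bnd z0 (qve_solves m_qve z0) (z_bnd z hz)
    (v_top z z0) e_gt0 e_small (tau_small z hz)).
have [z0 _] := inDH z hz; have [zeta0 _] := inDH zeta hzeta.
exact: (pair_expansion N_gt0 L0_ge1 L_E B_E S_sym S_bnd z0 (qve_solves m_qve z0) (z_bnd z hz)
  (v_top z z0) e_gt0 e_small (tau_small z hz) (qve_solves m_qve zeta0) (z_bnd zeta hzeta)
  (z_conj z hz) (near z zeta hz hzeta) dl_small).
Qed.
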